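(* For any fixed integers $k,\ell\ge 2$, there is a polynomial-time algorithm that, given a semicomplete digraph $D$ (with $|V(D)|\ge k$), decides whether $\kappa_k(D)\ge \ell$.
   Context: Digraphs are finite, without loops and without parallel arcs. A digraph is semicomplete if there is at least one arc between any pair of distinct vertices. A digraph is strong if for every ordered pair of vertices $u,v$ there is a directed path from $u$ to $v$; a one-vertex digraph is strong. For $S\subseteq V(D)$, strong subgraphs $D_1,\dots,D_p$ of $D$ each containing $S$ are $S$-internally disjoint if $V(D_i)\cap V(D_j)=S$ and $A(D_i)\cap A(D_j)=\emptyset$ for all $i<j$. $\kappa_S(D)$ is the maximum number of $S$-internally disjoint strong subgraphs containing $S$, and for $2\le k\le |V(D)|$, $\kappa_k(D)=\min\{\kappa_S(D): S\subseteq V(D),\ |S|=k\}$. *)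

(* Defs.v *)
From mathcomp Require Import all_boot.
Set Implicit Arguments. Unset Strict Implicit. Unset Printing Implicit Defensive.

(* No parallel arcs is automatic; loops are excluded by [loopless].    *)
Section Digraph.
Variable n : nat.
Implicit Types (D : rel 'I_n).

Definition loopless D : bool := [forall v : 'I_n, ~~ D v v].

Definition semicomplete D : bool :=
  [forall u : 'I_n, forall v : 'I_n, (u != v) ==> (D u v || D v u)].

Definition subdigraph D (V : {set 'I_n}) (A : {set 'I_n * 'I_n}) : bool :=
  [forall a in A, [&& D a.1 a.2, a.1 \in V & a.2 \in V]].

Definition strongb (V : {set 'I_n}) (A : {set 'I_n * 'I_n}) : bool :=
  [forall u in V, forall v in V, connect (fun x y => (x, y) \in A) u v].

Definition S_int_disjoint_family D (S : {set 'I_n}) p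
    (F : {ffun 'I_p -> {set 'I_n} * {set 'I_n * 'I_n}}) : bool :=
  [&& [forall i, subdigraph D (F i).1 (F i).2],
      [forall i, strongb (F i).1 (F i).2],
      [forall i, S \subset (F i).1] &
      [forall i : 'I_p, forall j : 'I_p, (i < j)%N ==>
          (((F i).1 :&: (F j).1 == S) && ((F i).2 :&: (F j).2 == set0))]].

Definition has_family D S p : bool :=
  [exists F : {ffun 'I_p -> {set 'I_n} * {set 'I_n * 'I_n}},
     S_int_disjoint_family D S F].

(* kappa_S(D): maximum number of S-internally disjoint strong subgraphs
   containing S.  For |S| >= 2 every member has an arc and the arc sets
   are disjoint, so this number is at most n*n; the cap is not binding. *)
Definition kappaS D (S : {set 'I_n}) : nat :=
  \max_(p < (n * n).+1 | has_family D S p) p.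

(* kappa_k(D) = min over S with |S| = k of kappa_S(D)
   (the neutral element n*n is irrelevant when 2 <= k <= n). *)
Definition kappa_k D (k : nat) : nat :=
  \big[minn/(n * n)]_(S : {set 'I_n} | #|S| == k) kappaS D S.

Definition encode D : seq bool :=
  [seq D u v | u <- enum 'I_n, v <- enum 'I_n].
End Digraph.

(* States 'I_q.+1, tape symbols 'I_g.+3: 0 = blank, 1 = bit false,     *)
(* 2 = bit true.                                                       *)
Inductive move := MLeft | MRight | MStay.

Record TM := mkTM {
  tm_q : nat;
  tm_g : nat;
  tm_start : 'I_tm_q.+1;
  tm_acc : 'I_tm_q.+1;
  tm_rej : 'I_tm_q.+1;
  tm_delta : 'I_tm_q.+1 -> 'I_tm_g.+3 -> 'I_tm_q.+1 * 'I_tm_g.+3 * move }.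

Section TMsem.
Variable M : TM.
Local Notation St := 'I_(tm_q M).+1.
Local Notation Sy := 'I_(tm_g M).+3.

(* configuration: state, left tape (reversed), head symbol, right tape *)
Definition config : Type := (St * seq Sy * Sy * seq Sy)%type.

Definition blank : Sy := ord0.
Definition sym_of_bit (b : bool) : Sy := inord (1 + b).

Definition halted (q : St) : bool := (q == @tm_acc M) || (q == @tm_rej M).

Definition step (c : config) : config :=
  let: (q, l, h, r) := c in
  if halted q then c else
  let: (q', h', m) := @tm_delta M q h in
  match m with
  | MStay => (q', l, h', r)
  | MLeft => match l with
             | [::] => (q', [::], blank, h' :: r)
             | x :: l' => (q', l', x, h' :: r)
             end
  | MRight => match r with
              | [::] => (q', h' :: l, blank, [::])
              | x :: r' => (q', h' :: l, x, r')
              end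
  end.

Definition init (w : seq bool) : config :=
  match map sym_of_bit w with
  | [::] => (@tm_start M, [::], blank, [::])
  | x :: r => (@tm_start M, [::], x, r)
  end.

Definition tm_result (w : seq bool) (t : nat) : option bool :=
  let: (q, _, _, _) := iter t step (init w) in
  if q == @tm_acc M then Some true
  else if q == @tm_rej M then Some false else None.
End TMsem.

(* Main.v *)
(** Fix a set [S] of [k] vertices.  In a strong subgraph containing [S], each
    vertex of [S] has an out-neighbour outside [S] from which all its other such
    out-neighbours can be reached outside [S], and dually an in-neighbour; joining
    these at most [2 * k] representatives by paths shows that, up to boundedly
    many guessed vertices, a family of [l] strong subgraphs is a linkage of at most
    [2 * k * l] disjoint paths.

    Take such a family with the fewest vertices and cut its paths into blocks of
    constant length.  Paths of a minimum linkage have no forward chords, so the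
    current block of a path dominates the vertices passed before it.  If no path
    could advance by one block without this block dominating many vertices still
    ahead, then following the path on which these vertices lie would close a cycle
    along which the paths can be rerouted with fewer vertices.  Hence the blocks
    can be swept one at a time so that, up to boundedly many exceptional vertices, the swept vertices
    stay recognizable from the current blocks alone.  A sweep is therefore a walk
    in a graph whose states are tuples of boundedly many vertices; conversely
    every walk yields disjoint paths, because the set of swept vertices is required
    to grow and each new block must avoid it.  What remains is reachability in a
    graph of polynomial size with arcs given by a formula with one universal
    quantifier, which a loop program over relational tables, compiled to a
    Turing machine, decides. *)
Require Import Defs.
From mathcomp Require Import all_boot.
From mathcomp Require Import zify.
From Stdlib Require Import FunctionalExtensionality.
Set Implicit Arguments. Unset Strict Implicit. Unset Printing Implicit Defensive.

(** * Sweeping a minimum linkage *)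

(** The obstacle is to recognise swept vertices without storing them. Forward chords being excluded,
    every vertex of a block, except perhaps the first, dominates all that precedes the block on its
    own path. A vertex off the linkage that is dominated from one place of a path is dominated from
    every place at least three further on, since otherwise a detour through it would save a vertex.
    With two failures allowed per block, domination by the current blocks therefore persists when a
    block advances. The false alarms that matter are future path vertices, and bounding their number
    is the invariant of the sweep. Only arcs with both ends in [S] can be contested between members,
    because members meet in [S] alone. A member may thus be given all arcs of [D] on its vertices
    except inside [S], where ownership is recorded. This makes it semicomplete outside [S], as the
    choice of representatives demands, and it turns minimising the vertices of a family into
    minimising a linkage. *)

Section Linkage.
Variables (V T : finType) (D : rel V) (Gs : {set V}) (a b : T -> V).

Definition linked (t : T) (p : seq V) : bool :=
  if p is [::] then a t == b t else path D (a t) (rcons p (b t)).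

Definition linkage (X : T -> seq V) : Prop :=
  [/\ forall t, linked t (X t),
      forall t v, v \in X t -> v \notin Gs
    & forall t t' v, v \in X t -> v \in X t' -> t = t'].

Definition supp (X : T -> seq V) : {set V} := [set v | [exists t, v \in X t]].

Lemma suppP (X : T -> seq V) v : reflect (exists t, v \in X t) (v \in supp X).
Proof. by rewrite inE; apply: existsP. Qed.

Hypothesis semi : forall u v, u != v -> D u v || D v u.
Variables (X : T -> seq V) (W : nat) (v0 : V).
Hypothesis HX : linkage X.
Hypothesis Xuniq : forall t, uniq (X t).
Hypothesis Xmin : forall Y, linkage Y -> #|supp X| <= #|supp Y|.

Local Notation x t i := (nth v0 (X t) i).

Lemma mem_x t i : i < size (X t) -> x t i \in X t.
Proof. exact: mem_nth. Qed.

Lemma x_supp t i : i < size (X t) -> x t i \in supp X.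
Proof. by move=> h; apply/suppP; exists t; apply: mem_x. Qed.

Lemma x_inj t t' i i' : i < size (X t) -> i' < size (X t') ->
  x t i = x t' i' -> t = t' /\ i = i'.
Proof.
move=> hi hi' E; have [_ _ dis] := HX.
have Et : t = t' by apply: (dis _ _ (x t i)); rewrite ?mem_x // E mem_x.
subst t'; split=> //; apply/eqP; rewrite -(nth_uniq v0 hi hi' (Xuniq t)); exact/eqP.
Qed.

Lemma X_path t : X t != [::] -> path D (a t) (rcons (X t) (b t)).
Proof. by have [/(_ t) + _ _] := HX; rewrite /linked; case: (X t). Qed.

Lemma x_step t i : i.+1 < size (X t) -> D (x t i) (x t i.+1).
Proof.
move=> hi; have /X_path : X t != [::] by case: (X t) hi.
move/(pathP v0)/(_ i.+1); rewrite size_rcons ltnS => /(_ (ltnW hi)).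
rewrite -rcons_cons !nth_rcons /= hi.
by rewrite ltnS (ltnW hi).
Qed.

Lemma splice_linked t i m j : i < size (X t) -> j < size (X t) ->
  path D (x t i) (rcons m (x t j)) ->
  linked t (take i.+1 (X t) ++ m ++ drop j (X t)).
Proof.
move=> hi hj pm; have ne : X t != [::] by case: (X t) hi.
have pX := X_path ne.
rewrite /linked (take_nth v0 hi) cat_rcons.
case E : (take i (X t) ++ _) => [|y p]; first by case: (take i _) E.
rewrite -{y p}E rcons_cat cat_path.
have Xi : rcons (X t) (b t) = take i (X t) ++ x t i :: rcons (drop i.+1 (X t)) (b t).
  by rewrite -rcons_cons -(drop_nth v0 hi) -rcons_cat cat_take_drop.
have Xj : rcons (X t) (b t) = take j (X t) ++ x t j :: rcons (drop j.+1 (X t)) (b t).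
  by rewrite -rcons_cons -(drop_nth v0 hj) -rcons_cat cat_take_drop.
move: (pX); rewrite Xi cat_path /= => /and3P[-> -> _] /=.
move: pX; rewrite Xj cat_path /= => /and3P[_ _ pj].
rewrite (drop_nth v0 hj) rcons_cat cat_path /=.
by move: pm; rewrite rcons_path => /andP[-> ->] /=.
Qed.

(** The spliced family is again a linkage, so minimality of [X] charges the new vertices against
    those cut out between [i] and [j]. *)
Lemma splice_linkage t i m j : i < size (X t) -> j < size (X t) ->
  path D (x t i) (rcons m (x t j)) -> i < j ->
  {in m, forall z, z \notin Gs /\ z \notin supp X} ->
  #|supp X| <= size m + #|supp X :\: [set v | [exists h : 'I_(size (X t)), (i < h < j) && (v == x t h)]]|.
Proof.
move=> hi hj pm ltij hm.
pose Y t' := if t' == t then take i.+1 (X t) ++ m ++ drop j (X t) else X t'.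
have [l1 l2 l3] := HX.
have YX t' v : v \in Y t' -> v \in X t' \/ v \in m.
  rewrite /Y; case: eqP => [->|_]; last by left.
  by rewrite !mem_cat => /or3P[/mem_take|->|/mem_drop]; [left|right|left].
have LY : linkage Y; first split.
- move=> t'; rewrite /Y; case: eqP => [->|_] //; exact: splice_linked.
- by move=> t' v /YX[/l2//|/hm[]].
- move=> t1 t2 v; rewrite /Y.
  case: (eqVneq t1 t) => [->|n1]; case: (eqVneq t2 t) => [->|n2] //; last exact: l3.
  + rewrite !mem_cat => /or3P[/mem_take h1|/hm[_ /suppP h1]|/mem_drop h1] h2; try exact: (l3 _ _ v).
    by case: h1; exists t2.
  + move=> h2; rewrite !mem_cat => /or3P[/mem_take h1|/hm[_ /suppP h1]|/mem_drop h1]; try exact: (l3 _ _ v).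
    by case: h1; exists t1.
apply: leq_trans (Xmin LY) _.
set Z := _ :\: _.
have sub : supp Y \subset [set z in m] :|: Z.
  apply/subsetP=> v /suppP[t' vY]; rewrite !inE.
  case vm: (v \in m) => //=.
  have vX : v \in X t' by case: (YX _ _ vY) => //; rewrite vm.
  apply/andP; split; last by apply/existsP; exists t'.
  apply/existsP=> -[h /andP[hh /eqP Ev]].
  have Et : t' = t by apply: (l3 _ _ v) => //; rewrite Ev mem_x.
  subst t'; move: vY; rewrite /Y eqxx !mem_cat vm /= Ev => /orP[].
    move/(nthP v0) => [h']; rewrite size_take_min => lt'; rewrite nth_take; last lia.
    by move=> E; have [||_ ?] := x_inj _ _ E; rewrite ?ltn_ord //; lia.
  move/(nthP v0) => [h']; rewrite size_drop => lt'; rewrite nth_drop.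
  move=> E; have [||E2] := x_inj _ _ E; rewrite ?ltn_ord -?ltn_subRL //; lia.
apply: leq_trans (subset_leq_card sub) _; apply: leq_trans (leq_card_setU _ _) _.
by rewrite leq_add2r cardsE card_size.
Qed.

(** A forward chord would be a shortcut that drops [x t i.+1]. *)
Lemma x_nochord t i j : i.+2 <= j -> j < size (X t) -> ~~ D (x t i) (x t j).
Proof.
move=> hij hj; apply/negP=> Dij.
have hi : i < size (X t) by lia.
have := @splice_linkage t i [::] j hi hj; rewrite /= Dij => /(_ isT).
move=> /(_ ltac:(lia)) /(_ ltac:(by [])).
set Z := [set v | _]; rewrite add0n leqNgt => /negP; apply.
apply: proper_card; apply/properP; split; first exact: subsetDl.
have h1 : i.+1 < size (X t) by lia.
exists (x t i.+1); first exact: x_supp.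
rewrite !inE negb_and negbK; apply/orP; left; apply/existsP.
by exists (Ordinal h1); rewrite /= eqxx andbT; lia.
Qed.

Lemma x_back t i j : i.+2 <= j -> j < size (X t) -> D (x t j) (x t i).
Proof.
move=> hij hj; have hi : i < size (X t) by lia.
have : x t j != x t i by apply/eqP=> E; have [_ ?] := x_inj hj hi E; lia.
by move/semi; rewrite (negbTE (x_nochord hij hj)) orbF.
Qed.

(** Were the arc reversed, the detour through [z] would trade one vertex for at least two; this is
    where the distance three comes from. *)
Lemma x_outside t i j z : z \notin Gs -> z \notin supp X ->
  i.+3 <= j -> j < size (X t) -> D (x t i) z -> D (x t j) z.
Proof.
move=> zG zX hij hj Diz.
have : x t j != z by apply: contraNneq zX => <-; exact: x_supp.
move/semi => /orP[//|Dzj]; exfalso.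
have hi : i < size (X t) by lia.
have := @splice_linkage t i [:: z] j hi hj; rewrite /= Diz Dzj => /(_ isT).
move=> /(_ ltac:(lia)) /(_ ltac:(by move=> y; rewrite inE => /eqP->)).
set Z := [set v | _].
have h1 : i.+1 < size (X t) by lia.
have h2 : i.+2 < size (X t) by lia.
have sub : [set x t i.+1; x t i.+2] \subset supp X :&: Z.
  apply/subsetP=> v; rewrite !inE => /orP[]/eqP->; apply/andP; split;
   apply/existsP; try by exists t; rewrite mem_x.
  by exists (Ordinal h1); rewrite /= eqxx andbT; lia.
  by exists (Ordinal h2); rewrite /= eqxx andbT; lia.
have := subset_leq_card sub; rewrite cards2 (nth_uniq v0 h1 h2 (Xuniq t)) (ltn_eqF (ltnSn _)) /=.
by have := cardsID Z (supp X); lia.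
Qed.

(** * Rerouting around a cycle of paths *)

Section Reroute.
Variables (C : pred T) (f : T -> T) (per : T -> nat) (lo : T -> nat) (ai bi : T -> T -> nat).
Variable t0 : T.
Hypothesis Ct0 : C t0.
Hypothesis Cf : forall s, C s -> C (f s).
Hypothesis f_inj : forall s s', C s -> C s' -> f s = f s' -> s = s'.
Hypothesis f_per : forall s, C s -> iter (per s).+1 f s = s.
Hypothesis lo_size : forall s, C s -> lo s < size (X s).
Hypothesis ai_lo : forall s t, C s -> (ai s t).+1 < lo s.
Hypothesis ai_first : forall s t, C s -> t != s -> ai s s < ai s t.
Hypothesis ai_inj : forall s, C s -> injective (ai s).
Hypothesis bi_lo : forall s t, C s -> lo (f s) <= bi s t < size (X (f s)).
Hypothesis bi_last : forall s t, C s -> t != f s -> bi s t < bi s (f s).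
Hypothesis bi_inj : forall s, C s -> injective (bi s).
Hypothesis ab_arc : forall s t, C s -> D (x s (ai s t)) (x (f s) (bi s t)).

(* Along the cycle of [f], path [t] jumps from its index [ai s t] on path [s] to
   index [bi s t] on path [f s], far ahead, and then uses the backward arc there
   to return to [ai (f s) t], until it re-enters itself. *)
Fixpoint zig n s t : seq V :=
  if n is n'.+1 then x (f s) (bi s t) :: x (f s) (ai (f s) t) :: zig n' (f s) t
  else [::].

Let C_iter n s : C s -> C (iter n f s).
Proof. by elim: n => //= n IH /IH; apply: Cf. Qed.

Lemma zig_path n s t : C s ->
  path D (x s (ai s t)) (zig n s t) /\
  last (x s (ai s t)) (zig n s t) = x (iter n f s) (ai (iter n f s) t).
Proof.
elim: n s => //= n IH s Cs; have [p l] := IH _ (Cf Cs).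
rewrite ab_arc // p l andbT -iterS iterSr; split=> //.
have /andP[h1 h2] := bi_lo t Cs.
by apply: x_back => //; have := ai_lo t (Cf Cs); lia.
Qed.

Let pr t := iter (per t) f t.
Let C_pr t : C t -> C (pr t). Proof. exact: C_iter. Qed.
Let f_pr t : C t -> f (pr t) = t. Proof. by move=> Ct; rewrite -iterS f_per. Qed.

(** Path [t] makes [per t] zigzags and so arrives on the predecessor [pr t] of [t]; one more jump
    from there lands on [t] itself, at or beyond [lo t]. *)
Let Y t := if C t then take (ai t t).+1 (X t) ++ zig (per t) t t ++ drop (bi (pr t) t) (X t)
           else X t.

Inductive used t s i : Prop :=
| UsedPre of s = t & i <= ai t t
| UsedPost of s = t & bi (pr t) t <= i
| UsedIn s' of C s' & f s' = s & i = bi s' t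
| UsedOut of i = ai s t.

Let zig_used n s t v : C s -> v \in zig n s t ->
  exists s' i, [/\ C s', i < size (X s'), v = x s' i & used t s' i].
Proof.
elim: n s => //= n IH s Cs; have Cfs := Cf Cs.
rewrite !inE => /or3P[/eqP->|/eqP->|]; last exact: IH.
- exists (f s), (bi s t); split=> //; first by have /andP[] := bi_lo t Cs.
  by apply: (@UsedIn _ _ _ s).
- exists (f s), (ai (f s) t); split=> //; last exact: UsedOut.
  by have := ai_lo t Cfs; have := lo_size Cfs; lia.
Qed.

Let Y_used t v : C t -> v \in Y t ->
  exists s i, [/\ C s, i < size (X s), v = x s i & used t s i].
Proof.
move=> Ct; rewrite /Y Ct !mem_cat => /or3P[|/zig_used-/(_ Ct)//|].
- move=> vT; have vX := mem_take vT; exists t, (index v (X t)).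
  split; rewrite ?index_mem ?nth_index //; apply: UsedPre => //.
  by move: vT; rewrite in_take // ltnS.
- move=> /(nthP v0)[i]; rewrite size_drop nth_drop => hi <-.
  exists t, (bi (pr t) t + i); split=> //; first by rewrite -ltn_subRL.
  by apply: UsedPost => //; apply: leq_addr.
Qed.

Let Y_linked t : C t -> linked t (Y t).
Proof.
move=> Ct; rewrite /Y Ct; have hlo := lo_size Ct.
have /andP[_ hb] := bi_lo t (C_pr Ct); rewrite f_pr // in hb.
apply: splice_linked => //; first by have := ai_lo t Ct; lia.
have [p l] := zig_path (per t) t Ct.
by rewrite rcons_path p l /=; have := ab_arc t (C_pr Ct); rewrite f_pr.
Qed.

(** Other paths land on [t] only from its unique predecessor, before the place where [t] re-enters
    itself, and take off from [t] only after the place where [t] left. *)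
Let used_own t t' i : C t -> t' != t ->
  (i <= ai t t) || (bi (pr t) t <= i) -> ~ used t' t i.
Proof.
move=> Ct ne hi; have /andP[hb1 hb2] := bi_lo t (C_pr Ct); rewrite f_pr // in hb1 hb2.
case=> [E|E|s' Cs' fs' Ei|Ei]; try by rewrite E eqxx in ne.
- have Es : s' = pr t by apply: f_inj; rewrite ?f_pr //; apply: C_pr.
  have := bi_last Cs' (t := t'); rewrite fs' => /(_ ne).
  have := bi_lo t' Cs'; rewrite fs' -Ei.
  by have := ai_lo t Ct; move: hi; rewrite -Es; lia.
- have := ai_first Ct ne; have := ai_lo t' Ct; move: hi; rewrite -Ei; lia.
Qed.

Let used_disjoint t t' s i : C t -> C t' -> C s ->
  used t s i -> used t' s i -> t = t'.
Proof.
move=> Ct Ct' Cs U U'; apply/eqP/negPn/negP => ne.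
have ne' : t' != t by rewrite eq_sym.
case: U (U) => [Es hi|Es hi|s1 C1 f1 E1|E1] U.
- by apply: (used_own Ct ne' (i := i)); [rewrite hi | rewrite -Es].
- by apply: (used_own Ct ne' (i := i)); [rewrite hi orbT | rewrite -Es].
- case: U' => [Es hi|Es hi|s2 C2 f2 E2|E2].
  + by apply: (used_own Ct' ne (i := i)); [rewrite hi | rewrite -Es].
  + by apply: (used_own Ct' ne (i := i)); [rewrite hi orbT | rewrite -Es].
  + have Es : s1 = s2 by apply: f_inj => //; rewrite f1 f2.
    by case/eqP: ne; apply: (bi_inj C2); rewrite -E2 E1 Es.
  + by have := bi_lo t C1; have := ai_lo t' Cs; rewrite f1; lia.
- case: U' => [Es hi|Es hi|s2 C2 f2 E2|E2].
  + by apply: (used_own Ct' ne (i := i)); [rewrite hi | rewrite -Es].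
  + by apply: (used_own Ct' ne (i := i)); [rewrite hi orbT | rewrite -Es].
  + by have := bi_lo t' C2; have := ai_lo t Cs; rewrite f2; lia.
  + by case/eqP: ne; apply: (ai_inj Cs); rewrite -E2 -E1.
Qed.

Let Y_sub t v : v \in Y t -> exists s, [/\ v \in X s & C s = C t].
Proof.
case Ct : (C t); last by rewrite /Y Ct => h; exists t.
by case/(Y_used Ct) => s [i] [Cs hi -> _]; exists s; split=> //; apply: mem_x.
Qed.

(** The new linkage stays within the old support and misses the vertex just before [lo t0], against
    minimality. *)
Lemma reroute : False.
Proof.
have [l1 l2 l3] := HX.
have LY : linkage Y; first split.
- move=> t; case Ct : (C t); first exact: Y_linked.
  by rewrite /Y Ct.
- by move=> t v /Y_sub[s [/l2]].
- move=> t t' v vt vt'; have [s [sX sC]] := Y_sub vt; have [s' [sX' sC']] := Y_sub vt'.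
  have Es := l3 _ _ _ sX sX'; subst s'.
  case Ct : (C t); last first.
    move: vt vt'; rewrite /Y Ct -sC' sC Ct; exact: l3.
  have Ct' : C t' by rewrite -sC' sC.
  have [s1 [i1 [C1 h1 E1 U1]]] := Y_used Ct vt.
  have [s2 [i2 [C2 h2 E2 U2]]] := Y_used Ct' vt'.
  have [Es Ei] := x_inj h1 h2 (etrans (esym E1) E2); subst s2 i2.
  exact: (used_disjoint Ct Ct' C1 U1).
have := Xmin LY; rewrite leqNgt => /negP; apply.
apply: proper_card; apply/properP; split.
  apply/subsetP=> v /suppP[t /Y_sub[s [sX _]]]; apply/suppP; by exists s.
have hl := lo_size Ct0; have ha := ai_lo t0 Ct0.
have hi : (lo t0).-1 < size (X t0) by lia.
exists (x t0 (lo t0).-1); first exact: x_supp.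
apply/suppP=> -[t vY]; have [s [sX sC]] := Y_sub vY.
have Es : s = t0 by apply: (l3 _ _ _ sX); apply: mem_x.
have Ct : C t by rewrite -sC Es.
have [s1 [i1 [C1 h1 E1 U1]]] := Y_used Ct vY.
have [E2 Ei] := x_inj hi h1 E1; subst s1 i1.
case: U1 => [E h|E h|s2 C2 f2 E|E].
- by subst t; lia.
- have := bi_lo t (C_pr Ct); rewrite f_pr //; subst t; lia.
- by have := bi_lo t C2; rewrite f2; lia.
- by have := ai_lo t Ct0; lia.
Qed.

End Reroute.

(** * Cuts of the linkage into blocks *)

Section Cuts.
Hypothesis Wsize : forall t, W %| size (X t).
Hypothesis Wbig : 3 * #|T| + 4 <= W.
Implicit Type sg : T -> nat.

Definition past sg t := take (sg t * W) (X t).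
Definition future sg t := drop (sg t * W) (X t).
Definition last_block sg t := take W (drop ((sg t).-1 * W) (X t)).
(** Two failures are tolerated because the first two vertices of the next block can be closer than
    three places to the end of the old one, and [x_outside] says nothing about them. *)
Definition block_dominates (s : seq V) z := W <= count (fun w => D w z) s + 2.
(** If more than this many future vertices of a path are dominated, at most [W] of them lie in its
    next block, so enough landing points remain beyond that block. *)
Definition cut_bound := W + #|T| + 1.
(* The boundedly many future vertices dominated by the current blocks are the
   exceptional ones of the sweep. *)
Definition good sg := [forall t, forall t',
  (0 < sg t) ==> (count (block_dominates (last_block sg t)) (future sg t') <= cut_bound)].
Definition advance sg t := fun t' => if t' == t then (sg t').+1 else sg t'.

Section Stuck.
Variable sg : T -> nat.
Hypothesis sg_good : good sg.
Local Notation unfinished t := (sg t * W < size (X t)).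
Local Notation N t := (take W (future sg t)).
Hypothesis stuck : forall t, unfinished t -> ~~ good (advance sg t).

Lemma unfinished_size t : unfinished t -> sg t * W + W <= size (X t).
Proof.
have /dvdnP[q ->] := Wsize t; have W0 : 0 < W by lia.
by rewrite ltn_pmul2r // -mulSnr leq_pmul2r.
Qed.

Definition nxt t := if [pick t' | cut_bound < count (block_dominates (N t)) (future sg t')]
                    is Some t' then t' else t.

(** Advancing [t] keeps the blocks of the other paths and only shrinks futures, so a failure of
    [good] is due to the new block of [t]. *)
Lemma nxt_dom t : unfinished t -> cut_bound < count (block_dominates (N t)) (future sg (nxt t)).
Proof.
move=> Ut; rewrite /nxt; case: pickP => [t' //|none]; exfalso.
have := stuck Ut; rewrite negb_forall => /existsP[t1]; rewrite negb_forall => /existsP[t2].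
rewrite negb_imply -ltnNge => /andP[h1 h2].
have h3 : cut_bound < count (block_dominates (last_block (advance sg t) t1)) (future sg t2).
  apply: leq_trans h2 _; rewrite /future /advance; case: eqP => // _.
  by rewrite mulSnr addnC -drop_drop -[X in _ <= count _ X](cat_take_drop W) count_cat leq_addl.
case: (eqVneq t1 t) => [E|ne].
  subst t1; have /negP := negbT (none t2); apply.
  by move: h3; rewrite /last_block /advance eqxx.
have := forallP (forallP sg_good t1) t2.
move: h1 h3; rewrite /last_block /advance (negbTE ne) => -> /=.
by rewrite ltnNge => /negP.
Qed.

Let lo t := sg t * W + W.

Lemma nxt_lo t : unfinished t -> lo (nxt t) + #|T| < size (X (nxt t)).
Proof.
move/nxt_dom => h; have := leq_trans h (count_size _ _).
by rewrite size_drop /cut_bound /lo; lia.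
Qed.

Lemma nxt_unfinished t : unfinished t -> unfinished (nxt t).
Proof. by move/nxt_lo; rewrite /lo; lia. Qed.

Definition bidx s := take #|T|.+1
  [seq j <- iota (lo (nxt s)) (size (X (nxt s)) - lo (nxt s)) | block_dominates (N s) (x (nxt s) j)].
(** Take-off indices. The last vertex of the block is left out, hence [W.-1], to keep the gap of two
    below [lo s]. *)
Definition aidx s :=
  [seq i <- iota (sg s * W) W.-1 | all (fun j => D (x s i) (x (nxt s) j)) (bidx s)].

Lemma size_bidx s : unfinished s -> size (bidx s) = #|T|.+1.
Proof.
move=> Us; rewrite size_takel // size_filter; have hlo := nxt_lo Us.
rewrite -(count_map (fun j => x (nxt s) j)) map_nth_iota; last lia.
rewrite [take (_ - _) _]take_oversize ?size_drop //.
have E : drop W (future sg (nxt s)) = drop (lo (nxt s)) (X (nxt s)) by rewrite drop_drop /lo addnC.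
have := nxt_dom Us; rewrite -(cat_take_drop W (future sg (nxt s))) count_cat E.
have := count_size (block_dominates (N s)) (take W (future sg (nxt s))).
by rewrite size_take_min /cut_bound; lia.
Qed.

Lemma bidxP s j : j \in bidx s ->
  [/\ lo (nxt s) <= j, j < size (X (nxt s)) & block_dominates (N s) (x (nxt s) j)].
Proof.
by move/mem_take; rewrite mem_filter mem_iota => /and3P[-> h1 h2]; split=> //; lia.
Qed.

(** A union bound over [js]. *)
Lemma count_not_all (I J : Type) (P : I -> J -> bool) c (js : seq J) (s : seq I) :
  all (fun j => count (fun i => ~~ P i j) s <= c) js ->
  count (fun i => ~~ all (P i) js) s <= c * size js.
Proof.
elim: js => [|j js IH] /=; first by rewrite (eq_count (a2 := pred0)) ?count_pred0.
case/andP=> hj /IH {}IH; rewrite mulnS; apply: leq_trans (leq_add hj IH).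
rewrite -count_predUI; apply: leq_trans (leq_addr _ _).
by apply: sub_count => i /=; rewrite negb_and.
Qed.

(** Each of the [#|T|.+1] landing points excludes at most two of the [W.-1] candidates. More than
    [#|T|] must remain, which is the origin of [3 * #|T| + 4] in [Wbig]. *)
Lemma size_aidx s : unfinished s -> #|T| < size (aidx s).
Proof.
move=> Us; have hs := unfinished_size Us; set P := fun i j => D (x s i) (x (nxt s) j).
have : all (fun j => count (fun i => ~~ P i j) (iota (sg s * W) W.-1) <= 2) (bidx s).
  apply/allP => j /bidxP[_ _]; rewrite /block_dominates.
  have -> : N s = [seq x s i | i <- iota (sg s * W) W] by rewrite map_nth_iota //; lia.
  rewrite count_map => h.
  have {}h : W <= count (fun i => P i j) (iota (sg s * W) W) + 2 := h.
  have E : count (fun i => P i j) (iota (sg s * W) W) +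
      count (fun i => ~~ P i j) (iota (sg s * W) W) = W.
    by rewrite -[RHS](size_iota (sg s * W)) -(count_predC (fun i => P i j)).
  have EI : iota (sg s * W) W = iota (sg s * W) W.-1 ++ [:: sg s * W + W.-1].
    by rewrite -(iotaD _ _ 1) addn1 prednK //; lia.
  have : count (fun i => ~~ P i j) (iota (sg s * W) W.-1) <= count (fun i => ~~ P i j) (iota (sg s * W) W).
    by rewrite EI count_cat leq_addr.
  by move: E h; lia.
move/count_not_all; rewrite size_bidx //.
have E : count (fun i => all (P i) (bidx s)) (iota (sg s * W) W.-1) +
    count (fun i => ~~ all (P i) (bidx s)) (iota (sg s * W) W.-1) = W.-1.
  by rewrite -[RHS](size_iota (sg s * W)) -(count_predC (fun i => all (P i) (bidx s))).
rewrite size_filter -[X in _ < X]/(count (fun i => all (P i) (bidx s)) _); lia.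
Qed.

(* A path leaves itself first and re-enters itself last, so that its retained ends
   avoid the indices used by the other paths. *)
Definition bi s t := nth 0 (bidx s) (if t == nxt s then #|T| else enum_rank t).
Definition ai s t := nth 0 (aidx s) (if t == s then 0 else (enum_rank t).+1).

Lemma bi_mem s t : unfinished s -> bi s t \in bidx s.
Proof.
by move=> Us; rewrite mem_nth // size_bidx //; case: ifP => // _; rewrite ltnS ltnW.
Qed.

Lemma ai_mem s t : unfinished s -> ai s t \in aidx s.
Proof.
move=> Us; rewrite mem_nth //; apply: leq_trans (size_aidx Us).
by case: ifP => // _; rewrite !ltnS.
Qed.

Lemma aidx_sorted s : sorted ltn (aidx s).
Proof. exact/sorted_filter/iota_ltn_sorted/ltn_trans. Qed.

Lemma bidx_sorted s : sorted ltn (bidx s).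
Proof. exact/take_sorted/sorted_filter/iota_ltn_sorted/ltn_trans. Qed.

Lemma sorted_nth_lt (s : seq nat) i j : sorted ltn s -> i < j -> j < size s ->
  nth 0 s i < nth 0 s j.
Proof. by move=> ss ij js; apply: (sorted_ltn_nth ltn_trans) => //; rewrite inE; lia. Qed.

Lemma sorted_nth_inj (s : seq nat) i j : sorted ltn s -> i < size s -> j < size s ->
  nth 0 s i = nth 0 s j -> i = j.
Proof.
move=> ss hi hj /eqP; rewrite nth_uniq //; first by move/eqP.
exact: (sorted_uniq ltn_trans ltnn).
Qed.

Definition cyc s := (unfinished s) && [exists m : 'I_#|T|, iter m.+1 nxt s == s].
Definition per s : nat :=
  if [pick m : 'I_#|T| | iter m.+1 nxt s == s] is Some m then m else 0.

Lemma cyc_per s : cyc s -> iter (per s).+1 nxt s = s.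
Proof.
case/andP=> _ /existsP[m hm]; rewrite /per; case: pickP => [m' /eqP //|/(_ m)].
by rewrite /= hm.
Qed.

Lemma cyc_nxt s : cyc s -> cyc (nxt s).
Proof.
case/andP=> Us /existsP[m /eqP hm]; rewrite /cyc nxt_unfinished //=.
by apply/existsP; exists m; apply/eqP; rewrite -{2}hm -iterSr.
Qed.

Lemma iter_period p q s : iter p nxt s = s -> iter (q * p) nxt s = s.
Proof. by move=> E; elim: q => // q IH; rewrite mulSn iterD IH. Qed.

(** Both points return to themselves after the product of their two cycle lengths, and their
    iterates agree from the first step on. *)
Lemma nxt_inj_cyc s s' : cyc s -> cyc s' -> nxt s = nxt s' -> s = s'.
Proof.
move=> /cyc_per h /cyc_per h' E.
have := iter_period (per s').+1 h; rewrite mulnC => hs.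
have := iter_period (per s).+1 h'; rewrite mulSn addSn iterSr -E -iterSr => <-.
by rewrite -addSn -mulSn.
Qed.

(** A self-map of a finite set has a cycle, and there [nxt] is a periodic injection, as rerouting
    demands. *)
Lemma stuck_false t : unfinished t -> False.
Proof.
move=> Ut; have /trajectP[i hi Ei] := looping_order nxt t.
have Ui j : unfinished (iter j nxt t).
  by elim: j => //= j IH; apply: nxt_unfinished.
have C0 : cyc (iter i nxt t).
  rewrite /cyc Ui; apply/existsP.
  have ho : order nxt t <= #|T| := max_card _.
  have hm : (order nxt t - i).-1 < #|T| by lia.
  exists (Ordinal hm) => /=; rewrite -iterS -iterD -Ei prednK ?subn_gt0 //.
  by rewrite subnK // ltnW.
have CU s : cyc s -> unfinished s by case/andP.
apply: (@reroute cyc nxt per lo ai bi _ C0) => //.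
- exact: cyc_nxt.
- exact: nxt_inj_cyc.
- exact: cyc_per.
- move=> s Cs; have Cp : cyc (iter (per s) nxt s).
    by elim: (per s) => //= j IH; apply: cyc_nxt.
  have := nxt_lo (CU _ Cp); rewrite -iterS cyc_per //; lia.
- move=> s u /CU Us; have := ai_mem u Us; rewrite mem_filter mem_iota /lo; lia.
- move=> s u /CU Us ne; rewrite /ai eqxx (negbTE ne).
  apply: sorted_nth_lt; rewrite ?aidx_sorted //; apply: leq_trans (size_aidx Us).
  by rewrite !ltnS.
- move=> s /CU Us u u' E; have hz v : (if v == s then 0 else (enum_rank v).+1) < size (aidx s).
    by apply: leq_trans (size_aidx Us); case: ifP => // _; rewrite !ltnS.
  have := sorted_nth_inj (aidx_sorted s) (hz u) (hz u') E.
  case: eqP => [->|_]; case: eqP => [->|_] // [] /val_inj; exact: enum_rank_inj.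
- by move=> s u /CU Us; have [-> ->] := bidxP (bi_mem u Us).
- move=> s u /CU Us ne; rewrite /bi eqxx (negbTE ne).
  by apply: sorted_nth_lt; rewrite ?bidx_sorted ?size_bidx.
- move=> s /CU Us u u' E.
  have hz v : (if v == nxt s then #|T| else enum_rank v) < size (bidx s).
    by rewrite size_bidx //; case: ifP => // _; rewrite ltnS ltnW.
  have := sorted_nth_inj (bidx_sorted s) (hz u) (hz u') E.
  case: eqP => [->|_]; case: eqP => [->|_] //.
  + by move=> F; have := ltn_ord (enum_rank u'); rewrite -F ltnn.
  + by move=> F; have := ltn_ord (enum_rank u); rewrite F ltnn.
  + by move/val_inj; exact: enum_rank_inj.
- move=> s u /CU Us; have := ai_mem u Us; rewrite mem_filter => /andP[/allP h _].
  exact: (h _ (bi_mem u Us)).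
Qed.

End Stuck.

Lemma good_advance sg t : good sg -> sg t * W < size (X t) ->
  exists t', sg t' * W < size (X t') /\ good (advance sg t').
Proof.
move=> g Ut; case: (pickP [pred t | (sg t * W < size (X t)) && good (advance sg t)]).
  by move=> t' /andP[]; exists t'.
move=> none; exfalso; apply: (stuck_false g _ Ut) => t' Ut'.
by have := none t'; rewrite /= Ut' /= => ->.
Qed.

End Cuts.

End Linkage.

(** * Decomposition of strong semicomplete digraphs *)

Lemma uniq_flatten_map (I U : eqType) (f : I -> seq U) (s : seq I) :
  uniq s -> {in s, forall i, uniq (f i)} ->
  {in s &, forall i j v, v \in f i -> v \in f j -> i = j} ->
  uniq (flatten [seq f i | i <- s]).
Proof.
elim: s => //= i s IH /andP[his us] hu hd; rewrite cat_uniq hu ?mem_head //= IH //.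
- rewrite andbT; apply/hasPn=> v /flattenP[_ /mapP[j js ->] vj]; apply/negP=> vi.
  have E : i = j by apply: (hd _ _ _ _ v) => //; rewrite inE ?eqxx ?js ?orbT.
  by rewrite E js in his.
- by move=> j js; apply: hu; rewrite inE js orbT.
- by move=> j j' js js'; apply: hd; rewrite inE ?js ?js' orbT.
Qed.

Section King.
Variables (V : finType) (e : rel V) (A : {set V}).
Definition restr : rel V := [rel u v | [&& u \in A, v \in A & e u v]].

(** Take a vertex with a largest reachable set: a vertex it misses would dominate it and reach
    strictly more. *)
Lemma semicomplete_king : A != set0 ->
  {in A &, forall u v, u != v -> e u v || e v u} ->
  exists2 w, w \in A & {in A, forall v, connect restr w v}.
Proof.
move=> /set0Pn[a0 ha0] semi.
pose reach w := [set v in A | connect restr w v].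
case: (arg_maxnP (fun w => #|reach w|) ha0) => w wA' wmax; have wA : w \in A := wA'; exists w => // v vA.
apply/negPn/negP => nwv.
have newv : v != w by apply: contraNneq nwv => ->; apply: connect0.
have evw : connect restr v w.
  apply: connect1; rewrite /restr /= vA wA /=; case/orP: (semi _ _ vA wA newv) => // ewv.
  by case/negP: nwv; apply: connect1; rewrite /restr /= vA wA.
have := wmax v vA; rewrite /= leqNgt => /negP; apply; apply: proper_card.
apply/properP; split.
  apply/subsetP=> z; rewrite !inE => /andP[-> /(connect_trans evw)->] //.
by exists v; rewrite inE vA ?connect0 //= negbK.
Qed.
End King.

Lemma semicomplete_coking (V : finType) (e : rel V) (A : {set V}) : A != set0 ->
  {in A &, forall u v, u != v -> e u v || e v u} ->
  exists2 w, w \in A & {in A, forall v, connect (restr e A) v w}.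
Proof.
move=> A0 semi.
have [|w wA hw] := @semicomplete_king V (fun u v => e v u) A A0.
  by move=> u v uA vA /(semi _ _ uA vA); rewrite orbC.
exists w => // v /hw hv; have /= <- := connect_rev (restr e A) w v.
apply: (connect_sub _ hv) => x y /and3P[h1 h2 h3].
by apply: connect1; rewrite /restr /= h1 h2.
Qed.

Lemma perm_flatten_cat (I U : eqType) (f g : I -> seq U) (s : seq I) :
  perm_eq (flatten [seq f i ++ g i | i <- s])
          (flatten [seq f i | i <- s] ++ flatten [seq g i | i <- s]).
Proof.
elim: s => //= i s IH; rewrite -!catA perm_cat2l perm_sym perm_catCA perm_cat2l perm_sym.
exact: IH.
Qed.

Lemma flatten_map_filter (I J : Type) (U : eqType) (m : J -> seq U) (f : I -> seq J)
    (g : I -> seq U) (a : pred U) (s : seq I) :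
  all (fun i => flatten [seq m j | j <- f i] == [seq v <- g i | a v]) s ->
  flatten [seq m j | j <- flatten [seq f i | i <- s]]
    = [seq v <- flatten [seq g i | i <- s] | a v].
Proof.
elim: s => //= i s IH /andP[/eqP E /IH {}IH].
by rewrite map_cat flatten_cat filter_cat E IH.
Qed.

Section Segments.
Variables (V : finType) (T : {set V}).
Implicit Types (a v : V) (p acc : seq V).

(** [a] is the last vertex of [T] met and [acc] collects the vertices passed since. A final stretch
    not ending in [T] is lost, so paths are required to end in [T]. *)
Fixpoint segs a acc p : seq (V * seq V * V) :=
  if p is v :: p' then
    if v \in T then (a, acc, v) :: segs v [::] p' else segs a (rcons acc v) p'
  else [::].

(** The virtual arcs standing for the segments. *)
Definition link (sg : seq (V * seq V * V)) : rel V :=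
  [rel u v | has (fun q => (u == q.1.1) && (v == q.2)) sg].

Lemma segs_path (h : rel V) a acc p : path h a (acc ++ p) ->
  {in segs a acc p, forall q, path h q.1.1 (rcons q.1.2 q.2)}.
Proof.
elim: p a acc => //= v p IH a acc; case: ifP => vT hp q; last first.
  by apply: IH; rewrite cat_rcons.
move: hp; rewrite cat_path /= => /and3P[h1 h2 h3].
by rewrite inE => /orP[/eqP->/=|/IH->//]; rewrite rcons_path h1.
Qed.

Lemma segs_ends a acc p : a \in T ->
  {in segs a acc p, forall q, q.1.1 \in T /\ q.2 \in T}.
Proof.
elim: p a acc => //= v p IH a acc aT; case: ifP => vT q; last exact: IH.
by rewrite inE => /orP[/eqP->//|/(IH v [::] vT)].
Qed.

Lemma segs_mid a acc p : all [predC T] acc -> last a (acc ++ p) \in T ->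
  flatten [seq q.1.2 | q <- segs a acc p] = acc ++ [seq v <- p | v \notin T].
Proof.
elim: p a acc => [|v p IH] a acc /=.
  by case/lastP: acc => // acc v; rewrite all_rcons cats0 last_rcons /= => /andP[/negP h _] /h.
move=> hacc; case: ifP => vT /=; first by rewrite last_cat /= => /(IH v [::] isT) ->.
by rewrite -cat_rcons => /IH ->; rewrite ?cat_rcons // all_rcons hacc /= vT.
Qed.

Lemma segs_size a acc p : size (segs a acc p) = count [in T] p.
Proof. by elim: p a acc => //= v p IH a acc; case: ifP => vT /=; rewrite IH. Qed.

Lemma segs_chain a acc p : path (link (segs a acc p)) a [seq v <- p | v \in T].
Proof.
elim: p a acc => //= v p IH a acc; case: ifP => vT //=.
apply/andP; split; first by rewrite /link /= !eqxx.
by apply: sub_path (IH v [::]) => x y; rewrite /link /= => ->; rewrite orbT.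
Qed.

End Segments.

Section Decomposition.
Variables (V : finType) (S W : {set V}) (h : rel V) (w : nat).
Hypothesis SW : S \subset W.
Hypothesis S0 : S != set0.
Hypothesis hW : forall u v, h u v -> u \in W /\ v \in W.
(** Pairs inside [S] are exempt, because an arc there may belong to another member. *)
Hypothesis hsemi : {in W &, forall u v, u != v -> ~~ ((u \in S) && (v \in S)) ->
  h u v || h v u}.
Hypothesis hstrong : {in W &, forall u v, connect h u v}.
Hypothesis w_gt0 : 0 < w.

Let P := W :\: S.
Let hP := restr h P.
Let r u v := connect hP u v.

Let PW v : v \in P -> v \in W. Proof. by case/setDP. Qed.
Let PS v : v \in P -> v \in S = false. Proof. by case/setDP => _ /negbTE. Qed.
Let hPh u v : hP u v -> [/\ u \in P, v \in P & h u v]. Proof. by case/and3P. Qed.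

Let Psemi : {in P &, forall u v, u != v -> h u v || h v u}.
Proof. by move=> u v uP vP ne; apply: hsemi; rewrite ?PW // !PS. Qed.

Let restr_connect (A : {set V}) : A \subset P -> subrel (connect (restr h A)) (connect hP).
Proof.
move=> AP; apply: connect_sub => x y /and3P[xA yA hxy]; apply: connect1.
by rewrite /hP /restr /= !(subsetP AP).
Qed.

(* [o x] is an out-neighbour of [x] reaching all the others, [n x] the dual; these
   are the representatives collected in [T]. *)
Let out x := [set v in P | h x v].
Let inn x := [set v in P | h v x].
Let o x := [pick v in out x | [forall z in out x, r v z]].
Let n x := [pick v in inn x | [forall z in inn x, r z v]].

Let o_ex x v : v \in P -> h x v ->
  exists t, [/\ o x = Some t, t \in P, h x t & r t v].
Proof.
move=> vP hv; have vo : v \in out x by rewrite inE vP.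
have oP : out x \subset P by apply/subsetP=> z; rewrite inE => /andP[].
have [||t tA ht] := @semicomplete_king V h (out x).
- by apply/set0Pn; exists v.
- by move=> a b /(subsetP oP) aP /(subsetP oP) bP; apply: Psemi.
rewrite /o; case: pickP => [t' /andP[tA' /forall_inP ht']|/(_ t)].
  by exists t'; split=> //; [apply: (subsetP oP)|move: tA'; rewrite inE => /andP[]|apply: ht'].
rewrite tA /= => /negP[]; apply/forall_inP=> z zA; exact: (restr_connect oP (ht z zA)).
Qed.

Let n_ex x v : v \in P -> h v x ->
  exists t, [/\ n x = Some t, t \in P, h t x & r v t].
Proof.
move=> vP hv; have vo : v \in inn x by rewrite inE vP.
have iP : inn x \subset P by apply/subsetP=> z; rewrite inE => /andP[].
have [||t tA ht] := @semicomplete_coking V h (inn x).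
- by apply/set0Pn; exists v.
- by move=> a b /(subsetP iP) aP /(subsetP iP) bP; apply: Psemi.
rewrite /n; case: pickP => [t' /andP[tA' /forall_inP ht']|/(_ t)].
  by exists t'; split=> //; [apply: (subsetP iP)|move: tA'; rewrite inE => /andP[]|apply: ht'].
rewrite tA /= => /negP[]; apply/forall_inP=> z zA; exact: (restr_connect iP (ht z zA)).
Qed.

Let T := [set t in P | (Some t \in o @: S) || (Some t \in n @: S)].

Let TP : T \subset P. Proof. by apply/subsetP=> t; rewrite inE => /andP[]. Qed.

Let card_T : #|T| <= 2 * #|S|.
Proof.
have Si : injective (@Some V) by move=> x y [].
rewrite -(card_imset _ Si).
apply: leq_trans (_ : #|(o @: S) :|: (n @: S)| <= _).
  by apply/subset_leq_card/subsetP=> _ /imsetP[t + ->]; rewrite !inE => /andP[].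
by apply: leq_trans (leq_card_setU _ _) _; rewrite mul2n -addnn leq_add ?leq_imset_card.
Qed.

Let eqv u v := r u v && r v u.
Let eqv_refl u : eqv u u. Proof. by rewrite /eqv /r connect0. Qed.
Let eqv_sym u v : eqv u v = eqv v u. Proof. by rewrite /eqv andbC. Qed.
Let eqv_trans u v z : eqv u v -> eqv v z -> eqv u z.
Proof.
by case/andP=> h1 h2 /andP[h3 h4]; rewrite /eqv /r (connect_trans h1 h3) (connect_trans h4 h2).
Qed.

Let rep t := odflt t [pick t' in T | eqv t t'].

Let repP t : t \in T -> rep t \in T /\ eqv t (rep t).
Proof.
move=> tT; rewrite /rep; case: pickP => [t' /andP[]//|/(_ t)].
by rewrite tT eqv_refl.
Qed.

Let rep_eqv t t' : t \in T -> t' \in T -> eqv t t' -> rep t = rep t'.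
Proof.
move=> tT tT' e; rewrite /rep.
rewrite (@eq_pick _ _ [pred z in T | eqv t' z]); last first.
  move=> z /=; case: (z \in T) => //=; apply/idP/idP; last exact: eqv_trans.
  by apply: eqv_trans; rewrite eqv_sym.
by case: pickP => // /(_ t'); rewrite /= tT' eqv_refl.
Qed.

Let Tc t := [set t' in T | eqv t t'].
Let Tc_T t : Tc t \subset T. Proof. by apply/subsetP=> z; rewrite inE => /andP[]. Qed.

(* One path per strong component meeting [T], from a vertex of [T] reached by all
   of [T] in this component to one reaching all of it. *)
Let route t : exists q : V * seq V, t \in T ->
  [/\ [/\ path hP q.1 q.2, uniq (q.1 :: q.2), q.1 \in Tc t & last q.1 q.2 \in Tc t],
      {in Tc t, forall t', connect (restr h T) t' q.1}
    & {in Tc t, forall t', connect (restr h T) (last q.1 q.2) t'}].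
Proof.
case tT : (t \in T); last by exists (t, [::]).
have sub : {in Tc t &, forall u v, u != v -> h u v || h v u}.
  by move=> u v /(subsetP (Tc_T t)) uT /(subsetP (Tc_T t)) vT; apply: Psemi; apply: (subsetP TP).
have n0 : Tc t != set0 by apply/set0Pn; exists t; rewrite inE tT eqv_refl.
have [u uT hu] := semicomplete_coking n0 sub.
have [v vT hv] := semicomplete_king n0 sub.
have sT : subrel (connect (restr h (Tc t))) (connect (restr h T)).
  apply: connect_sub => x y /and3P[xA yA hxy]; apply: connect1.
  by rewrite /restr /= !(subsetP (Tc_T t)).
have ruv : r u v.
  move: uT vT; rewrite !inE => /andP[_ /andP[_ h1]] /andP[_ /andP[h2 _]].
  exact: connect_trans h1 h2.
have [p hp Ev] := connectP ruv.
case: (shortenP hp) Ev => p' hp' up' _ Ev.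
exists (u, p') => _; rewrite /= -Ev; split=> // t' t'T; apply: sT; [exact: hu|exact: hv].
Qed.

(** [G] collects [S], at most [2 * #|S|] representatives, and fewer than [w] vertices from each of
    at most [2 * #|S|] segments, cut off so that the remaining lengths are divisible by [w]. Routes
    of different classes are disjoint because a route stays in one strong component of [P]. *)
Lemma decomposition : exists (G : {set V}) (sg : seq (V * seq V * V)),
  [/\ [/\ S \subset G, G \subset W, #|G| <= 3 * #|S| + 2 * #|S| * w & size sg <= 2 * #|S|],
      {in sg, forall q, [/\ q.1.1 \in G, q.2 \in G, path h q.1.1 (rcons q.1.2 q.2),
                            w %| size q.1.2 & q.1.2 != [::]]},
      {in flatten [seq q.1.2 | q <- sg], forall v, v \in W :\: G},
      uniq (flatten [seq q.1.2 | q <- sg])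
    & {in G &, forall u v, connect [rel x y | [&& x \in G, y \in G & h x y || link sg x y]] u v}].
Proof.
have [q hq] := fin_all_exists route.
pose Rp := rep @: T.
have RpT t : t \in Rp -> t \in T by case/imsetP => z /repP[zT _] ->.
have Rprep t : t \in Rp -> rep t = t.
  case/imsetP => z zT ->; have [z1 z2] := repP zT.
  by apply: rep_eqv => //; rewrite eqv_sym.
have qeqv t v : t \in T -> v \in (q t).2 -> eqv t v && (v \in P).
  move=> tT vq; have [[pq _ h1 h2] _ _] := hq _ tT.
  have vP : v \in P.
    elim: ((q t).2) ((q t).1) pq vq => //= z p IH u /andP[/hPh[_ zP _] hp].
    by rewrite inE => /orP[/eqP->|/(IH _ hp)].
  rewrite vP andbT; move: h1 h2; rewrite !inE => /andP[_ /andP[e1 _]] /andP[_ /andP[_ e2]].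
  case/splitPr: vq pq e2 => p1 p2; rewrite cat_path last_cat /= => /and3P[p1P hv p2P] e2.
  apply/andP; split.
    apply: connect_trans e1 _; apply/connectP; exists (rcons p1 v); rewrite ?last_rcons //.
    by rewrite rcons_path p1P.
  by apply: connect_trans e2; apply/connectP; exists p2.
pose A := flatten [seq (q t).2 | t <- enum Rp].
pose sg0 := flatten [seq segs T (q t).1 [::] (q t).2 | t <- enum Rp].
have Auniq : uniq A.
  apply: uniq_flatten_map => [|t|t t'].
  - exact: enum_uniq.
  - by rewrite mem_enum => /RpT/hq[[_ /andP[]]].
  - rewrite !mem_enum => tR tR' v /(qeqv _ _ (RpT _ tR))/andP[e1 _].
    move=> /(qeqv _ _ (RpT _ tR'))/andP[e2 _]; rewrite -(Rprep _ tR) -(Rprep _ tR').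
    by apply: rep_eqv; rewrite ?RpT //; apply: eqv_trans e1 _; rewrite eqv_sym.
have AP : {subset A <= P}.
  by move=> v /flattenP[s /mapP[t]]; rewrite mem_enum => /RpT tT Es; rewrite Es => /(qeqv _ _ tT)/andP[].
have sg0_mid : flatten [seq e.1.2 | e <- sg0] = [seq v <- A | v \notin T].
  apply: flatten_map_filter; apply/allP => t1; rewrite mem_enum => /RpT/hq[[_ _ _ lT] _ _].
  by rewrite segs_mid //=; apply: subsetP lT.
(* Segments end at distinct vertices of [T]. *)
have sg0_size : size sg0 <= 2 * #|S|.
  apply: leq_trans card_T; have -> : size sg0 = count [in T] A.
    rewrite /sg0 /A; elim: (enum Rp) => //= t s IH.
    by rewrite size_cat count_cat segs_size IH.
  rewrite -size_filter -(card_uniqP _) ?filter_uniq //.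
  by apply/subset_leq_card/subsetP=> v; rewrite mem_filter => /andP[].
have sg0P e : e \in sg0 -> [/\ e.1.1 \in T, e.2 \in T & path hP e.1.1 (rcons e.1.2 e.2)].
  case/flattenP => _ /mapP[t + ->]; rewrite mem_enum => /RpT/hq[[pq _ uT _] _ _] he.
  have [h1 h2] := segs_ends (subsetP (Tc_T t) _ uT) he.
  by split=> //; apply: segs_path he; rewrite cat0s.
pose pre (e : V * seq V * V) := take (size e.1.2 %% w) e.1.2.
pose rest (e : V * seq V * V) := drop (size e.1.2 %% w) e.1.2.
pose chop (e : V * seq V * V) := (last e.1.1 (pre e), rest e, e.2).
(* A segment emptied by the cut leaves an arc of [h] between two vertices of [G], which stands for
   itself. *)
pose sg := [seq e <- [seq chop e | e <- sg0] | e.1.2 != [::]].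
pose Pre := flatten [seq pre e | e <- sg0].
pose G := S :|: T :|: [set v in Pre].
have sg_mid : flatten [seq e.1.2 | e <- sg] = flatten [seq rest e | e <- sg0].
  rewrite /sg; elim: (sg0) => //= e s IH; case: eqP => [->|_] //=; by rewrite IH.
have mid_perm : perm_eq [seq v <- A | v \notin T] (Pre ++ flatten [seq e.1.2 | e <- sg]).
  rewrite sg_mid perm_sym -sg0_mid perm_sym.
  rewrite (eq_map (g := fun e => pre e ++ rest e)); last by move=> e; rewrite cat_take_drop.
  exact: perm_flatten_cat.
have : uniq (Pre ++ flatten [seq e.1.2 | e <- sg]).
  by rewrite -(perm_uniq mid_perm) filter_uniq.
rewrite cat_uniq => /and3P[Pre_uniq Pre_dis mid_uniq].
have midA v : v \in Pre ++ flatten [seq e.1.2 | e <- sg] -> (v \in A) && (v \notin T).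
  by rewrite -(perm_mem mid_perm) mem_filter andbC.
have SG : {subset S <= G} by move=> v vS; rewrite !in_setU vS.
have TG : {subset T <= G} by move=> v vT; rewrite !in_setU vT orbT.
have PG : {subset Pre <= G} by move=> v vp; rewrite !in_setU in_set vp orbT.
exists G, sg; split=> //.
- split.
  + exact/subsetP.
  + apply/subsetP=> v; rewrite !inE -orbA => /or3P[/(subsetP SW)//|/andP[/andP[_ ->]]//|vp].
    have /andP[/AP/PW//] : (v \in A) && (v \notin T) by apply: midA; rewrite mem_cat vp.
  + apply: leq_trans (leq_card_setU _ _) _; apply: leq_add.
      by apply: leq_trans (leq_card_setU _ _) _; have := card_T; lia.
    rewrite cardsE; apply: leq_trans (card_size _) _.
    apply: leq_trans (_ : size sg0 * w <= _); last by rewrite leq_mul2r sg0_size orbT.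
    rewrite /Pre; elim: (sg0) => //= e s IH; rewrite size_cat mulSn leq_add //.
    by rewrite size_take_min; apply: leq_trans (geq_minl _ _) _; rewrite ltnW // ltn_mod.
  + rewrite size_filter; apply: leq_trans (count_size _ _) _; by rewrite size_map.
- move=> e; rewrite mem_filter => /andP[ne /mapP[e0 e0s Ee]]; have [h1 h2 h3] := sg0P _ e0s.
  have preG : {subset pre e0 <= G}.
    move=> v vp; apply/PG/flattenP; exists (pre e0) => //.
    exact: map_f.
  have hh : path h e0.1.1 (rcons e0.1.2 e0.2) by apply: sub_path h3 => x y /hPh[].
  rewrite Ee /=; split=> //.
  + case/lastP E : (pre e0) => [|p v] /=; first exact: TG.
    by rewrite last_rcons; apply: preG; rewrite E mem_rcons mem_head.
  + exact: TG.
  + by move: hh; rewrite -{1}(cat_take_drop (size e0.1.2 %% w) e0.1.2) rcons_cat cat_path => /andP[].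
  + by rewrite size_drop {1}(divn_eq (size e0.1.2) w) addnK dvdn_mull.
  + by rewrite Ee in ne.
- move=> v vm; have /andP[vA vT] : (v \in A) && (v \notin T) by apply: midA; rewrite mem_cat vm orbT.
  have vP := AP _ vA; apply/setDP; split; first exact: PW.
  rewrite !in_setU in_set (PS vP) (negbTE vT) /=.
  by apply/negP => vp; move/hasPn: Pre_dis => /(_ _ vm) /negP.
pose VR := [rel x y | [&& x \in G, y \in G & h x y || link sg x y]].
rewrite -/VR.
have STG : {subset S :|: T <= G} by move=> v /setUP[/SG|/TG].
have hVR u v : u \in S :|: T -> v \in S :|: T -> h u v -> connect VR u v.
  by move=> uT vT huv; apply: connect1; rewrite /= !STG // huv.
have pVR e c : e \in sg0 -> c \in e.1.1 :: pre e -> connect VR e.1.1 c /\ connect VR c e.2.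
  move=> es cp; have [h1 h2 h3] := sg0P _ es.
  have pG : {subset e.1.1 :: pre e <= G}.
    move=> v; rewrite inE => /orP[/eqP->|vp]; first exact: TG.
    by apply/PG/flattenP; exists (pre e) => //; apply: map_f.
  have hh : path h e.1.1 (rcons e.1.2 e.2) by apply: sub_path h3 => x y /hPh[].
  move: hh; rewrite -{1}(cat_take_drop (size e.1.2 %% w) e.1.2) -/(pre e) rcons_cat cat_path.
  rewrite -/(rest e) => /andP[hp hr].
  have pp : path VR e.1.1 (pre e).
    elim: (pre e) (e.1.1) hp pG {cp hr} => //= v p IH u /andP[huv hp] pG.
    rewrite huv !pG ?inE ?eqxx ?orbT //=; apply: IH => // z zp; apply: pG.
    by rewrite inE zp orbT.
  have lG : last e.1.1 (pre e) \in G by apply: pG; apply: mem_last.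
  have le : connect VR (last e.1.1 (pre e)) e.2.
    apply: connect1; rewrite /= lG TG //=; apply/orP.
    case E : (rest e) hr => [|v p] /=; first by rewrite andbT => ->; left.
    move=> _; right; apply/hasP; exists (chop e); last by rewrite /= !eqxx.
    by rewrite mem_filter map_f // andbT /= E.
  split; first exact: (path_connect pp).
  apply: connect_trans le; case/splitPl: cp pp => p1 p2 Ec; rewrite cat_path last_cat Ec => /andP[_ p2P].
  by apply/connectP; exists p2.
(* From [t], go inside [T] to the start of the route of its class, follow the route by virtual arcs,
   and go inside [T] from its end to [t']. *)
have classVR t t' : t \in T -> t' \in T -> eqv t t' -> connect VR t t'.
  move=> tT t'T e; have [rT re] := repP tT.
  have rR : rep t \in Rp by apply: imset_f.
  have [[pq _ uT lT] h1 h2] := hq _ rT.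
  have sub : subrel (connect (restr h T)) (connect VR).
    by apply: connect_sub => x y /and3P[xT yT]; apply: hVR; rewrite in_setU ?xT ?yT orbT.
  have tc : t \in Tc (rep t) by rewrite inE tT eqv_sym.
  have t'c : t' \in Tc (rep t) by rewrite inE t'T /=; apply: eqv_trans e; rewrite eqv_sym.
  apply: connect_trans (sub _ _ (h1 _ tc)) _.
  apply: connect_trans _ (sub _ _ (h2 _ t'c)).
  have lf : last (q (rep t)).1 [seq v <- (q (rep t)).2 | v \in T] = last (q (rep t)).1 (q (rep t)).2.
    move: (subsetP (Tc_T _) _ lT); case/lastP: ((q (rep t)).2) => // p v.
    by rewrite last_rcons filter_rcons => ->; rewrite last_rcons.
  have := segs_chain T (q (rep t)).1 [::] (q (rep t)).2; set sgr := segs _ _ _ _ => pc.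
  have ls : subrel (connect (link sgr)) (connect VR).
    apply: connect_sub => x y /hasP[ee es /andP[/eqP-> /eqP->]].
    have e0 : ee \in sg0.
      by apply/flattenP; exists sgr => //; apply/mapP; exists (rep t); rewrite ?mem_enum.
    by have [] := pVR _ _ e0 (mem_head _ _).
  by apply: ls; apply/connectP; exists [seq v <- (q (rep t)).2 | v \in T].
(* If the arc between the two points from [t'] to [t], it closes a cycle with the path from [t] to
   [t'], so both lie in one class. *)
have rVR t t' : t \in T -> t' \in T -> r t t' -> connect VR t t'.
  move=> tT t'T rtt; case: (eqVneq t t') => [->|ne]; first exact: connect0.
  have tP := subsetP TP _ tT; have t'P := subsetP TP _ t'T.
  case/orP: (Psemi tP t'P ne) => htt.
    by apply: hVR => //; rewrite in_setU ?tT ?t'T orbT.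
  apply: classVR => //; rewrite /eqv rtt /=; apply: connect1.
  by rewrite /hP /restr /= t'P tP.
(* Invariant along a walk of the member: outside [S] the walk is tracked only by a representative
   from which the current vertex can be reached in [P]. Leaving [S] uses [o], entering it uses
   [n]. *)
pose Reach s z : Prop := if z \in S then is_true (connect VR s z)
                 else exists t, [/\ t \in T, connect VR s t & r t z].
have oT x t : x \in S -> o x = Some t -> t \in P -> t \in T.
  by move=> xS E tP; rewrite inE tP -E imset_f.
have nT x t : x \in S -> n x = Some t -> t \in P -> t \in T.
  by move=> xS E tP; rewrite inE tP -E orbC imset_f.
have Reach_step s x y : Reach s x -> h x y -> Reach s y.
  move=> Rx hxy; have [xW yW] := hW hxy; move: Rx; rewrite /Reach.
  case xS : (x \in S); case yS : (y \in S).
  - by move=> c; apply: connect_trans c (hVR _ _ _ _ hxy); rewrite in_setU ?xS ?yS.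
  - have yP : y \in P by rewrite inE yS.
    have [t [ox tP hxt rty]] := o_ex yP hxy; have tT := oT _ _ xS ox tP.
    move=> c; exists t; split=> //; apply: connect_trans c (hVR _ _ _ _ hxt).
      by rewrite in_setU xS.
    by rewrite in_setU tT orbT.
  - have xP : x \in P by rewrite inE xS.
    have [t [ny tP hty rxt]] := n_ex xP hxy; have tT := nT _ _ yS ny tP.
    case=> t' [t'T c r'x]; apply: connect_trans c _.
    apply: connect_trans (rVR _ _ t'T tT (connect_trans r'x rxt)) (hVR _ _ _ _ hty).
      by rewrite in_setU tT orbT.
    by rewrite in_setU yS.
  - case=> t [tT c rtx]; exists t; split=> //; apply: connect_trans rtx _.
    by apply: connect1; rewrite /hP /restr /= !inE xS yS xW yW.
have ST_W v : v \in S :|: T -> v \in W.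
  by case/setUP => [/(subsetP SW)//|/(subsetP TP)/PW].
have coreVR u v : u \in S :|: T -> v \in S :|: T -> connect VR u v.
  move=> uT vT; have /connectP[p hp Ev] := hstrong (ST_W _ uT) (ST_W _ vT).
  have Ru : Reach u u.
    rewrite /Reach; case: ifP => uS; first exact: connect0.
    exists u; split; rewrite ?connect0 //; first by move: uT; rewrite in_setU uS.
    exact: connect0.
  have : Reach u v.
    rewrite {}Ev; have gen : forall p x, Reach u x -> path h x p -> Reach u (last x p).
      by elim=> //= z p' IH x Rx /andP[hxz hp']; apply: IH hp'; apply: Reach_step hxz.
    exact: gen.
  rewrite /Reach; case: ifP => // vS [t [tT c rtv]].
  apply: connect_trans c (rVR _ _ tT _ rtv).
  by move: vT; rewrite in_setU vS.
have core v : v \in G -> exists a b, [/\ a \in S :|: T, b \in S :|: T, connect VR a v & connect VR v b].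
  rewrite in_setU => /orP[vT|]; first by exists v, v; rewrite !connect0.
  rewrite inE => /flattenP[_ /mapP[e es ->] ve]; have [h1 h2 _] := sg0P _ es.
  have [|c1 c2] := pVR _ v es; first by rewrite inE ve orbT.
  by exists e.1.1, e.2; rewrite !in_setU h1 h2 !orbT.
move=> u v /core[_ [b [_ bT _ ub]]] /core[a [_ [aT _ av _]]].
exact: connect_trans ub (connect_trans (coreVR _ _ bT aT) av).
Qed.

End Decomposition.

(** * Bounded states and local moves *)

Section LocalPredicates.
(* Paths are indexed by a member of the family and a number below [R]. *)
Variables (k l R g w B : nat).
Definition pathT : finType := ('I_l * 'I_R)%type.
Definition restT : finType :=
  ('I_l * 'I_g + pathT * bool + 'I_l * ('I_k * 'I_k) + pathT * 'I_w.+2 + 'I_B)%type.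
Definition slotT : finType := ('I_k + restT)%type.

Section State.
(** Arcs and equality are abstract relations [d] and [e], so that the same formulas can be evaluated
    on the slots themselves once the pattern of arcs and equalities is known. *)
Variables (V : Type) (d e : rel V) (x : slotT -> V).

Definition term i := x (inl i).
Definition guess c j := x (inr (inl (inl (inl (inl (c, j)))))).
Definition src t := x (inr (inl (inl (inl (inr (t, true)))))).
Definition dst t := x (inr (inl (inl (inl (inr (t, false)))))).
Definition flag c i j := x (inr (inl (inl (inr (c, (i, j)))))).
(* One bit encoded by an equality of vertices: member [c] may use the arc from
   terminal [i] to terminal [j]. *)
Definition owns c i j := e (flag c i j) (term i).
Definition blk t j := x (inr (inl (inr (t, j)))).
Definition exc i := x (inr (inr i)).

Definition in_term v := [exists i, e v (term i)].
Definition in_guess v := in_term v || [exists c, [exists j, e v (guess c j)]].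
(* A path not yet started has its first two block entries equal. *)
Definition started t := ~~ e (blk t ord0) (blk t (Ordinal (isT : 1 < w.+2))).
Definition gpoint c (i : 'I_k + 'I_g) := match i with inl i => term i | inr j => guess c j end.
Definition arc c u v := d u v && ((in_term u && in_term v) ==>
  [exists i, [exists j, [&& e u (term i), e v (term j) & owns c i j]]]).
Definition virt c u v := [exists r, e u (src (c, r)) && e v (dst (c, r))].
(** Equality counts as a link because several slots may name the same vertex. *)
Definition glink c : rel ('I_k + 'I_g) := fun i j =>
  [|| e (gpoint c i) (gpoint c j), arc c (gpoint c i) (gpoint c j)
    | virt c (gpoint c i) (gpoint c j)].
Definition terms_distinct := [forall i, forall j, e (term i) (term j) ==> (i == j)].

Definition init_state := [&& [forall t, ~~ started t],
  [forall c, forall c', (c != c') ==>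
     [forall j, forall j', e (guess c j) (guess c' j') ==> in_term (guess c j)]],
  [forall c, forall i, forall j, connect (glink c) i j],
  [forall t : pathT, [exists i, e (src t) (gpoint t.1 i)] && [exists i, e (dst t) (gpoint t.1 i)]]
 & [forall c, forall c', (c != c') ==> [forall i, forall j, ~~ (owns c i j && owns c' i j)]]].

Definition final_state :=
  [forall t, if started t then d (blk t ord_max) (dst t) else e (src t) (dst t)].

Definition in_block v := [exists t, started t && [exists j, e v (blk t j)]].
Definition block_dom v :=
  [exists t, started t && (w.+2 <= #|[pred j | d (blk t j) v]| + 2)].
(* The vertices already swept, as far as the state can tell. *)
Definition behind v :=
  [&& ~~ in_guess v, ~~ [exists i, e v (exc i)] & in_block v || block_dom v].
End State.

Section Step.
Variables (V : Type) (d e : rel V) (x y : slotT -> V).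
(** The exceptions [exc] are left free: each state guesses its own. *)
Definition same_frame := [&& [forall i, e (term x i) (term y i)],
  [forall c, forall j, e (guess x c j) (guess y c j)],
  [forall t, e (src x t) (src y t) && e (dst x t) (dst y t)]
 & [forall c, forall i, forall j, e (flag x c i j) (flag y c i j)]].

(** The new block must avoid all that is recognised as swept, and must itself be recognised
    afterwards, lest the newly guessed exceptions hide it from later steps. *)
Definition moves t := [&& [forall t', (t' != t) ==> [forall j, e (blk x t' j) (blk y t' j)]],
  started e y t,
  [forall j, [&& ~~ in_guess e x (blk y t j), ~~ behind d e x (blk y t j)
               & behind d e y (blk y t j)]],
  [forall i : 'I_w.+2, forall j : 'I_w.+2, (j == i.+1 :> nat) ==> d (blk y t i) (blk y t j)]
 & d (if started e x t then blk x t ord_max else src x t) (blk y t ord0)].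

(** The universally quantified vertex [v] serves only to say that what is recognised stays
    recognised. *)
Definition step_state v :=
  [&& same_frame, [exists t, moves t] & behind d e x v ==> behind d e y v].
End Step.
End LocalPredicates.

Lemma sum_card_disjoint (I U : finType) (F : I -> {set U}) (A : {set U}) :
  (forall i, F i \subset A) -> (forall i j v, v \in F i -> v \in F j -> i = j) ->
  \sum_i #|F i| <= #|A|.
Proof.
move=> sub dis; under eq_bigr => i _ do rewrite -sum1_card.
rewrite (exchange_big_dep [in A]) /=; last by move=> i v _; apply: (subsetP (sub i)).
rewrite -sum1_card; apply: leq_sum => v _; rewrite sum1_card.
apply/card_le1_eqP => i j hi hj; exact: dis hj hi.
Qed.

Lemma card_bigcup_le (I U : finType) (F : I -> {set U}) :
  #|\bigcup_i F i| <= \sum_i #|F i|.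
Proof.
elim/big_rec2: _ => [|i m A _ IH]; first by rewrite cards0.
by apply: leq_trans (leq_card_setU _ _) _; rewrite leq_add2l.
Qed.

Lemma startedE k l R g w B (V : Type) (e : rel V) (x : slotT k l R g w B -> V) t :
  started e x t = ~~ e (blk x t ord0) (blk x t (Ordinal (isT : 1 < w.+2))).
Proof. by []. Qed.

Lemma in_termE k l R g w B (V : Type) (e : rel V) (x : slotT k l R g w B -> V) v :
  in_term e x v = [exists i, e v (term x i)].
Proof. by []. Qed.

Lemma in_guessE k l R g w B (V : Type) (e : rel V) (x : slotT k l R g w B -> V) v :
  in_guess e x v = in_term e x v || [exists c, [exists j, e v (guess x c j)]].
Proof. by []. Qed.

Section Vertices.
Variables (k l R g w B n : nat) (D : rel 'I_n).
Local Notation V := 'I_n.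
Local Notation T := (pathT l R).
Local Notation slot := (slotT k l R g w B).
Implicit Types x y : slot -> V.
Local Notation term := (@term k l R g w B V).
Local Notation guess := (@guess k l R g w B V).
Local Notation src := (@src k l R g w B V).
Local Notation dst := (@dst k l R g w B V).
Local Notation blk := (@blk k l R g w B V).
Local Notation exc := (@exc k l R g w B V).
Local Notation owns := (@owns k l R g w B V eq_op).
Local Notation in_term := (@in_term k l R g w B V eq_op).
Local Notation in_guess := (@in_guess k l R g w B V eq_op).
Local Notation started := (@started k l R g w B V eq_op).
Local Notation gpoint := (@gpoint k l R g w B V).
Local Notation arc := (@arc k l R g w B V D eq_op).
Local Notation virt := (@virt k l R g w B V eq_op).
Local Notation glink := (@glink k l R g w B V D eq_op).
Local Notation terms_distinct := (@terms_distinct k l R g w B V eq_op).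
Local Notation init_state := (@init_state k l R g w B V D eq_op).
Local Notation final_state := (@final_state k l R g w B V D eq_op).
Local Notation behind := (@behind k l R g w B V D eq_op).
Local Notation step_state := (@step_state k l R g w B V D eq_op).

Definition termset x : {set V} := [set v | in_term x v].
Definition guessset x : {set V} := [set v | in_guess x v].

(** * Rebuilding a family from a linkage *)

Section Builder.
Variables (x : slot -> V) (Y : T -> seq V).
Hypothesis xdist : terms_distinct x.
Hypothesis xinit : init_state x.
Hypothesis Ylink : linkage D (guessset x) (src x) (dst x) Y.

Definition member_vertices c : {set V} :=
  termset x :|: [set v | [exists j, v == guess x c j]] :|: [set v | [exists r, v \in Y (c, r)]].
Definition member_arcs c : {set V * V} :=
  [set a | [&& a.1 \in member_vertices c, a.2 \in member_vertices c & arc x c a.1 a.2]].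
Definition built : {ffun 'I_l -> {set V} * {set V * V}} :=
  [ffun c => (member_vertices c, member_arcs c)].

Let mv_gpoint c i : gpoint x c i \in member_vertices c.
Proof.
rewrite !inE; case: i => [i|j] /=; first by apply/orP; left; apply/orP; left; apply/existsP; exists i.
by apply/orP; left; apply/orP; right; apply/existsP; exists j.
Qed.

Let Y_term t v : v \in Y t -> in_term x v = false.
Proof.
have [_ h _] := Ylink; move/h; rewrite inE /in_guess negb_or => /andP[h1 _].
exact: negbTE.
Qed.

Let Y_guess t v c j : v \in Y t -> v != guess x c j.
Proof.
have [_ h _] := Ylink; move/h; rewrite inE /in_guess negb_or => /andP[_].
by rewrite negb_exists => /forallP/(_ c); rewrite negb_exists => /forallP/(_ j).
Qed.

Let mv_Y c r v : v \in Y (c, r) -> v \in member_vertices c.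
Proof. by move=> vY; rewrite !inE; apply/orP; right; apply/existsP; exists r. Qed.

Let src_gpoint t : exists i, src x t = gpoint x t.1 i.
Proof.
by have /and5P[_ _ _ /forallP/(_ t)/andP[/existsP[i /eqP ->] _] _] := xinit; exists i.
Qed.

Let dst_gpoint t : exists i, dst x t = gpoint x t.1 i.
Proof.
by have /and5P[_ _ _ /forallP/(_ t)/andP[_ /existsP[i /eqP ->]] _] := xinit; exists i.
Qed.

Let e c : rel V := fun u v => (u, v) \in member_arcs c.

Let Y_path c r : Y (c, r) != [::] -> path (e c) (src x (c, r)) (rcons (Y (c, r)) (dst x (c, r))).
Proof.
have [/(_ (c, r)) h _ _] := Ylink => ne.
have [i Ei] := src_gpoint (c, r); have [j Ej] := dst_gpoint (c, r).
have sv : src x (c, r) \in member_vertices c by rewrite Ei mv_gpoint.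
have dv : dst x (c, r) \in member_vertices c by rewrite Ej mv_gpoint.
have {}h : path D (src x (c, r)) (rcons (Y (c, r)) (dst x (c, r))).
  by move: h ne; rewrite /linked; case: (Y _).
have step u v : u \in member_vertices c -> v \in member_vertices c -> 
    (u \in Y (c, r)) || (v \in Y (c, r)) -> D u v -> e c u v.
  move=> uv vv uY duv; rewrite /e inE /= uv vv /arc duv /=; apply/implyP.
  by case/orP: uY => /Y_term->; rewrite // andbF.
have gen q z : z \in Y (c, r) -> {subset q <= Y (c, r)} ->
    path D z (rcons q (dst x (c, r))) -> path (e c) z (rcons q (dst x (c, r))).
  elim: q z => [|v q IH] z zY qY /=.
    by rewrite !andbT => hz; apply: step; rewrite ?zY ?(mv_Y zY).
  have vY : v \in Y (c, r) by apply: qY; rewrite mem_head.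
  case/andP=> hz hq; rewrite step ?(mv_Y zY) ?(mv_Y vY) ?zY //=.
  by apply: IH => // y yq; apply: qY; rewrite inE yq orbT.
have [u [p E]] : exists u p, Y (c, r) = u :: p by case: (Y _) ne => // u p; exists u, p.
have sub : {subset u :: p <= Y (c, r)} by rewrite E.
move: h; rewrite E /= => /andP[h1 h2].
have uY : u \in Y (c, r) by apply: sub; rewrite mem_head.
rewrite step ?uY ?orbT ?(mv_Y uY) //=; apply: gen => // y yq.
by apply: sub; rewrite inE yq orbT.
Qed.

Let connect_virt c r : connect (e c) (src x (c, r)) (dst x (c, r)).
Proof.
case E : (Y (c, r) == [::]).
  by have [/(_ (c, r))] := Ylink; rewrite /linked (eqP E) => /eqP->.
apply/connectP; exists (rcons (Y (c, r)) (dst x (c, r))); last by rewrite last_rcons.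
by rewrite Y_path ?E.
Qed.

Let connect_gpoint c i j : connect (e c) (gpoint x c i) (gpoint x c j).
Proof.
have /and5P[_ _ /forallP/(_ c)/forallP/(_ i)/forallP/(_ j) + _ _] := xinit.
case/connectP=> p hp ->; elim: p i hp => //= j' p IH i /andP[hij /IH].
apply: connect_trans; case/or3P: hij => [/eqP->|a|/existsP[r /andP[/eqP-> /eqP->]]] //.
by apply: connect1; rewrite /e inE /= !mv_gpoint.
Qed.

Let near_gpoint c v : v \in member_vertices c ->
  exists i j, connect (e c) (gpoint x c i) v /\ connect (e c) v (gpoint x c j).
Proof.
rewrite !inE => /orP[/orP[/existsP[i /eqP->]|/existsP[j /eqP->]]|/existsP[r vY]].
- by exists (inl i), (inl i).
- by exists (inr j), (inr j).
have ne : Y (c, r) != [::] by case: (Y _) vY.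
have [i Ei] := src_gpoint (c, r); have [j Ej] := dst_gpoint (c, r).
exists i, j; rewrite -Ei -Ej; have pY := Y_path ne.
have vY' : v \in src x (c, r) :: Y (c, r) by rewrite inE vY orbT.
split; first by apply: (path_connect pY); rewrite !inE mem_rcons inE vY !orbT.
case/splitPl: vY' pY => p1 p2 <-; rewrite rcons_cat cat_path => /andP[_ h].
by apply/connectP; exists (rcons p2 (dst x (c, r))); rewrite ?last_rcons.
Qed.

(** Every vertex of a member lies on a walk between guessed points, and these are mutually linked
    through [glink]. Two members share only terminals, so a common arc would join two terminals and
    have two owners. *)
Lemma built_family : S_int_disjoint_family D (termset x) built.
Proof.
have [l1 l2 l3] := Ylink; have /and5P[_ /forallP disg _ _ /forallP diso] := xinit.
apply/and4P; split.
- apply/forallP=> c; rewrite ffunE; apply/forall_inP=> a /=; rewrite inE.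
  by case/and3P => -> ->; rewrite /arc => /andP[->].
- apply/forallP=> c; rewrite ffunE /=; apply/forall_inP=> u uc; apply/forall_inP=> v vc.
  have [_ [j [_ h1]]] := near_gpoint uc; have [i [_ [h2 _]]] := near_gpoint vc.
  exact: connect_trans h1 (connect_trans (connect_gpoint _ _ _) h2).
- by apply/forallP=> c; rewrite ffunE /= /member_vertices -setUA subsetUl.
apply/forallP=> c; apply/forallP=> c'; apply/implyP=> ltc; rewrite !ffunE /=.
have ne : c != c' by rewrite -val_eqE /= neq_ltn ltc.
have meet v : v \in member_vertices c -> v \in member_vertices c' -> in_term x v.
  rewrite !inE -!orbA => /or3P[//|/existsP[j /eqP Ej]|/existsP[r vr]] /or3P[//|/existsP[j' /eqP Ej']|/existsP[r' vr']].
  - have := implyP (forallP (disg c) c') ne => /forallP/(_ j)/forallP/(_ j')/implyP.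
    by rewrite -Ej -Ej' eqxx; apply.
  - by have /eqP := Y_guess c j vr'.
  - by have /eqP := Y_guess c' j' vr.
  - by have [E] := l3 _ _ _ vr vr'; rewrite E eqxx in ne.
apply/andP; split.
  apply/eqP/setP=> v; rewrite !in_setI; apply/andP/idP => [[h1 h2]|vS].
    by rewrite inE meet.
  by rewrite /member_vertices !in_setU vS.
apply/eqP/setP=> -[u v]; rewrite in_setI in_set0; apply/negP => /andP[].
rewrite {1}/member_arcs in_set => /and3P[u1 v1 a1].
rewrite {1}/member_arcs in_set => /and3P[u2 v2 a2].
have uS : in_term x u := meet _ u1 u2.
have vS : in_term x v := meet _ v1 v2.
move: a1 a2; rewrite /arc /= uS vS /= => /andP[_ /existsP[i /existsP[j /and3P[/eqP ui /eqP vj o1]]]].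
case/andP=> _ /existsP[i' /existsP[j' /and3P[/eqP ui' /eqP vj' o2]]].
have tinj a b : term x a = term x b -> a = b.
  by move=> E; apply/eqP; move/forallP/(_ a)/forallP/(_ b)/implyP: xdist; apply; apply/eqP.
have Ei : i = i' by apply: tinj; rewrite -ui.
have Ej : j = j' by apply: tinj; rewrite -vj.
subst i' j'; have := implyP (forallP (diso c) c') ne => /forallP/(_ i)/forallP/(_ j).
by rewrite o1 o2.
Qed.

(** Only the last term depends on [Y], so a smaller linkage gives a smaller bound on the family. *)
Lemma built_size :
  \sum_c #|(built c).1| <= l * #|termset x| + #|guessset x :\: termset x| + #|supp Y|.
Proof.
have /and4P[_ _ _ /forallP disj] := built_family.
have bE c : #|(built c).1| = #|termset x| + #|(built c).1 :\: termset x|.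
  rewrite -(cardsID (termset x)) addnC addnC (setIidPr _) //.
  by rewrite ffunE /= /member_vertices -setUA subsetUl.
rewrite (eq_bigr _ (fun c _ => bE c)) big_split /= sum_nat_const card_ord -addnA leq_add2l.
apply: leq_trans (leq_card_setU _ _); apply: sum_card_disjoint => [c|c c' v].
  apply/subsetP=> v; rewrite ffunE !in_setU in_setD !inE /=.
  case/andP=> vS /orP[/orP[h|/existsP[j /eqP Ev]]|/existsP[r vY]].
  - by rewrite h in vS.
  - apply/orP; left; rewrite vS /in_guess; apply/orP; right.
    by apply/existsP; exists c; apply/existsP; exists j; apply/eqP.
  - by apply/orP; right; apply/existsP; exists (c, r).
rewrite !in_setD => /andP[vS vc] /andP[_ vc']; apply/eqP/negPn/negP => ne.
wlog lt : c c' vc vc' ne / c < c'.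
  move=> H; move: (ne); rewrite -val_eqE /= neq_ltn => /orP[h|h]; first exact: (H c c').
  by apply: (H c' c); rewrite // eq_sym.
have /implyP/(_ lt)/andP[/eqP/setP/(_ v)] := forallP (disj c) c'.
by rewrite in_setI vc vc' (negbTE vS).
Qed.

End Builder.

(** * Soundness of walks in the state graph *)

Section Soundness.
Hypothesis k_gt0 : 0 < k.

Definition frame_eq x y := [/\ term x =1 term y, forall c, guess x c =1 guess y c,
  src x =1 src y, dst x =1 dst y
  & forall c i j, flag x c i j = flag y c i j].

Definition sweeps x0 x (p : T -> seq V) := [/\ frame_eq x0 x,
  forall t, if started x t then exists q, p t = rcons q (blk x t ord_max) else p t = [::],
  forall t, path D (src x0 t) (p t),
  forall t v, v \in p t -> behind x v
  & forall t t' v, v \in p t -> v \in p t' -> t = t'].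

Lemma frame_eq_trans x y z : frame_eq x y -> frame_eq y z -> frame_eq x z.
Proof.
case=> a1 a2 a3 a4 a5 [b1 b2 b3 b4 b5]; split=> [i|c j|t|t|c i j].
all: by [rewrite a1 b1|rewrite a2 b2|rewrite a3 b3|rewrite a4 b4|rewrite a5 b5].
Qed.

Lemma same_frameP x y : reflect (frame_eq x y) (same_frame eq_op x y).
Proof.
apply: (iffP and4P) => [[h1 h2 h3 h4]|[h1 h2 h3 h4 h5]]; split.
- by move=> i; apply/eqP/(forallP h1).
- by move=> c j; apply/eqP/(forallP (forallP h2 c)).
- by move=> t; have /andP[/eqP] := forallP h3 t.
- by move=> t; have /andP[_ /eqP] := forallP h3 t.
- by move=> c i j; apply/eqP/(forallP (forallP (forallP h4 c) i)).
- by apply/forallP=> i; apply/eqP.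
- by apply/forallP=> c; apply/forallP=> j; apply/eqP/h2.
- by apply/forallP=> t; rewrite h3 h4 !eqxx.
- by apply/forallP=> c; apply/forallP=> i; apply/forallP=> j; apply/eqP.
Qed.

Lemma init_frame x y : frame_eq x y -> (forall t, ~~ started y t) ->
  init_state x -> init_state y.
Proof.
case=> h1 h2 h3 h4 h5 ns.
have gp c i : gpoint x c i = gpoint y c i by case: i => [i|j] /=; rewrite ?h1 ?h2.
have it v : in_term x v = in_term y v.
  by rewrite !in_termE; apply: eq_existsb => i; rewrite h1.
have ow c i j : owns x c i j = owns y c i j by rewrite /owns h5 h1.
have ar c u v : arc x c u v = arc y c u v.
  rewrite /arc !it; congr (_ && (_ ==> _)).
  by apply: eq_existsb => i; apply: eq_existsb => j; rewrite !h1 ow.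
have gl c : glink x c =2 glink y c.
  move=> i j; rewrite /glink !gp ar; congr [|| _, _ | _].
  by apply: eq_existsb => r; rewrite h3 h4.
case/and5P=> _ H2 H3 H4 H5; apply/and5P; split.
- exact/forallP.
- apply/forallP=> c; apply/forallP=> c'; apply/implyP=> ne; apply/forallP=> j; apply/forallP=> j'.
  have /implyP/(_ ne)/forallP/(_ j)/forallP/(_ j') := forallP (forallP H2 c) c'.
  by rewrite !h2 it.
- apply/forallP=> c; apply/forallP=> i; apply/forallP=> j.
  by rewrite -(eq_connect (gl c)); apply: (forallP (forallP (forallP H3 c) i)).
- apply/forallP=> t; have /andP[/existsP[i hi] /existsP[j hj]] := forallP H4 t.
  apply/andP; split; apply/existsP; first by exists i; rewrite -gp -h3.
  by exists j; rewrite -gp -h4.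
- apply/forallP=> c; apply/forallP=> c'; apply/implyP=> ne; apply/forallP=> i; apply/forallP=> j.
  have /implyP/(_ ne)/forallP/(_ i)/forallP/(_ j) := forallP (forallP H5 c) c'.
  by rewrite !ow.
Qed.

(** Old vertices stay behind by monotonicity and the new block avoids whatever is behind, so
    disjointness is inherited from the current state alone. *)
Lemma sweeps_step x0 x y p : sweeps x0 x p -> (forall z, step_state x y z) ->
  exists p', sweeps x0 y p'.
Proof.
move=> [fr st pa be di] stp.
(* Any vertex will do to extract the conditions that do not mention it. *)
have /and3P[/same_frameP fxy /existsP[t /and5P[oth sty inb adj prev]] _] := stp (x (inl (Ordinal k_gt0))).
have grow v : behind x v -> behind y v by have /and3P[_ _ /implyP] := stp v.
have same t' : t' != t -> blk y t' =1 blk x t'.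
  move=> ne j; have /implyP/(_ ne)/forallP/(_ j)/eqP := forallP oth t'; by [].
pose N := [seq blk y t j | j <- enum 'I_w.+2].
have Nin v : v \in N -> [/\ ~~ in_guess x v, ~~ behind x v & behind y v].
  by case/mapP => j _ ->; have /and3P := forallP inb j.
exists (fun t' => if t' == t then p t ++ N else p t'); split.
- exact: frame_eq_trans fr fxy.
- move=> t'; case: (eqVneq t' t) => [->|ne].
    rewrite sty; exists (p t ++ [seq blk y t (widen_ord (leqnSn _) j) | j <- enum 'I_w.+1]).
    by rewrite /N enum_ordSr map_rcons rcons_cat -map_comp.
  by have := st t'; rewrite !startedE !(same _ ne).
- move=> t'; case: (eqVneq t' t) => [->|ne]; last exact: pa.
  rewrite cat_path pa /=.
  have lst : last (src x0 t) (p t) = if started x t then blk x t ord_max else src x t.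
    have := st t; case: ifP => _ => [[q ->]|->]; first by rewrite last_rcons.
    by have [_ _ -> _ _] := fr.
  have nE j : j < w.+2 -> nth (blk y t ord0) N j = blk y t (inord j).
    move=> hj; rewrite (nth_map ord0) ?size_enum_ord //; congr (blk y t _).
    by apply: val_inj; rewrite /= nth_enum_ord ?inordK.
  rewrite lst; apply/(pathP (blk y t ord0)) => i; rewrite size_map size_enum_ord => hi.
  rewrite nE //; case: i hi => [|i] hi.
    by rewrite (_ : inord 0 = ord0) //; apply: val_inj; rewrite /= inordK.
  rewrite -[nth _ (_ :: N) i.+1]/(nth (blk y t ord0) N i) nE; last exact: ltnW.
  have /forallP/(_ (inord i.+1))/implyP := forallP adj (inord i).
  by apply; rewrite !inordK // ltnW.
- move=> t' v; case: (eqVneq t' t) => [_|ne]; last by move/be/grow.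
  by rewrite mem_cat => /orP[/be/grow//|/Nin[]].
- move=> t1 t2 v; case: (eqVneq t1 t) => [->|n1]; case: (eqVneq t2 t) => [->|n2] //.
  + by rewrite mem_cat => /orP[|/Nin[_ nb _] /be]; [apply: di|rewrite (negbTE nb)].
  + by move=> h1; rewrite mem_cat => /orP[|/Nin[_ /negP nb _]]; [exact: di h1|case: nb; exact: be h1].
  + exact: di.
Qed.

Lemma sweeps_init x : init_state x -> sweeps x x (fun=> [::]).
Proof.
by case/and5P => h _ _ _ _; split=> // t; rewrite (negbTE (forallP h t)).
Qed.

Lemma sweeps_reaches (x y : {ffun slot -> V}) : init_state x ->
  connect (fun x y : {ffun slot -> V} => [forall z, step_state x y z]) x y ->
  exists p, sweeps x y p.
Proof.
move=> ix /connectP[s hs ->].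
have gen : forall s (u : {ffun slot -> V}) p, sweeps x u p ->
    path (fun x y : {ffun slot -> V} => [forall z, step_state x y z]) u s ->
    exists p, sweeps x (last u s) p.
  elim=> [|z s' IH] u p h0 /=; first by exists p.
  by case/andP=> /forallP hz hs'; have [p1 h1] := sweeps_step h0 hz; apply: IH h1 hs'.
by apply: gen hs; apply: sweeps_init.
Qed.

Lemma in_guess_frame x y : frame_eq x y -> in_guess x =1 in_guess y.
Proof.
case=> h1 h2 _ _ _ v; rewrite !in_guessE !in_termE.
by congr orb; apply: eq_existsb => i; rewrite ?h1 //; apply: eq_existsb => j; rewrite h2.
Qed.

Lemma sound (x y : {ffun slot -> V}) : init_state x -> terms_distinct y ->
  connect (fun x y : {ffun slot -> V} => [forall z, step_state x y z]) x y ->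
  final_state y -> has_family D (termset y) l.
Proof.
move=> ix dy cxy fy; have [p [fr st pa be di]] := sweeps_reaches ix cxy.
have [fr1 fr2 fr3 fr4 _] := fr.
have dx : terms_distinct x.
  by move: dy; congr is_true; apply: eq_forallb => i; apply: eq_forallb => j; rewrite !fr1.
have -> : termset y = termset x.
  by apply/setP=> v; rewrite !inE !in_termE; apply: eq_existsb => i; rewrite fr1.
apply/existsP; exists (built x p); apply: built_family => //; split=> // [t|t v].
  have := forallP fy t; have := st t; rewrite /linked fr3 fr4.
  case: (started y t) => [[q E] dq|->] //.
  have := pa t; rewrite E fr3 => pq.
  rewrite -E; case Ep : (p t) => [|u s]; first by rewrite Ep in E; case: (q) E.
  by rewrite -Ep E rcons_path pq last_rcons.
by move/be => /and3P[h _ _]; rewrite inE (in_guess_frame fr).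
Qed.

End Soundness.
End Vertices.

(** * Completeness of the sweep *)

Section Sweeping.
Variables (k l R g w B n : nat) (D : rel 'I_n).
Local Notation V := 'I_n.
Local Notation T := (pathT l R).
Local Notation slot := (slotT k l R g w B).
Local Notation W := w.+2.
Variables (fr : slot -> V) (X : T -> seq V).
Local Notation Gs := (guessset fr).
Hypothesis semi : forall u v, u != v -> D u v || D v u.
Hypothesis k_gt0 : 0 < k.
Hypothesis HX : linkage D Gs (src fr) (dst fr) X.
Hypothesis Xuniq : forall t, uniq (X t).
Hypothesis Xmin : forall Y, linkage D Gs (src fr) (dst fr) Y -> #|supp X| <= #|supp Y|.
Hypothesis Wsize : forall t, W %| size (X t).
Hypothesis Wbig : 3 * #|T| + 4 <= W.
Hypothesis Bbig : #|T| * #|T| * cut_bound T W <= B.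

Let v0 := term fr (Ordinal k_gt0).
Local Notation x t i := (nth v0 (X t) i).
Local Notation past := (past X W).
Local Notation future := (future X W).
Local Notation block := (last_block X W).
Local Notation dominates := (block_dominates D W).
Local Notation good := (good D X W).

Definition exset sg : {set V} := \bigcup_t \bigcup_t'
  [set v | [&& 0 < sg t, v \in future sg t' & dominates (block sg t) v]].

(** An unstarted path repeats [src fr t], so its first two block entries are equal. Surplus
    exception slots default to the terminal [v0], a guessed vertex and hence never behind. *)
Definition state_at (sg : T -> nat) : {ffun slot -> V} := [ffun i : slot =>
  match i with
  | inr (inl (inr (t, j))) => if sg t == 0 then src fr t else x t ((sg t).-1 * W + j)
  | inr (inr i) => nth v0 (enum (exset sg)) i
  | _ => fr i
  end].

Lemma st_frame sg : frame_eq fr (state_at sg).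
Proof. by split=> [i|c j|t|t|c i j]; rewrite /term /guess /src /dst /flag ffunE. Qed.

Lemma st_blk sg t j :
  blk (state_at sg) t j = if sg t == 0 then src fr t else x t ((sg t).-1 * W + j).
Proof. by rewrite /blk ffunE. Qed.

Lemma st_exc sg i : exc (state_at sg) i = nth v0 (enum (exset sg)) i.
Proof. by rewrite /exc ffunE. Qed.

Lemma st_guess sg v : in_guess eq_op (state_at sg) v = (v \in Gs).
Proof. by rewrite inE -(in_guess_frame (st_frame sg)). Qed.

Definition within sg := forall t, sg t * W <= size (X t).

Lemma block_index sg t j : within sg -> 0 < sg t -> j < W -> (sg t).-1 * W + j < size (X t).
Proof. by move=> h s0 jW; have := h t; case: (sg t) s0 => //= m _; rewrite mulSn; lia. Qed.

Lemma st_started sg t : within sg -> started eq_op (state_at sg) t = (0 < sg t).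
Proof.
move=> h; rewrite startedE !st_blk; case: posnP => s0; first by rewrite eqxx.
by rewrite nth_uniq ?block_index //= addn0 addn1; lia.
Qed.

Lemma dominates_blk sg t v : within sg -> 0 < sg t ->
  (W <= #|[pred j | D (blk (state_at sg) t j) v]| + 2) = dominates (block sg t) v.
Proof.
move=> h s0; have hs := h t; have E : sg t * W = (sg t).-1 * W + W by case: (sg t) s0 => //= m; rewrite mulSnr.
rewrite /block_dominates /last_block -(map_nth_iota v0); last by lia.
have -> : #|[pred j | D (blk (state_at sg) t j) v]| =
    count (fun j => D (blk (state_at sg) t j) v) (enum 'I_W).
  by rewrite cardE /enum_mem size_filter count_filter; apply: eq_count => j; rewrite /= andbT.
have -> : iota ((sg t).-1 * W) W = [seq (sg t).-1 * W + val j | j <- enum 'I_W].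
  by rewrite (map_comp (addn _)) val_enum_ord -iotaDl addn0.
rewrite -map_comp [in RHS]count_map; congr (_ <= _ + 2); apply: eq_count => j /=.
by rewrite st_blk gtn_eqF.
Qed.

Lemma card_exset sg : good sg -> #|exset sg| <= B.
Proof.
move=> gs; apply: leq_trans Bbig; apply: leq_trans (card_bigcup_le _) _.
rewrite -mulnA -sum_nat_const; apply: leq_sum => t _.
apply: leq_trans (card_bigcup_le _) _.
rewrite -sum_nat_const; apply: leq_sum => t' _.
have := forallP (forallP gs t) t'; case: (posnP (sg t)) => s0 /=.
  by move=> _; rewrite (_ : finset _ = set0) ?cards0 //; apply/setP=> v; rewrite !inE.
apply: leq_trans; rewrite -size_filter.
apply: leq_trans (card_size _); apply/subset_leq_card/subsetP=> v.
by rewrite inE => /andP[vf vd]; rewrite mem_filter vd.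
Qed.

Lemma exset_future sg v : v \in exset sg -> exists t, v \in future sg t.
Proof. by case/bigcupP=> t _ /bigcupP[t' _]; rewrite inE => /and3P[_ h _]; exists t'. Qed.

Lemma st_excP sg v : good sg -> v \notin Gs ->
  [exists i, v == exc (state_at sg) i] = (v \in exset sg).
Proof.
move=> gs vG; apply/existsP/idP => [[i /eqP]|vE].
  rewrite st_exc => Ev; rewrite -mem_enum; case: (ltnP i (size (enum (exset sg)))) => hi.
    by rewrite Ev mem_nth.
  by case/negP: vG; rewrite Ev nth_default // inE in_guessE in_termE; apply/orP; left; apply/existsP; exists (Ordinal k_gt0).
have hi : index v (enum (exset sg)) < B.
  by apply: leq_trans (card_exset gs); rewrite cardE index_mem mem_enum.
by exists (Ordinal hi); rewrite st_exc /= nth_index ?mem_enum.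
Qed.

Lemma mem_past sg t i : within sg -> i < size (X t) -> (x t i \in past sg t) = (i < sg t * W).
Proof.
by move=> h hi; rewrite in_take_leq // index_uniq.
Qed.

Lemma past_future sg t t' v : v \in past sg t -> v \notin future sg t'.
Proof.
move=> vp; apply/negP => vf; have [_ _ di] := HX.
have E := di _ _ _ (mem_take vp) (mem_drop vf); subst t'.
have := Xuniq t; rewrite -(cat_take_drop (sg t * W) (X t)) cat_uniq => /and3P[_ /hasPn/(_ _ vf)/negP].
by case.
Qed.

Let X_guess t v : v \in X t -> v \notin Gs. Proof. by have [_ h _] := HX; apply: h. Qed.

Lemma in_blockP sg v : within sg -> reflect
  (exists t i, [/\ v = x t i, (sg t).-1 * W <= i, i < sg t * W & i < size (X t)])
  (in_block eq_op (state_at sg) v).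
Proof.
move=> h; apply: (iffP existsP) => [[t /andP[]]|[t [i [-> h1 h2 h3]]]].
  rewrite st_started // => s0 /existsP[j /eqP->]; exists t, ((sg t).-1 * W + j).
  rewrite st_blk gtn_eqF // block_index // leq_addr; split=> //.
  by case: (sg t) s0 => //= m _; rewrite mulSnr ltn_add2l.
have s0 : 0 < sg t by case: (sg t) h2.
have E : sg t * W = (sg t).-1 * W + W by case: (sg t) s0 => //= m; rewrite mulSnr.
exists t; rewrite st_started // s0 /=; apply/existsP.
have hj : i - (sg t).-1 * W < W by lia.
by exists (Ordinal hj); rewrite st_blk gtn_eqF //= subnKC.
Qed.

Lemma block_domP sg v : within sg -> reflect
  (exists2 t, 0 < sg t & dominates (block sg t) v) (block_dom D eq_op (state_at sg) v).
Proof.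
move=> h; apply: (iffP existsP) => [[t /andP[]]|[t s0 d]]; last exists t.
  by rewrite st_started // => s0; rewrite dominates_blk //; exists t.
by rewrite st_started // s0 dominates_blk.
Qed.

(** A vertex before the current block is dominated by all of it but perhaps its first vertex; a
    future vertex dominated by a block is an exception, by the choice of [exset]. *)
Lemma behind_in sg t i : within sg -> good sg -> i < size (X t) ->
  behind D eq_op (state_at sg) (x t i) = (i < sg t * W).
Proof.
move=> hw hg hi; have xX : x t i \in X t by apply: mem_nth.
have xG := X_guess xX; rewrite /behind st_guess xG st_excP //=.
case: ltnP => h.
  have -> /= : x t i \notin exset sg.
    apply/negP=> /exset_future[t']; apply/negP.
    by apply: (past_future (t := t)); rewrite mem_past.
  case: (leqP ((sg t).-1 * W) i) => h2.
    by apply/orP; left; apply/in_blockP => //; exists t, i.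
  apply/orP; right; apply/block_domP => //.
  have s0 : 0 < sg t by case: (sg t) h.
  exists t => //; rewrite -dominates_blk //.
  have sub : predC1 ord0 \subset [pred j | D (blk (state_at sg) t j) (x t i)].
    apply/subsetP=> j; rewrite !inE => j0; rewrite st_blk gtn_eqF //.
    have jp : 0 < j by rewrite lt0n -(inj_eq val_inj) in j0 *.
    by apply: (x_back semi v0 HX Xuniq Xmin); [have := leq_add h2 jp; rewrite addn1|apply: block_index].
  by apply: leq_trans (leq_add (subset_leq_card sub) (leqnn 2)); rewrite cardC1 card_ord /= addn2.
apply/negbTE/negP => /andP[ne /orP[/in_blockP|/block_domP]].
  case=> // t' [i' [E h1 h2 h3]]; have [Et Ei] := x_inj HX Xuniq hi h3 E.
  by subst t' i'; lia.
case=> // t' s0 d; case/negP: ne.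
apply/bigcupP; exists t' => //; apply/bigcupP; exists t => //.
rewrite inE s0 d andbT /=; rewrite -(subnKC h) -nth_drop mem_nth // size_drop.
by rewrite ltn_sub2r // (leq_ltn_trans h).
Qed.

Lemma behind_out sg v : within sg -> good sg -> v \notin supp X -> v \notin Gs ->
  behind D eq_op (state_at sg) v = [exists t, (0 < sg t) && dominates (block sg t) v].
Proof.
move=> hw hg vX vG; rewrite /behind st_guess vG st_excP //=.
have -> /= : v \notin exset sg.
  apply: contra vX => /exset_future[t /mem_drop vt]; apply/suppP; by exists t.
apply/orP/existsP => [[/in_blockP|/block_domP]|[t /andP[s0 d]]].
- case=> // t [i [E _ _ hi]]; case/negP: vX; apply/suppP; exists t; by rewrite E mem_nth.
- by case=> // t s0 d; exists t; rewrite s0.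
- by right; apply/block_domP => //; exists t.
Qed.

(** The delicate case is a vertex off the linkage dominated by the block that moves on: [x_outside]
    hands it over to all but the first two vertices of the next block. *)
Lemma st_step sg t : within sg -> good sg -> sg t * W + W <= size (X t) ->
  good (advance sg t) -> forall z, step_state D eq_op (state_at sg) (state_at (advance sg t)) z.
Proof.
move=> hw hg ht hg' z; set sg' := advance sg t.
have hw' : within sg'.
  by move=> t'; rewrite /sg' /advance; case: eqP => [->|_] //; rewrite mulSnr.
have sgt : sg' t = (sg t).+1 by rewrite /sg' /advance eqxx.
have sgo t' : t' != t -> sg' t' = sg t' by rewrite /sg' /advance => /negbTE->.
have bt (j : 'I_W) : blk (state_at sg') t j = x t (sg t * W + j) by rewrite st_blk sgt.
have jsz (j : 'I_W) : sg t * W + j < size (X t).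
  by apply: leq_trans ht; rewrite ltn_add2l.
apply/and3P; split.
- apply/same_frameP; have [a1 a2 a3 a4 a5] := st_frame sg; have [b1 b2 b3 b4 b5] := st_frame sg'.
  split=> [i|c j|u|u|c i j].
  + exact: etrans (esym (a1 i)) (b1 i).
  + exact: etrans (esym (a2 c j)) (b2 c j).
  + exact: etrans (esym (a3 u)) (b3 u).
  + exact: etrans (esym (a4 u)) (b4 u).
  + exact: etrans (esym (a5 c i j)) (b5 c i j).
- apply/existsP; exists t; apply/and5P; split.
  + apply/forallP=> t'; apply/implyP=> ne; apply/forallP=> j.
    by rewrite !st_blk sgo.
  + by rewrite st_started // sgt.
  + apply/forallP=> j; rewrite bt st_guess !behind_in // sgt mulSnr.
    by rewrite ltn_add2l ltn_ord -leqNgt leq_addr (X_guess (mem_nth v0 (jsz j))).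
  + apply/forallP=> i; apply/forallP=> j; apply/implyP=> /eqP E; rewrite !bt E addnS.
    by apply: (x_step v0 HX); rewrite -addnS -E.
  + rewrite bt /= addn0 st_started //; case: posnP => s0.
      have [_ _ <- _ _] := st_frame sg; rewrite s0 mul0n.
      have ne : X t != [::] by case: (X t) ht => //=; rewrite s0.
      by have := X_path HX ne; case: (X t) ne => // u s _ /= /andP[].
    rewrite st_blk gtn_eqF //=.
    have E : sg t * W = ((sg t).-1 * W + w.+1).+1 by case: (sg t) s0 => //= m; rewrite mulSnr; lia.
    by rewrite E; apply: (x_step v0 HX); rewrite -E; have := jsz ord0; rewrite addn0.
- apply/implyP=> bz; have : z \notin Gs by case/and3P: bz; rewrite st_guess.
  move=> zG; case zX : (z \in supp X).
    have /suppP[t' /(nthP v0)[i hi Ez]] := zX; move: bz; rewrite -Ez !behind_in //.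
    move=> h; apply: leq_trans h _; rewrite leq_mul2r; apply/orP; right.
    by rewrite /sg' /advance; case: ifP.
  move: bz; rewrite !behind_out ?zX // => /existsP[t' /andP[s0 d]]; apply/existsP.
  exists t'; case: (eqVneq t' t) => [E|ne]; last first.
    by rewrite sgo // s0; move: d; rewrite /last_block sgo.
  subst t'; rewrite sgt /= -dominates_blk ?sgt //.
  move: d; rewrite -dominates_blk // => d.
  (* [W] exceeds the two tolerated failures, so some vertex of the old block does dominate [z]. *)
  have /card_gt0P[j0] : 0 < #|[pred j | D (blk (state_at sg) t j) z]| by move: Wbig d; lia.
  rewrite inE st_blk gtn_eqF // => dj.
  have E : sg t * W = (sg t).-1 * W + W by case: (sg t) (s0) => //= m; rewrite mulSnr.
  have sub : [pred j : 'I_W | 1 < j] \subset [pred j | D (blk (state_at sg') t j) z].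
    apply/subsetP=> j; rewrite !inE => hj; rewrite bt.
    apply: (x_outside semi HX Xuniq Xmin zG _ _ (jsz j) dj); first by rewrite zX.
    by have := ltn_ord j0; lia.
  apply: leq_trans (_ : #|[pred j : 'I_W | 1 < j]| + 2 <= _); last by rewrite leq_add2r subset_leq_card.
  have := cardC [pred j : 'I_W | 1 < j]; rewrite card_ord => {1}<-; rewrite leq_add2l.
  have sub2 : predC [pred j : 'I_W | 1 < j] \subset [:: ord0; Ordinal (isT : 1 < W)].
    by apply/subsetP=> -[[|[|j]] hj]; rewrite !inE.
  by apply: leq_trans (subset_leq_card sub2) _; apply: leq_trans (card_size _) _.
Qed.

Lemma sweep_final sg : within sg -> good sg -> exists sg', [/\ within sg', good sg',
  connect (fun x y : {ffun slot -> V} => [forall z, step_state D eq_op x y z]) (state_at sg) (state_at sg')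
  & forall t, sg' t * W = size (X t)].
Proof.
have [m] := ubnP (\sum_t (size (X t) - sg t * W)); elim: m sg => // m IH sg hm hw hg.
case: (pickP [pred t | sg t * W < size (X t)]) => [t0 /= ht0|none]; last first.
  exists sg; split=> // t; apply/eqP; rewrite eqn_leq hw leqNgt.
  by have := none t; rewrite /= => ->.
have [t [ht hg']] := good_advance semi v0 HX Xuniq Xmin Wsize Wbig hg ht0.
have htW : sg t * W + W <= size (X t) by apply: (unfinished_size Wsize Wbig hg).
have hw' : within (advance sg t).
  by move=> t'; rewrite /advance; case: eqP => [->|_] //; rewrite mulSnr.
have [||//|sg' [h1 h2 h3 h4]] := IH (advance sg t).
- rewrite ltnS in hm; apply: leq_trans hm; rewrite (bigD1 t) //= [X in _ < X](bigD1 t) //=.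
  rewrite -addSn leq_add //; first by rewrite /advance eqxx mulSnr; lia.
  by apply: leq_sum => t' ne; rewrite /advance (negbTE ne).
- exact: hw'.
exists sg'; split=> //; apply: connect_trans (connect1 _) h3; apply/forallP.
exact: st_step.
Qed.

Lemma sweep_run : init_state D eq_op (state_at (fun=> 0)) -> exists x y : {ffun slot -> V},
  [/\ init_state D eq_op x, final_state D eq_op y, frame_eq fr x, frame_eq fr y
   & connect (fun x y : {ffun slot -> V} => [forall z, step_state D eq_op x y z]) x y].
Proof.
move=> hi; have [||sg [hw hg hc hs]] := @sweep_final (fun=> 0).
- by move=> t; rewrite mul0n.
- by apply/forallP=> t; apply/forallP=> t'.
exists (state_at (fun=> 0)), (state_at sg); split; try exact: st_frame; rewrite //.
apply/forallP=> t; rewrite st_started //; have [_ _ Es Ed _] := st_frame sg; rewrite -Es -Ed.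
have [/(_ t) + _ _] := HX; rewrite /linked st_blk; have := hs t; case: posnP => s0.
  by rewrite s0 mul0n; case: (X t).
case E : (X t) => [|u s]; first by move/eqP; rewrite muln_eq0 orbF eqn0Ngt s0.
rewrite -E => hsz; rewrite rcons_path => /andP[_].
have -> : (sg t).-1 * W + (ord_max : 'I_W) = (size (X t)).-1.
  by rewrite -hsz; case: (sg t) s0 => // m _; rewrite -[m.+1.-1]/m mulSnr addnS.
by rewrite nth_last E.
Qed.

End Sweeping.

(** * From a minimum family to a walk *)

Section Complete.
Variables (k l n : nat) (D : rel 'I_n) (s : 'I_k -> 'I_n).
Local Notation V := 'I_n.
(** [R] bounds the segments of one member, so there are [l * R] paths and the block length [w.+2] is
    the least one allowed by [Wbig]. [g] is the size bound of [decomposition] for that block length,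
    and [B] allows [cut_bound] exceptions for each ordered pair of paths. *)
Let R := 2 * k.
Let w := 3 * (l * R) + 2.
Let g := 3 * k + 2 * k * w.+2.
Let B := (l * R) * (l * R) * (w.+2 + l * R + 1).
Local Notation T := (pathT l R).
Local Notation slot := (slotT k l R g w B).
Hypothesis k_gt1 : 1 < k.
Hypothesis semi : forall u v, u != v -> D u v || D v u.
Hypothesis s_inj : injective s.
Let S : {set V} := [set v | [exists i, v == s i]].

Let card_S : #|S| = k.
Proof.
rewrite -[RHS](card_ord k) -(card_imset _ s_inj); apply: eq_card => v.
rewrite inE; apply/existsP/imsetP => [[i /eqP->]|[i _ ->]]; by exists i.
Qed.

Let sS i : s i \in S. Proof. by rewrite inE; apply/existsP; exists i. Qed.
Let i0 : 'I_k := Ordinal (ltnW k_gt1).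
Let i1 : 'I_k := Ordinal k_gt1.
(** A vertex different from [v], to write a zero bit into a flag; two terminals suffice. *)
Let other v := if v == s i0 then s i1 else s i0.
Let other_neq v : (other v == v) = false.
Proof.
rewrite /other; case: (eqVneq v (s i0)) => [->|ne]; last by rewrite eq_sym (negbTE ne).
by rewrite (inj_eq s_inj).
Qed.

Variable F : {ffun 'I_l -> {set V} * {set V * V}}.
Hypothesis famF : S_int_disjoint_family D S F.
Hypothesis minF : forall F' : {ffun 'I_l -> {set V} * {set V * V}}, S_int_disjoint_family D S F' ->
  \sum_c #|(F c).1| <= \sum_c #|(F' c).1|.

Let F_sub c u v : (u, v) \in (F c).2 -> [/\ D u v, u \in (F c).1 & v \in (F c).1].
Proof. by have /and4P[/forallP/(_ c)/forall_inP h _ _ _] := famF; move/h/and3P. Qed.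
Let F_strong c u v : u \in (F c).1 -> v \in (F c).1 ->
  connect (fun x y => (x, y) \in (F c).2) u v.
Proof.
have /and4P[_ /forallP/(_ c)/forall_inP h _ _] := famF.
by move=> /h/forall_inP h2; apply: h2.
Qed.
Let F_S c : {subset S <= (F c).1}.
Proof. by have /and4P[_ _ /forallP/(_ c)/subsetP h _] := famF. Qed.
Let F_disj c c' : c != c' ->
  ((F c).1 :&: (F c').1 = S) /\ ((F c).2 :&: (F c').2 = set0).
Proof.
have /and4P[_ _ _ /forallP h] := famF; rewrite -val_eqE /= neq_ltn => /orP[lt|lt].
  by have /implyP/(_ lt)/andP[/eqP-> /eqP->] := forallP (h c) c'.
by have /implyP/(_ lt)/andP[/eqP<- /eqP<-] := forallP (h c') c; rewrite setIC (setIC (F c).2).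
Qed.

(** The member enlarged by all arcs of [D] on its vertices except those inside [S], so that it is
    semicomplete where [decomposition] demands it. *)
Let h c : rel V := fun u v => [&& u \in (F c).1, v \in (F c).1, D u v
  & ((u \in S) && (v \in S)) ==> ((u, v) \in (F c).2)].

Let dec c : exists (G : {set V}) (sg : seq (V * seq V * V)),
  [/\ [/\ S \subset G, G \subset (F c).1, #|G| <= 3 * #|S| + 2 * #|S| * w.+2 & size sg <= 2 * #|S|],
      {in sg, forall q, [/\ q.1.1 \in G, q.2 \in G, path (h c) q.1.1 (rcons q.1.2 q.2),
                            w.+2 %| size q.1.2 & q.1.2 != [::]]},
      {in flatten [seq q.1.2 | q <- sg], forall v, v \in (F c).1 :\: G},
      uniq (flatten [seq q.1.2 | q <- sg])
    & {in G &, forall u v, connect [rel x y | [&& x \in G, y \in G & h c x y || link sg x y]] u v}].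
Proof.
apply: decomposition => //.
- exact/subsetP/F_S.
- by apply/set0Pn; exists (s i0).
- by move=> u v /and4P[].
- move=> u v uc vc ne nS; rewrite /h uc vc (negbTE nS) [(v \in S) && _]andbC (negbTE nS) /= !andbT.
  exact: semi.
- move=> u v uc vc; apply: connect_sub (F_strong uc vc) => x y hxy; apply: connect1.
  by have [d xc yc] := F_sub hxy; rewrite /h xc yc d hxy implybT.
Qed.

Lemma complete_min : exists x y : {ffun slot -> V},
  [/\ init_state D eq_op x, final_state D eq_op y, term x =1 s, term y =1 s
   & connect (fun x y : {ffun slot -> V} => [forall z, step_state D eq_op x y z]) x y].
Proof.
have [G /fin_all_exists[sg H]] := fin_all_exists dec.
(* Surplus path indices receive an empty segment with equal ends, which [linked] accepts. *)
pose dummy := (s i0, [::] : seq V, s i0).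
pose seg (t : T) := nth dummy (sg t.1) t.2.
have GS c : {subset S <= G c} by have [[/subsetP h1 _ _ _] _ _ _ _] := H c.
have GF c : {subset G c <= (F c).1} by have [[_ /subsetP h1 _ _] _ _ _ _] := H c.
have segP (t : T) : (t.2 < size (sg t.1)) && (seg t \in sg t.1) || (seg t == dummy).
  rewrite /seg; case: ltnP => hs /=; first by rewrite mem_nth.
  by rewrite nth_default.
pose fr : slot -> V := fun i => match i with
  | inl i => s i
  | inr (inl (inl (inl (inl (c, j))))) => nth (s i0) (enum (G c)) j
  | inr (inl (inl (inl (inr (t, b))))) => if b then (seg t).1.1 else (seg t).2
  | inr (inl (inl (inr (c, (i, j))))) => if (s i, s j) \in (F c).2 then s i else other (s i)
  | _ => s i0
  end.
have ownsE c i j : owns eq_op fr c i j = ((s i, s j) \in (F c).2).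
  by rewrite /owns /flag /term /=; case: ifP; rewrite ?eqxx ?other_neq.
have in_termE' v : in_term eq_op fr v = (v \in S) by rewrite inE.
have guessG c j : guess fr c j \in G c.
  rewrite /guess /=; case: (ltnP j (size (enum (G c)))) => hj; first by rewrite -mem_enum mem_nth.
  by rewrite nth_default // GS.
have G_guess c v : v \in G c -> exists j, guess fr c j = v.
  move=> vG; have hj : index v (enum (G c)) < g.
    have [[_ _ hg _] _ _ _ _] := H c; rewrite card_S in hg; apply: leq_trans hg.
    by rewrite cardE index_mem mem_enum.
  by exists (Ordinal hj); rewrite /guess /= nth_index ?mem_enum.
have gpG c i : gpoint fr c i \in G c by case: i => [i|j] /=; rewrite ?guessG // GS.
have G_gp c v : v \in G c -> exists i, gpoint fr c i = v.
  by case/G_guess => j <-; exists (inr j).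
have srcG c r : src fr (c, r) \in G c.
  rewrite /src /=; case/orP: (segP (c, r)) => [/andP[_ e]|/eqP->]; last exact/GS/sS.
  by have [_ /(_ _ e)[]] := H c.
have dstG c r : dst fr (c, r) \in G c.
  rewrite /dst /=; case/orP: (segP (c, r)) => [/andP[_ e]|/eqP->]; last exact/GS/sS.
  by have [_ /(_ _ e)[]] := H c.
have meetS c c' v : c != c' -> v \in (F c).1 -> v \in (F c').1 -> v \in S.
  by move/F_disj => [<- _] v1 v2; rewrite inE v1.
pose X (t : T) := (seg t).1.2.
have XF c r v : v \in X (c, r) -> v \in (F c).1 :\: G c.
  rewrite /X; case/orP: (segP (c, r)) => [/andP[_ e]|/eqP->] // vX.
  have [_ _ hm _ _] := H c; apply: hm; apply/flattenP; exists (seg (c, r)).1.2 => //.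
  exact: map_f.
have X_S c r v : v \in X (c, r) -> v \notin S.
  by move/XF/setDP => [_]; apply: contra; apply: GS.
have X_guess (t : T) v : v \in X t -> v \notin guessset fr.
  case: t => c r vX; rewrite inE in_guessE in_termE' negb_or (X_S _ _ _ vX) /=.
  have /setDP[vF /negP vG] := XF _ _ _ vX.
  apply/existsP=> -[c' /existsP[j /eqP Ev]]; have vG' : v \in G c' by rewrite Ev.
  case: (eqVneq c c') => [E|ne]; first by apply: vG; rewrite E.
  by case/negP: (X_S _ _ _ vX); apply: meetS ne vF (GF _ _ vG').
have X_path (t : T) : X t != [::] -> path (h t.1) (src fr t) (rcons (X t) (dst fr t)).
  rewrite /src /dst /X /=; case/orP: (segP t) => [/andP[_ e] _|/eqP->] //.
  by have [_ /(_ _ e)[]] := H t.1.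
have X_link : linkage D (guessset fr) (src fr) (dst fr) X.
  split=> [[c r]||[c r] [c' r'] v vX vX'].
  - rewrite /linked; have := X_path (c, r); case E : (X (c, r)) => [|u p].
      move=> _; move: E; rewrite /src /dst /X /=.
      case/orP: (segP (c, r)) => [/andP[_ e]|/eqP->] // E.
      by have [_ /(_ _ e)[_ _ _ _]] := H c; rewrite E.
    by move/(_ isT); apply: sub_path => x y /and4P[].
  - exact: X_guess.
  have /setDP[v1 _] := XF _ _ _ vX; have /setDP[v2 _] := XF _ _ _ vX'.
  case: (eqVneq c c') => [E|ne]; last first.
    by case/negP: (X_S _ _ _ vX); apply: meetS ne v1 v2.
  subst c'; congr (_, _); apply/eqP/negPn/negP => ne; move: vX vX'; rewrite /X.
  case/orP: (segP (c, r)) => [/andP[hr _]|/eqP->] //.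
  case/orP: (segP (c, r')) => [/andP[hr' _]|/eqP->] //.
  have [_ _ _ hu _] := H c; rewrite /seg /=.
  wlog lt : r r' ne hr hr' / r < r'.
    move=> HH a b; move: (ne); rewrite -val_eqE /= neq_ltn => /orP[lt|lt].
      exact: (HH r r').
    by apply: (HH r' r) => //; rewrite eq_sym.
  move: hu; rewrite -{1}(cat_take_drop r' (sg c)) map_cat flatten_cat cat_uniq.
  case/and3P=> _ /hasPn hn _ a b.
  have b' : v \in flatten [seq q.1.2 | q <- drop r' (sg c)].
    apply/flattenP; exists (nth dummy (sg c) r').1.2 => //; apply: map_f.
    by rewrite -[in X in nth _ _ X](addn0 r') -nth_drop mem_nth // size_drop subn_gt0.
  have := hn _ b'; rewrite /= => /negP; apply.
  apply/flattenP; exists (nth dummy (sg c) r).1.2 => //; apply: map_f.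
  by rewrite -(nth_take _ lt) mem_nth // size_take hr'.
have X_uniq (t : T) : uniq (X t).
  rewrite /X; case/orP: (segP t) => [/andP[_ e]|/eqP->] //.
  have [_ _ _ hu _] := H t.1; move: hu; case/splitPr: e => p1 p2.
  by rewrite map_cat flatten_cat /= !cat_uniq => /and5P[_ _ ->].
have X_size (t : T) : w.+2 %| size (X t).
  rewrite /X; case/orP: (segP t) => [/andP[_ e]|/eqP->]; last by rewrite dvdn0.
  by have [_ /(_ _ e)[]] := H t.1.
have frdist : terms_distinct eq_op fr.
  by apply/forallP=> i; apply/forallP=> j; apply/implyP => /eqP/s_inj->.
have gs_link c i j : h c (gpoint fr c i) (gpoint fr c j) -> glink D eq_op fr c i j.
  case/and4P=> _ _ d /implyP hS; apply/or3P; apply: Or32; rewrite /arc d !in_termE' /=.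
  apply/implyP=> uv; have /andP[uS vS] := uv; move: (hS uv) uS vS; rewrite !inE.
  move=> hA /existsP[i' /eqP Ei] /existsP[j' /eqP Ej]; apply/existsP; exists i'.
  by apply/existsP; exists j'; apply/and3P; split;
    [rewrite Ei; exact: eqxx|rewrite Ej; exact: eqxx|rewrite ownsE -Ei -Ej].
have glink_step c i j : [&& gpoint fr c i \in G c, gpoint fr c j \in G c
    & h c (gpoint fr c i) (gpoint fr c j) || link (sg c) (gpoint fr c i) (gpoint fr c j)] ->
    glink D eq_op fr c i j.
  case/and3P=> _ _ /orP[|/hasP[e es /andP[/eqP e1 /eqP e2]]]; first exact: gs_link.
  have hr : index e (sg c) < R.
    have [[_ _ _ hs] _ _ _ _] := H c; rewrite card_S in hs.
    by apply: leq_trans hs; rewrite index_mem.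
  apply/or3P; apply: Or33; apply/existsP; exists (Ordinal hr).
  by rewrite /src /dst /= /seg /= nth_index // -e1 -e2 !eqxx.
have glink_connect c i j : connect (glink D eq_op fr c) i j.
  have [_ _ _ _ /(_ _ _ (gpG c i) (gpG c j))/connectP[p]] := H c.
  elim: p i => [|u p IH] i /=.
    by move=> _ E; apply: connect1; apply/or3P; apply: Or31; rewrite E.
  case/andP=> hu hp El; have /and3P[_ uG _] := hu; have [i' Ei] := G_gp _ _ uG.
  apply: connect_trans (connect1 (glink_step c i i' _)) (IH i' _ _); by rewrite Ei.
have fr_init : init_state D eq_op fr.
  apply/and5P; split.
  - by apply/forallP=> t; rewrite startedE /blk /= eqxx.
  - apply/forallP=> c; apply/forallP=> c'; apply/implyP=> ne; apply/forallP=> j; apply/forallP=> j'.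
    apply/implyP=> /eqP E; rewrite in_termE'; apply: meetS ne (GF _ _ (guessG c j)) _.
    by rewrite E; apply/GF/guessG.
  - by apply/forallP=> c; apply/forallP=> i; apply/forallP=> j; apply: glink_connect.
  - apply/forallP=> -[c r]; apply/andP; split; apply/existsP.
    + by have [i Ei] := G_gp _ _ (srcG c r); exists i; rewrite Ei.
    + by have [i Ei] := G_gp _ _ (dstG c r); exists i; rewrite Ei.
  - apply/forallP=> c; apply/forallP=> c'; apply/implyP=> ne; apply/forallP=> i; apply/forallP=> j.
    rewrite !ownsE; apply/negP=> /andP[o1 o2]; have [_ /setP/(_ (s i, s j))] := F_disj ne.
    by rewrite inE o1 o2 inE.
(* Terminals and guesses contribute equally to [F] and to the family rebuilt from [Y], so comparing
   the totals compares the supports. *)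
have X_min Y : linkage D (guessset fr) (src fr) (dst fr) Y -> #|supp X| <= #|supp Y|.
  move=> LY; have := minF (built_family frdist fr_init LY).
  move/leq_trans/(_ (built_size frdist fr_init LY)).
  rewrite -[termset fr]/S; set Gs := guessset fr.
  have FE c : #|(F c).1| = #|S| + #|(F c).1 :\: S|.
    by rewrite -(cardsID S) (setIidPr _) //; apply/subsetP/F_S.
  rewrite (eq_bigr _ (fun c _ => FE c)) big_split /= sum_nat_const card_ord -addnA leq_add2l.
  have sub : (Gs :\: S) :|: supp X \subset \bigcup_c ((F c).1 :\: S).
    apply/subsetP=> v; rewrite in_setU in_setD => /orP[/andP[vS]|/suppP[[c r] vX]].
      rewrite inE in_guessE in_termE' (negbTE vS) /= => /existsP[c /existsP[j /eqP Ev]].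
      by apply/bigcupP; exists c => //; rewrite in_setD vS Ev (GF _ _ (guessG c j)).
    apply/bigcupP; exists c => //; have /setDP[v1 _] := XF _ _ _ vX.
    by rewrite in_setD v1 (X_S _ _ _ vX).
  move/(leq_trans (leq_trans (subset_leq_card sub) (card_bigcup_le _))).
  rewrite cardsU (_ : _ :&: _ = set0) ?cards0 ?subn0 ?leq_add2l //.
  apply/setP=> v; rewrite inE in_set0 in_setD; apply/negP=> /andP[/andP[_ vG] /suppP[t /X_guess]].
  by rewrite vG.
have cT : #|T| = l * R by rewrite card_prod !card_ord.
have [|||x [y [h1 h2 h3 h4 h5]]] := @sweep_run k l R g w B n D fr X semi (ltnW k_gt1) X_link X_uniq X_min X_size.
- by rewrite cT /w; lia.
- by rewrite /cut_bound cT.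
- apply: init_frame fr_init; first exact: st_frame.
  by move=> t; rewrite startedE !st_blk /= !eqxx.
have [t1 _ _ _ _] := h3; have [t2 _ _ _ _] := h4.
by exists x, y; split.
Qed.

End Complete.

(** * Connectivity as a reachability query *)

Section Kappa.
Variables (n : nat) (D : rel 'I_n).

(** Each member contains two vertices of [S], hence an arc, and different members have different
    arcs. *)
Lemma has_family_cap (S : {set 'I_n}) p : 1 < #|S| -> has_family D S p -> p <= n * n.
Proof.
move=> S1 /existsP[F /and4P[_ /forallP hstr /forallP hS /forallP hd]].
have [u [v [uS vS ne]]] : exists u v, [/\ u \in S, v \in S & u != v].
  by have /card_gt1P[u [v]] := S1; exists u, v.
have arcF i : exists a, a \in (F i).2.
  have uF := subsetP (hS i) _ uS; have vF := subsetP (hS i) _ vS.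
  have /forall_inP/(_ u uF)/forall_inP/(_ v vF)/connectP[[|z q] /=] := hstr i.
    by move=> _ E; rewrite E eqxx in ne.
  by case/andP=> h _ _; exists (u, z).
have /fin_all_exists[f hf] := arcF.
have finj : injective f.
  move=> i j E; apply/eqP/negPn/negP; rewrite -val_eqE /= neq_ltn => /orP[lt|lt].
    have /implyP/(_ lt)/andP[_ /eqP/setP/(_ (f i))] := forallP (hd i) j.
    by rewrite inE hf E hf inE.
  have /implyP/(_ lt)/andP[_ /eqP/setP/(_ (f i))] := forallP (hd j) i.
  by rewrite inE hf E hf inE.
by have := leq_card f finj; rewrite card_prod !card_ord.
Qed.

Lemma has_family_le (S : {set 'I_n}) p l : l <= p -> has_family D S p -> has_family D S l.
Proof.
move=> lp /existsP[F /and4P[/forallP h1 /forallP h2 /forallP h3 /forallP h4]].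
apply/existsP; exists [ffun i => F (widen_ord lp i)]; apply/and4P; split.
- by apply/forallP=> i; rewrite ffunE.
- by apply/forallP=> i; rewrite ffunE.
- by apply/forallP=> i; rewrite ffunE.
- apply/forallP=> i; apply/forallP=> j; rewrite !ffunE.
  exact: (forallP (h4 (widen_ord lp i)) (widen_ord lp j)).
Qed.

Lemma leq_kappaS (S : {set 'I_n}) l : 0 < l -> 1 < #|S| ->
  (l <= kappaS D S) = has_family D S l.
Proof.
move=> l0 S1; apply/idP/idP => [|hl]; last first.
  have ll : l < (n * n).+1 by rewrite ltnS (has_family_cap S1).
  exact: (@leq_bigmax_cond _ _ (fun p : 'I_(n * n).+1 => p : nat) (Ordinal ll)).
apply: contraTT => nl; rewrite -ltnNge /kappaS -(prednK l0) ltnS.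
apply/bigmax_leqP => p hp; rewrite -ltnS prednK // ltnNge; apply: contra nl => lp.
exact: has_family_le hp.
Qed.

Lemma leq_kappa_k k l : 0 < l -> 1 < k -> k <= n ->
  reflect (forall S : {set 'I_n}, #|S| = k -> has_family D S l) (l <= kappa_k D k).
Proof.
move=> l0 k1 kn; apply: (iffP idP) => [h S Sk|h].
  rewrite -leq_kappaS ?Sk //; apply: leq_trans h _; rewrite /kappa_k.
  have : S \in index_enum {set 'I_n} by rewrite mem_index_enum.
  elim: (index_enum _) => // S' r IH; rewrite inE big_cons => /orP[/eqP<-|/IH h].
    by rewrite Sk eqxx geq_minl.
  by case: ifP => // _; apply: leq_trans (geq_minr _ _) h.
have [S Sk] : exists S : {set 'I_n}, #|S| = k.
  have := card_draws 'I_n k; rewrite card_ord => E.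
  have : 0 < 'C(n, k) by rewrite bin_gt0.
  by rewrite -E => /card_gt0P[S]; rewrite inE => /eqP; exists S.
(* The initial value [n * n] is at least [l] by [has_family_cap], applied to some set of size
   [k]. *)
rewrite /kappa_k; elim/big_ind: _ => [|a b ha hb|S' /eqP hS'].
- by apply: (has_family_cap (S := S)); [rewrite Sk|apply: h].
- by rewrite leq_min ha.
- by rewrite leq_kappaS ?hS' // h.
Qed.

End Kappa.

Section Rename.
Variables (k l R g w B : nat) (V W : Type) (d e : rel V) (h : W -> V).
Local Notation slot := (slotT k l R g w B).
Local Notation pull r := (fun i j => r (h i) (h j)).
Lemma glink_map (x : slot -> W) c :
  glink (pull d) (pull e) x c =2 glink d e (fun i => h (x i)) c.
Proof. by move=> [i|i] [j|j]. Qed.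
Lemma init_state_map (x : slot -> W) :
  init_state (pull d) (pull e) x = init_state d e (fun i => h (x i)).
Proof.
rewrite /init_state; apply: (f_equal2 andb); first by [].
apply: (f_equal2 andb); first by [].
apply: (f_equal2 andb).
  apply: eq_forallb => c; apply: eq_forallb => i; apply: eq_forallb => j.
  exact: (eq_connect (glink_map x c)).
apply: (f_equal2 andb); last by [].
by apply: eq_forallb => t; apply: (f_equal2 andb); apply: eq_existsb => -[i|i].
Qed.
Lemma final_state_map (x : slot -> W) :
  final_state (pull d) (pull e) x = final_state d e (fun i => h (x i)).
Proof. by []. Qed.
Lemma step_state_map (x y : slot -> W) z :
  step_state (pull d) (pull e) x y z = step_state d e (fun i => h (x i)) (fun i => h (y i)) (h z).
Proof.
rewrite /step_state; apply: (f_equal2 andb); first by [].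
apply: (f_equal2 andb); last by [].
apply: eq_existsb => t; rewrite /moves. do 4!(apply: (f_equal2 andb); first by []).
have <- : started (pull e) x t = started e (fun i => h (x i)) t by [].
by case: (started _ _ _).
Qed.
End Rename.

Lemma connect_ind (T : finType) (e : rel T) (P : T -> T -> Prop) :
  (forall x, P x x) -> (forall x y z, e x y -> P y z -> P x z) ->
  forall x y, connect e x y -> P x y.
Proof.
move=> refl trans x y /connectP[p hp ->]; elim: p x hp => //= z p IH x /andP[xz /IH].
exact: trans.
Qed.

(** * Patterns of arcs and equalities *)

Section Patterns.
Definition pattern (I : finType) : Type := {ffun I * I -> bool * bool}.
Definition pat (n : nat) (D : rel 'I_n) (I : finType) (x : I -> 'I_n) : pattern I :=
  [ffun ij => (D (x ij.1) (x ij.2), x ij.1 == x ij.2)].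
Definition pat_arc (I : finType) (p : pattern I) : rel I := fun i j => (p (i, j)).1.
Definition pat_eq (I : finType) (p : pattern I) : rel I := fun i j => (p (i, j)).2.

Lemma pat_arcE n (D : rel 'I_n) (I : finType) (x : I -> 'I_n) :
  pat_arc (pat D x) = fun i j => D (x i) (x j).
Proof. by apply/functional_extensionality=> i; apply/functional_extensionality=> j; rewrite /pat_arc ffunE. Qed.

Lemma pat_eqE n (D : rel 'I_n) (I : finType) (x : I -> 'I_n) :
  pat_eq (pat D x) = fun i j => x i == x j.
Proof. by apply/functional_extensionality=> i; apply/functional_extensionality=> j; rewrite /pat_eq ffunE. Qed.

Definition join3 (I : finType) n (x y : I -> 'I_n) (z : 'I_n) (i : I + I + unit) : 'I_n :=
  match i with inl (inl i) => x i | inl (inr i) => y i | inr _ => z end.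

(** [p0], [pf] and [q] see vertices only through patterns, so each is a finite table independent of
    [n]. *)
Definition query (K J : finType) (p0 pf : pattern (K + J)%type -> bool)
    (q : pattern ((K + J) + (K + J) + unit)%type -> bool) n (D : rel 'I_n) : bool :=
  [forall s : {ffun K -> 'I_n}, exists x : {ffun K + J -> 'I_n}, exists y : {ffun K + J -> 'I_n},
    [&& p0 (pat D x), pf (pat D y), [forall i, y (inl i) == s i]
      & connect (fun x y : {ffun K + J -> 'I_n} => [forall z, q (pat D (join3 x y z))]) x y]].

Variables (k l R g w B : nat).
Local Notation slot := (slotT k l R g w B).
Local Notation rest := (restT k l R g w B).

(** Vacuous when terminals coincide, because the query ranges over all tuples [s] and not just the
    injective ones. *)
Definition init_pat (p : pattern slot) : bool :=
  terms_distinct (pat_eq p) id ==> init_state (pat_arc p) (pat_eq p) id.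
Definition final_pat (p : pattern slot) : bool :=
  terms_distinct (pat_eq p) id ==> final_state (pat_arc p) (pat_eq p) id.
Definition step_pat (p : pattern (slot + slot + unit)%type) : bool :=
  step_state (pat_arc p) (pat_eq p) (fun i => inl (inl i)) (fun i => inl (inr i)) (inr tt).

Lemma init_patE n (D : rel 'I_n) (x : slot -> 'I_n) :
  init_pat (pat D x) = (terms_distinct eq_op x ==> init_state D eq_op x).
Proof.
rewrite /init_pat (pat_arcE D x) (pat_eqE D x).
by apply: (f_equal2 implb); [|apply: (init_state_map D eq_op x id)].
Qed.

Lemma final_patE n (D : rel 'I_n) (x : slot -> 'I_n) :
  final_pat (pat D x) = (terms_distinct eq_op x ==> final_state D eq_op x).
Proof.
rewrite /final_pat (pat_arcE D x) (pat_eqE D x).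
by apply: (f_equal2 implb); [|apply: (final_state_map D eq_op x id)].
Qed.

Lemma step_patE n (D : rel 'I_n) (x y : slot -> 'I_n) z :
  step_pat (pat D (join3 x y z)) = step_state D eq_op x y z.
Proof.
rewrite /step_pat (pat_arcE D (join3 x y z)) (pat_eqE D (join3 x y z)).
exact: (step_state_map D eq_op (join3 x y z)).
Qed.

Lemma step_frame n (D : rel 'I_n) (x y : {ffun slot -> 'I_n}) : 0 < n ->
  connect (fun x y : {ffun slot -> 'I_n} => [forall z, step_state D eq_op x y z]) x y ->
  frame_eq x y.
Proof.
move=> n0; apply: (connect_ind (P := fun x y : {ffun slot -> 'I_n} => frame_eq x y)) => //.
move=> {}x {}y z hz; apply: frame_eq_trans; apply/same_frameP.
by have /andP[] : step_state D eq_op x y (Ordinal n0) := forallP hz (Ordinal n0).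
Qed.
End Patterns.

Section KappaQuery.
Variables (k l : nat).
Let R := 2 * k.
Let w := 3 * (l * R) + 2.
Let g := 3 * k + 2 * k * w.+2.
Let B := (l * R) * (l * R) * (w.+2 + l * R + 1).
Local Notation slot := (slotT k l R g w B).
Local Notation rest := (restT k l R g w B).

Lemma kappa_query n (D : rel 'I_n) : 1 < k -> 0 < l -> semicomplete D -> k <= n ->
  (l <= kappa_k D k) = query (K := 'I_k) (J := rest) (@init_pat k l R g w B) (@final_pat k l R g w B)
    (@step_pat k l R g w B) D.
Proof.
move=> k1 l0 semi kn.
have hsemi u v : u != v -> D u v || D v u.
  by move=> ne; have /implyP := forallP (forallP semi u) v; apply.
have stepE : (fun x y : {ffun slot -> 'I_n} => [forall z, step_pat (pat D (join3 x y z))])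
   =2 (fun x y : {ffun slot -> 'I_n} => [forall z, step_state D eq_op x y z]).
  by move=> x y; apply: eq_forallb => z; rewrite step_patE.
apply/(leq_kappa_k _ l0 k1 kn)/forallP => [h s|h S Sk].
- case ds : [forall i, forall j, (s i == s j) ==> (i == j)]; last first.
    (* Repeated terminals are settled by a walk of length zero, on which both end conditions are
       vacuous. *)
    pose x : {ffun slot -> 'I_n} := [ffun i => if i is inl i then s i else s (Ordinal (ltnW k1))].
    have nd : terms_distinct eq_op x = false.
      by rewrite -[RHS]ds; apply: eq_forallb => i; apply: eq_forallb => j; rewrite /term !ffunE.
    apply/existsP; exists x; apply/existsP; exists x.
    rewrite init_patE final_patE nd connect0 andbT /=.
    by apply/forallP=> i; rewrite ffunE.
  have sinj : injective s.
    by move=> i j E; apply/eqP; move/forallP/(_ i)/forallP/(_ j)/implyP: ds; apply; apply/eqP.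
  pose S := [set v | [exists i, v == s i]].
  have Sk : #|S| = k.
    rewrite -[RHS](card_ord k) -(card_imset _ sinj); apply: eq_card => v.
    by rewrite inE; apply/existsP/imsetP => [[i /eqP->]|[i _ ->]]; exists i.
  have /existsP[F0 hF0] := h S Sk.
  case: (@arg_minnP _ F0 (S_int_disjoint_family D S (p := l)) (fun F => \sum_c #|(F c).1|) hF0) => F hF hmin.
  have [x [y [ix fy tx ty c]]] := complete_min k1 hsemi sinj hF hmin.
  apply/existsP; exists x; apply/existsP; exists y.
  rewrite init_patE final_patE ix fy !implybT (eq_connect stepE) c andbT /=.
  by apply/forallP=> i; apply/eqP/ty.
- pose s : {ffun 'I_k -> 'I_n} := [ffun i => enum_val (cast_ord (esym Sk) i)].
  have sinj : injective s by move=> i j; rewrite !ffunE => /enum_val_inj/cast_ord_inj.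
  have /existsP[x /existsP[y /and4P[ix fy /forallP hs]]] := h s.
  rewrite (eq_connect stepE) => c.
  have fxy : frame_eq x y := step_frame (leq_trans (ltnW k1) kn) c.
  have dy : terms_distinct eq_op y.
    apply/forallP=> i; apply/forallP=> j; apply/implyP; rewrite /term (eqP (hs i)) (eqP (hs j)).
    by move/eqP/sinj->.
  have dx : terms_distinct eq_op x.
    have [t1 _ _ _ _] := fxy.
    by move: dy; congr is_true; apply: eq_forallb => i; apply: eq_forallb => j; rewrite !t1.
  rewrite init_patE dx in ix; rewrite final_patE dy in fy.
  have := sound (ltnW k1) ix dy c fy; congr (is_true (has_family D _ l)).
  apply/setP=> v; rewrite inE in_termE; apply/existsP/idP => [[i /eqP->]|vS].
    by rewrite /term (eqP (hs i)) ffunE enum_valP.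
  exists (cast_ord Sk (enum_rank_in vS v)); rewrite /term (eqP (hs _)) ffunE cast_ordK.
  by rewrite enum_rankK_in.
Qed.
End KappaQuery.

(** * Machine fragments *)

Section Fragments.
Variable C : finType.

(* A program fragment over the cell alphabet [C]: control states [fQ] and exits
   labelled by results in [X]. *)
Record frag (X : finType) := Frag {
  fQ : finType;
  fstart : fQ + X;
  fstep : fQ -> C -> (fQ + X) * C * move }.

Definition shift (m : move) (p : nat) : nat :=
  match m with MLeft => p.-1 | MRight => p.+1 | MStay => p end.
Definition upd (t : nat -> C) (p : nat) (c : C) : nat -> C :=
  fun i => if i == p then c else t i.

(* The tape is a total function on positions, so a left move at 0, where the
   machine of [TM] would extend its tape, is excluded. *)
Inductive exec (X : finType) (f : frag X) :
    nat -> fQ f + X -> nat -> (nat -> C) -> X -> nat -> (nat -> C) -> Prop :=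
| ExecDone x p t : exec 0 (inr x) p t x p t
| ExecStep k q p t s c m x p' t' : fstep q (t p) = (s, c, m) -> (m = MLeft -> 0 < p) ->
    exec k s (shift m p) (upd t p c) x p' t' -> exec k.+1 (inl q) p t x p' t'.

Definition runs (X : finType) (f : frag X) p t k x p' t' := exec k (fstart f) p t x p' t'.

Definition ret (X : finType) (x : X) : frag X :=
  @Frag X void (inr x) (fun q _ => match q with end).

Definition act (X : finType) (F : C -> X * C * move) : frag X :=
  @Frag X unit (inl tt) (fun _ c => let: (x, c', m) := F c in (inr x, c', m)).

Section Bind.
Variables (X Y : finType) (f : frag X) (g : X -> frag Y).
Definition bindQ : finType := (fQ f + {x : X & fQ (g x)})%type.
Definition bind_in x (s : fQ (g x) + Y) : bindQ + Y :=
  match s with inl q => inl (inr (existT _ x q)) | inr y => inr y end.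
Definition bind_out (s : fQ f + X) : bindQ + Y :=
  match s with inl q => inl (inl q) | inr x => bind_in (fstart (g x)) end.
Definition bind : frag Y := @Frag Y bindQ (bind_out (fstart f)) (fun q c =>
  match q with
  | inl q => let: (s, c', m) := fstep q c in (bind_out s, c', m)
  | inr (existT x q) => let: (s, c', m) := fstep q c in (bind_in s, c', m)
  end).

Lemma runs_bind p t k x p1 t1 k' y p2 t2 :
  runs f p t k x p1 t1 -> runs (g x) p1 t1 k' y p2 t2 ->
  runs bind p t (k + k') y p2 t2.
Proof.
rewrite /runs => h1 h2 /=.
have hg : forall x k s p t y p' t', @exec Y (g x) k s p t y p' t' ->
    @exec Y bind k (bind_in s) p t y p' t'.
  move=> x0 k0 s0 p0 t0 y0 p0' t0'; elim=> [*|{}k0 q {}p0 {}t0 s c m x' p' t' E hm _ IH].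
    exact: ExecDone.
  by apply: ExecStep hm IH => /=; rewrite E.
elim: h1 h2 => [x0 p0 t0 /hg //|{}k q {}p {}t s c m x' p' t' E hm _ IH h2].
by rewrite addSn; apply: ExecStep hm (IH h2) => /=; rewrite E.
Qed.
End Bind.

Section Loop.
Variables (X : finType) (f : frag (option X)).
Definition loop_out (s : fQ f + option X) : option (fQ f) + X :=
  match s with inl q => inl (Some q) | inr (Some x) => inr x | inr None => inl None end.
(** The extra state [None] spends one step on each restart, so that even a body that starts at an
    exit yields a step function. *)
Definition loop : frag X := @Frag X (option (fQ f)) (inl None) (fun q c =>
  match q with
  | None => (loop_out (fstart f), c, MStay)
  | Some q => let: (s, c', m) := fstep q c in (loop_out s, c', m)
  end).

Let upd_id t p : upd t p (t p) = t.
Proof. by apply: functional_extensionality => i; rewrite /upd; case: eqP => [->|]. Qed.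

Lemma exec_loop k s p t o p' t' : exec k s p t o p' t' ->
  match o with
  | Some x => @exec X loop k (loop_out s) p t x p' t'
  | None => forall k' x p2 t2, @exec X loop k' (inl None) p' t' x p2 t2 ->
              @exec X loop (k + k') (loop_out s) p t x p2 t2
  end.
Proof.
elim=> [[x|] {}p {}t|{}k q {}p {}t {}s c m o' {}p' {}t' E hm _ IH] //=; first exact: ExecDone.
case: o' IH => [x|] IH; first by apply: ExecStep hm IH => /=; rewrite E.
by move=> k' x p2 t2 h; rewrite addSn; apply: ExecStep hm (IH _ _ _ _ h) => /=; rewrite E.
Qed.

Lemma runs_loop_stop p t k x p' t' : runs f p t k (Some x) p' t' -> runs loop p t k.+1 x p' t'.
Proof.
move/exec_loop => h; apply: (ExecStep (c := t p) (m := MStay)) => //.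
by rewrite upd_id.
Qed.

Lemma runs_loop_next p t k p' t' k' x p2 t2 : runs f p t k None p' t' ->
  runs loop p' t' k' x p2 t2 -> runs loop p t (k + k').+1 x p2 t2.
Proof.
move/exec_loop => h /h h'; apply: (ExecStep (c := t p) (m := MStay)) => //.
by rewrite upd_id.
Qed.
End Loop.

Lemma runs_act (X : finType) (F : C -> X * C * move) p t x c m :
  F (t p) = (x, c, m) -> (m = MLeft -> 0 < p) -> runs (act F) p t 1 x (shift m p) (upd t p c).
Proof. by move=> E hm; apply: ExecStep hm (ExecDone _ _ _ _) => /=; rewrite E. Qed.

(** * Translation to a Turing machine *)

Section ToTM.
Variables (f : frag bool) (cblank cfalse ctrue : C).

Definition tmQ : finType := (fQ f + bool)%type.
Lemma tmQ_card : #|tmQ| = #|tmQ|.-1.+1.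
Proof. by rewrite prednK //; apply/card_gt0P; exists (inr true). Qed.
Definition encQ (q : tmQ) : 'I_(#|tmQ|.-1.+1) := cast_ord tmQ_card (enum_rank q).
Definition decQ (q : 'I_(#|tmQ|.-1.+1)) : tmQ := enum_val (cast_ord (esym tmQ_card) q).
Lemma encQK : cancel encQ decQ.
Proof. by move=> q; rewrite /encQ /decQ cast_ordK enum_rankK. Qed.

(* The first three symbols are the input alphabet; each is read as a cell, but
   only the cells proper are ever written. *)
Definition encC (c : C) : 'I_(#|C|.+3) := rshift 3 (enum_rank c).
Definition decC (s : 'I_(#|C|.+3)) : C :=
  match split (s : 'I_(3 + #|C|)) with
  | inl i => if i == 0 :> nat then cblank else if i == 1 :> nat then cfalse else ctrue
  | inr i => enum_val i
  end.
Lemma encCK : cancel encC decC.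
Proof.
move=> c; rewrite /encC /decC; have := unsplitK (inr (enum_rank c) : 'I_3 + 'I_#|C|).
by rewrite /= => ->; rewrite enum_rankK.
Qed.

Definition toTM : TM := @mkTM #|tmQ|.-1 #|C| (encQ (fstart f)) (encQ (inr true)) (encQ (inr false))
  (fun q s => match decQ q with
   | inl q0 => let: (s', c, m) := fstep q0 (decC s) in (encQ s', encC c, m)
   | inr b => (q, s, MStay)
   end).

(** Compares the two stacks of a configuration with a total tape; positions beyond [r] read as
    [ord0], which decodes to the blank cell. *)
Definition rep (l : seq 'I_(#|C|.+3)) h r (p : nat) (t : nat -> C) :=
  size l = p /\ forall i, decC (nth ord0 (rev l ++ h :: r) i) = t i.

Lemma rep_head l h r p t : rep l h r p t -> decC h = t p.
Proof. by case=> <- /(_ (size l)); rewrite nth_cat size_rev ltnn subnn. Qed.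

Lemma rep_upd l h r p t c : rep l h r p t -> rep l (encC c) r p (upd t p c).
Proof.
case=> hs ht; split=> // i; rewrite /upd -hs; case: eqP => [->|ne].
  by rewrite nth_cat size_rev ltnn subnn /= encCK.
rewrite -ht !nth_cat size_rev; case: ltnP => // hi.
have : 0 < i - size l by lia.
by case: (i - size l).
Qed.

Lemma dec0 : decC ord0 = cblank.
Proof. by rewrite /decC; case: splitP => i //= <-. Qed.

Lemma toTM_step q p t s c m l h r : fstep q (t p) = (s, c, m) -> (m = MLeft -> 0 < p) ->
  rep l h r p t -> exists l' h' r', 
    @step toTM (encQ (inl q), l, h, r) = (encQ s, l', h', r') /\
    rep l' h' r' (shift m p) (upd t p c).
Proof.
move=> E hm hr; have hu := rep_upd c hr; have hh := rep_head hr.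
have nh : @halted toTM (encQ (inl q)) = false.
  by rewrite /halted /= !(inj_eq (can_inj encQK)).
rewrite /step nh /= encQK hh E; case: m E hm => E hm.
- case: l hr hu => [[hs _]|x l hr [hs ht]]; first by rewrite -hs in hm; have := hm erefl.
  exists l, x, (encC c :: r); split=> //; split; first by rewrite -hs.
  by move=> i; rewrite -ht rev_cons cat_rcons.
- case: r hr hu => [|x r] hr [hs ht].
    exists (encC c :: l), ord0, [::]; split=> //; split; first by rewrite /= hs.
    move=> i; rewrite -ht rev_cons cat_rcons !nth_cat; case: ltnP => // _.
    by case: (i - _) => [|[|j]] //=; rewrite ?nth_nil.
  exists (encC c :: l), x, r; split=> //; split; first by rewrite /= hs.
  by move=> i; rewrite -ht rev_cons cat_rcons.
- by exists l, (encC c), r.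
Qed.

Lemma toTM_exec k s p t x p' t' l h r : @exec bool f k s p t x p' t' -> rep l h r p t ->
  exists l' h' r', iter k (@step toTM) (encQ s, l, h, r) = (encQ (inr x), l', h', r').
Proof.
move=> hex; elim: hex l h r => [{}x {}p {}t|{}k q {}p {}t {}s c m {}x {}p' {}t' E hm _ IH] l h r hr.
  by exists l, h, r.
have [l1 [h1 [r1 [E1 hr1]]]] := toTM_step E hm hr.
by rewrite iterSr E1; apply: IH.
Qed.

Definition input_tape (w : seq bool) : nat -> C :=
  fun i => if i < size w then (if nth false w i then ctrue else cfalse) else cblank.

(** Halted configurations are fixed by [step], so every later time gives the same answer. *)
Lemma toTM_result w k x p' t' j : k <= j -> runs f 0 (input_tape w) k x p' t' ->
  tm_result toTM w j = Some x.
Proof.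
move=> kj hr; have [l [h [r [Ei hrep]]]] : exists l h r,
    @init toTM w = (encQ (fstart f), l, h, r) /\ rep l h r 0 (input_tape w).
  have dec_bit b : decC (@sym_of_bit toTM b) = if b then ctrue else cfalse.
    have E : (@sym_of_bit toTM b : nat) = 1 + b by rewrite inordK //; case: (b).
    rewrite /decC; case: splitP => i; rewrite /= E => Ei; first by rewrite -Ei; case: (b).
    by exfalso; move: Ei; case: (b) => /=; lia.
  case: w hr => [|b w] hr.
    by exists [::], ord0, [::]; split=> //; split=> // i; case: i => [|i] /=; rewrite ?nth_nil dec0.
  exists [::], (@sym_of_bit toTM b), (map (@sym_of_bit toTM) w); split=> //; split=> // i /=.
  rewrite -[_ :: _]/(map (@sym_of_bit toTM) (b :: w)) /input_tape; case: ltnP => hi.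
    by rewrite (nth_map false) // dec_bit.
  by rewrite nth_default ?size_map // dec0.
have [l' [h' [r' E]]] := toTM_exec hr hrep.
rewrite /tm_result Ei -(subnK kj) iterD E.
have hh : @halted toTM (encQ (inr x)) by rewrite /halted; case: x {E hr} => /=; rewrite eqxx ?orbT.
have -> : iter (j - k) (@step toTM) (encQ (inr x), l', h', r') = (encQ (inr x), l', h', r').
  by elim: (j - k) => //= m ->; rewrite /step hh.
rewrite /= !(inj_eq (can_inj encQK)).
by case: x {E hr hh}; rewrite ?eqxx.
Qed.
End ToTM.
End Fragments.

(** * Loop programs over relational tables *)

(** The base is at least 2, so one more exponent absorbs a sum; costs of composed fragments remain
    powers of [B.+2]. *)
Lemma pow_add B a b i j : a <= B.+2 ^ i -> b <= B.+2 ^ j -> a + b <= B.+2 ^ (maxn i j).+1.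
Proof.
move=> ha hb; rewrite expnS; apply: leq_trans (_ : 2 * B.+2 ^ maxn i j <= _).
  rewrite mul2n -addnn leq_add //; [apply: leq_trans ha _|apply: leq_trans hb _];
  by rewrite leq_pexp2l // ?leq_maxl ?leq_maxr.
by rewrite leq_mul2r orbT.
Qed.

Section Pebbles.
Variables V A : finType.
(* Each cell is a column of bits, one per track: [None] marks position 0, a pebble
   track holds a 1 exactly at the value of the pebble, and a data track is a
   relation on positions; pebbles serve as number registers. *)
Definition peb : finType := (V + 'I_5)%type.
Definition dat : finType := (bool + A)%type.
Definition track : finType := option (peb + dat).
Definition cell : finType := {ffun track -> bool}.

Record st := St { pb : peb -> nat; dt : dat -> nat -> bool }.
Definition tape (s : st) (i : nat) : cell := [ffun o : track =>
  match o with
  | None => i == 0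
  | Some (inl p) => pb s p == i
  | Some (inr a) => dt s a i
  end].
Definition setp (s : st) p v := St (fun q => if q == p then v else pb s q) (dt s).
Definition setd (s : st) a i b :=
  St (pb s) (fun a' j => if (a' == a) && (j == i) then b else dt s a' j).
Definition setbit (c : cell) (o : track) (b : bool) : cell :=
  [ffun o' => if o' == o then b else c o'].

Definition home : frag cell unit :=
  loop (act (fun c : cell => if c None then (Some tt, c, MStay) else (None, c, MLeft))).
Definition seek (p : peb) : frag cell unit :=
  loop (act (fun c : cell => if c (Some (inl p)) then (Some tt, c, MStay) else (None, c, MRight))).
Definition goto p := bind home (fun _ => seek p).
Definition readbit p o : frag cell bool :=
  bind (goto p) (fun _ => act (fun c : cell => (c o, c, MStay))).
Definition setdat p a b : frag cell unit :=
  bind (goto p) (fun _ => act (fun c : cell => (tt, setbit c (Some (inr a)) b, MStay))).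
Definition inc p : frag cell unit :=
  bind (goto p) (fun _ => bind (act (fun c : cell => (tt, setbit c (Some (inl p)) false, MRight)))
    (fun _ => act (fun c : cell => (tt, setbit c (Some (inl p)) true, MStay)))).
Definition clr p : frag cell unit :=
  bind (goto p) (fun _ => bind (act (fun c : cell => (tt, setbit c (Some (inl p)) false, MStay)))
    (fun _ => bind home (fun _ => act (fun c : cell => (tt, setbit c (Some (inl p)) true, MStay))))).
Lemma upd_same (t : nat -> cell) p : upd t p (t p) = t.
Proof. by apply: functional_extensionality => i; rewrite /upd; case: eqP => [->|]. Qed.

Lemma runs_home p (t : nat -> cell) : (forall i, t i None = (i == 0)) ->
  runs home p t (2 * p + 2) tt 0 t.
Proof.
move=> t0; elim: p => [|p IH].
  apply: runs_loop_stop; rewrite -{2}[t](upd_same t 0).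
  by apply: (runs_act (m := MStay)) => //; rewrite t0.
have -> : 2 * p.+1 + 2 = (1 + (2 * p + 2)).+1 by lia.
apply: runs_loop_next IH; rewrite -{2}[t](upd_same t p.+1).
by apply: (runs_act (p := p.+1) (m := MLeft)) => //; rewrite t0.
Qed.

Lemma runs_seek s p i d : i + d = pb s p ->
  runs (seek p) i (tape s) (2 * d + 2) tt (pb s p) (tape s).
Proof.
elim: d i => [|d IH] i E.
  apply: runs_loop_stop; rewrite -E addn0 -{2}[tape s](upd_same (tape s) i).
  by apply: (runs_act (m := MStay)) => //; rewrite ffunE -E addn0 eqxx.
have -> : 2 * d.+1 + 2 = (1 + (2 * d + 2)).+1 by lia.
apply: runs_loop_next (IH i.+1 _); last by rewrite addSnnS.
rewrite -{2}[tape s](upd_same (tape s) i).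
by apply: (runs_act (p := i) (m := MRight)) => //; rewrite ffunE -E gtn_eqF //; lia.
Qed.

Lemma runs_goto s p pos :
  runs (goto p) pos (tape s) (2 * pos + 2 + (2 * pb s p + 2)) tt (pb s p) (tape s).
Proof.
apply: (runs_bind (x := tt) (p1 := 0) (t1 := tape s)); last exact: runs_seek.
by apply: runs_home => i; rewrite ffunE.
Qed.

Definition bounded s B := forall p, pb s p <= B.
Definition unit_cost B := 6 * B + 20.

(** The head may start and end anywhere up to [B], since each primitive first returns to the marked
    cell. *)
Definition does (X : finType) (f : frag cell X) s x s' B K :=
  forall pos, pos <= B -> exists k pos',
    [/\ k <= K, pos' <= B & runs f pos (tape s) k x pos' (tape s')].

Lemma does_weaken (X : finType) (f : frag cell X) s x s' B K K' :
  K <= K' -> does f s x s' B K -> does f s x s' B K'.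
Proof.
move=> le h pos hp; have [k [pos' [h1 h2 h3]]] := h _ hp.
by exists k, pos'; split=> //; apply: leq_trans le.
Qed.

Lemma does_bind (X Y : finType) (f : frag cell X) (g : X -> frag cell Y) s x s1 y s2 B K1 K2 :
  does f s x s1 B K1 -> does (g x) s1 y s2 B K2 -> does (bind f g) s y s2 B (K1 + K2).
Proof.
move=> h1 h2 pos /h1[k1 [p1 [hk1 /h2[k2 [p2 [hk2 hp2 r2]]] r1]]].
by exists (k1 + k2), p2; split=> //; [apply: leq_add|apply: runs_bind r1 r2].
Qed.

Lemma does_ret (X : finType) (x : X) s B : does (ret cell x) s x s B 0.
Proof. by move=> pos hp; exists 0, pos; split=> //; apply: ExecDone. Qed.

Arguments does_ret : clear implicits.

Lemma does_loop_stop (X : finType) (f : frag cell (option X)) s x s' B K :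
  does f s (Some x) s' B K -> does (loop f) s x s' B K.+1.
Proof.
move=> h pos /h[k [p' [hk hp r]]]; exists k.+1, p'; split=> //; exact: runs_loop_stop.
Qed.

Lemma does_loop_next (X : finType) (f : frag cell (option X)) s x s1 s2 B K1 K2 :
  does f s None s1 B K1 -> does (loop f) s1 x s2 B K2 -> does (loop f) s x s2 B (K1 + K2).+1.
Proof.
move=> h1 h2 pos /h1[k1 [p1 [hk1 /h2[k2 [p2 [hk2 hp2 r2]]] r1]]].
by exists (k1 + k2).+1, p2; split=> //; [rewrite ltnS leq_add|apply: runs_loop_next r1 r2].
Qed.

Lemma does_read s p o B : bounded s B ->
  does (readbit p o) s (tape s (pb s p) o) s B (unit_cost B).
Proof.
move=> hb pos hp; have := hb p; exists (2 * pos + 2 + (2 * pb s p + 2) + 1), (pb s p).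
split=> //; first by rewrite /unit_cost; lia.
apply: runs_bind (runs_goto s p pos) _; rewrite -{3}[tape s](upd_same (tape s) (pb s p)).
exact: (runs_act (m := MStay)).
Qed.

Lemma tape_setd s p a b : upd (tape s) (pb s p) (setbit (tape s (pb s p)) (Some (inr a)) b)
  = tape (setd s a (pb s p) b).
Proof.
apply: functional_extensionality => i; rewrite /upd; apply/ffunP=> o.
case: eqP => [->|ne]; rewrite !ffunE.
  case: o => [[q|a']|] //=; rewrite eqxx andbT.
  by rewrite -[Some (inr a') == _]/(a' == a).
by case: o => [[q|a']|] //=; case: (i =P _); rewrite ?andbF.
Qed.

Lemma does_setdat s p a b B : bounded s B ->
  does (setdat p a b) s tt (setd s a (pb s p) b) B (unit_cost B).
Proof.
move=> hb pos hp; have := hb p; exists (2 * pos + 2 + (2 * pb s p + 2) + 1), (pb s p).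
split=> //; first by rewrite /unit_cost; lia.
apply: runs_bind (runs_goto s p pos) _; rewrite -tape_setd.
exact: (runs_act (m := MStay)).
Qed.

(** The intermediate tape on which pebble [p] lies nowhere; no [st] describes it. *)
Definition lifted s p : nat -> cell := upd (tape s) (pb s p) (setbit (tape s (pb s p)) (Some (inl p)) false).

Lemma lifted_drop s p j :
  upd (lifted s p) j (setbit (lifted s p j) (Some (inl p)) true) = tape (setp s p j).
Proof.
apply: functional_extensionality => i; apply/ffunP=> o.
have E q : (Some (inl q) == Some (inl p) :> track) = (q == p) by [].
rewrite /upd /lifted /upd; case: (i =P j) => [->|ne].
  rewrite !ffunE; case: o => [[q|a]|]; rewrite ?E /=.
  - by case: (q =P p) => // qp; rewrite ?eqxx //; case: (j =P _) => [->|_]; rewrite !ffunE ?E; case: (q =P p).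
  - by case: (j =P _) => [->|_]; rewrite !ffunE.
  - by case: (j =P _) => [->|_]; rewrite !ffunE.
case: (i =P pb s p) => [Ei|ne2]; try subst i; rewrite !ffunE; case: o => [[q|a]|]; rewrite ?E //=.
- by case: (q =P p) => // _; rewrite ?eqxx //; apply/esym/eqP=> h; exact: ne (esym h).
- case: (q =P p) => // ->; have -> : (pb s p == i) = false by apply/eqP=> h; exact: ne2 (esym h).
  by apply/esym/eqP=> h; exact: ne (esym h).
Qed.

Lemma does_inc s p B : bounded s B -> pb s p < B ->
  does (inc p) s tt (setp s p (pb s p).+1) B (unit_cost B).
Proof.
move=> hb hlt pos hp; exists (2 * pos + 2 + (2 * pb s p + 2) + (1 + 1)), (pb s p).+1.
split=> //; first by rewrite /unit_cost; lia.
apply: runs_bind (runs_goto s p pos) _; apply: (runs_bind (x := tt) (p1 := (pb s p).+1) (t1 := lifted s p)).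
  exact: (runs_act (m := MRight)).
by rewrite -lifted_drop; apply: (runs_act (m := MStay)).
Qed.

Lemma does_clr s p B : bounded s B -> does (clr p) s tt (setp s p 0) B (unit_cost B).
Proof.
move=> hb pos hp; have hb1 := hb p.
exists (2 * pos + 2 + (2 * pb s p + 2) + (1 + (2 * pb s p + 2 + 1))), 0.
split=> //; first by rewrite /unit_cost; lia.
apply: runs_bind (runs_goto s p pos) _; apply: (runs_bind (x := tt) (p1 := pb s p) (t1 := lifted s p)).
  exact: (runs_act (m := MStay)).
apply: (runs_bind (x := tt) (p1 := 0) (t1 := lifted s p)).
  by apply: runs_home => i; rewrite /lifted /upd; case: eqP => [->|_]; rewrite !ffunE.
by rewrite -lifted_drop; apply: (runs_act (m := MStay)).
Qed.

Lemma unit_cost_pow B : unit_cost B <= B.+2 ^ 5.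
Proof.
have h : 16 <= B.+2 ^ 4 by rewrite -[16]/(2 ^ 4) leq_exp2r.
by rewrite expnS /unit_cost; apply: leq_trans (_ : B.+2 * 16 <= _); [lia|rewrite leq_mul2l h orbT].
Qed.

(** The exponent is fixed before [B] and the state, which makes the time polynomial. [pre] may
    mention [B] in order to ask for room on the tape. *)
Definition spec (X : finType) (f : frag cell X) (pre : nat -> st -> Prop) (post : st -> X -> st -> Prop) :=
  exists e, forall B s, bounded s B -> pre B s ->
    exists x s', [/\ does f s x s' B (B.+2 ^ e), bounded s' B & post s x s'].

Lemma spec_conseq (X : finType) (f : frag cell X) (pre pre' : nat -> st -> Prop)
    (post post' : st -> X -> st -> Prop) :
  (forall B s, bounded s B -> pre' B s -> pre B s) ->
  (forall B s x s', bounded s B -> pre' B s -> bounded s' B -> post s x s' -> post' s x s') ->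
  spec f pre post -> spec f pre' post'.
Proof.
move=> h1 h2 [e he]; exists e => B s hb hp.
have [x [s' [d b p]]] := he B s hb (h1 _ _ hb hp); exists x, s'; split=> //.
exact: (h2 B).
Qed.

Lemma spec_bind (X Y : finType) (f : frag cell X) (g : X -> frag cell Y) pre post pre2 post2 :
  spec f pre post -> (forall x, spec (g x) (pre2 x) (post2 x)) ->
  (forall B s x s', pre B s -> post s x s' -> bounded s' B -> pre2 x B s') ->
  spec (bind f g) pre (fun s y s'' => exists x s', post s x s' /\ post2 x s' y s'').
Proof.
(* The result type is finite, so the exponents of the continuations have a maximum. *)
move=> [e he] /fin_all_exists[e2 he2] hpp; pose m := \max_x e2 x.
exists (maxn e m).+1 => B s hb hp; have [x [s1 [d1 b1 p1]]] := he B s hb hp.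
have [y [s2 [d2 b2 p2]]] := he2 x B s1 b1 (hpp _ _ _ _ hp p1 b1).
exists y, s2; split=> //; last by exists x, s1.
refine (does_weaken _ (does_bind d1 d2)); apply: pow_add => //.
by rewrite leq_pexp2l // leq_bigmax.
Qed.

Lemma spec_ret (X : finType) (x : X) (pre : nat -> st -> Prop) :
  spec (ret cell x) pre (fun s y s' => y = x /\ s' = s).
Proof.
by exists 0 => B s hb _; exists x, s; split=> //; refine (does_weaken (leq0n _) (does_ret _ _ _ _)).
Qed.

Lemma spec_inc p : spec (inc p) (fun B s => pb s p < B)
  (fun s _ s' => s' = setp s p (pb s p).+1).
Proof.
exists 5 => B s hb hp; exists tt, (setp s p (pb s p).+1); split=> //.
  by apply: does_weaken (unit_cost_pow B) _; apply: does_inc.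
by move=> q /=; case: ifP.
Qed.

Lemma spec_clr p (pre : nat -> st -> Prop) : spec (clr p) pre (fun s _ s' => s' = setp s p 0).
Proof.
exists 5 => B s hb hp; exists tt, (setp s p 0); split=> //.
  by apply: does_weaken (unit_cost_pow B) _; apply: does_clr.
by move=> q /=; case: ifP.
Qed.

Lemma spec_read p o (pre : nat -> st -> Prop) : spec (readbit p o) pre
  (fun s b s' => s' = s /\ b = tape s (pb s p) o).
Proof.
exists 5 => B s hb hp; exists (tape s (pb s p) o), s; split=> //.
by apply: does_weaken (unit_cost_pow B) _; apply: does_read.
Qed.

Lemma spec_setdat p a b (pre : nat -> st -> Prop) : spec (setdat p a b) pre
  (fun s _ s' => s' = setd s a (pb s p) b).
Proof.
exists 5 => B s hb hp; exists tt, (setd s a (pb s p) b); split=> //.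
by apply: does_weaken (unit_cost_pow B) _; apply: does_setdat.
Qed.

Definition whilene (c p : peb) (body : frag cell unit) : frag cell unit :=
  loop (bind (readbit c (Some (inl p))) (fun b : bool =>
    if b then ret cell (Some tt) else
    bind body (fun _ => bind (inc c) (fun _ => ret cell (@None unit))))).
Definition forto c p body : frag cell unit := bind (clr c) (fun _ => whilene c p body).

(** [I s0 i s] is the invariant with counter value [i]; the body must restore both counter and
    bound. At most [B.+1] tests occur, which costs a constant in the exponent. *)
Lemma spec_forto c p (body : frag cell unit) pre preb postb (I : st -> nat -> st -> Prop) :
  c != p -> spec body preb postb ->
  (forall B s, pre B s -> I s 0 (setp s c 0)) ->
  (forall B s0 i s, pre B s0 -> bounded s0 B -> bounded s B -> i < pb s0 p -> I s0 i s -> pb s c = i ->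
     pb s p = pb s0 p -> preb B s) ->
  (forall B s0 i s x s', pre B s0 -> bounded s B -> bounded s' B -> i < pb s0 p -> I s0 i s -> pb s c = i -> pb s p = pb s0 p ->
     postb s x s' -> [/\ pb s' c = i, pb s' p = pb s0 p & I s0 i.+1 (setp s' c i.+1)]) ->
  spec (forto c p body) pre (fun s0 _ s' => I s0 (pb s0 p) s').
Proof.
move=> cp [e he] h0 hpre hpost.
exists (5 + (1 + (maxn 5 (maxn e 5).+1).+1).+1).+1 => B s0 hb0 hp0.
pose K := unit_cost B + (B.+2 ^ e + unit_cost B).
have hw : forall d i s, i + d = pb s0 p -> I s0 i s -> pb s c = i -> pb s p = pb s0 p -> bounded s B ->
    exists s', [/\ does (whilene c p body) s tt s' B (d.+1 * K.+1), bounded s' B & I s0 (pb s0 p) s'].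
  elim=> [|d IH] i s Ed hI hc hp hb.
    exists s; split=> //; last by rewrite -Ed addn0.
    have := does_read c (Some (inl p)) hb; rewrite ffunE hp hc -Ed addn0 eqxx => hr.
    apply: (@does_weaken _ _ _ _ _ _ (unit_cost B + 0).+1); first by rewrite /K; lia.
    by apply: does_loop_stop; apply: (does_bind hr); apply: does_ret.
  have hi : i < pb s0 p by lia.
  have [[] [s1 [d1 b1 p1]]] := he B s hb (hpre _ _ _ _ hp0 hb0 hb hi hI hc hp).
  have [c1 q1 I1] := hpost B _ _ _ _ _ hp0 hb b1 hi hI hc hp p1.
  have iB : pb s1 c < B by rewrite c1; apply: leq_trans hi _.
  have hb2 : bounded (setp s1 c i.+1) B by move=> q /=; case: ifP => // _; rewrite -c1.
  have [|||s' [d2 b2 I2]] := IH i.+1 (setp s1 c i.+1) _ I1 _ _ hb2.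
  - by rewrite addSnnS.
  - by rewrite /= eqxx.
  - by rewrite /= eq_sym (negbTE cp).
  exists s'; split=> //; have := does_read c (Some (inl p)) hb.
  rewrite ffunE hp hc gtn_eqF // => hr; have := does_inc b1 iB; rewrite c1 => hinc.
  apply: (@does_weaken _ _ _ _ _ _
    (unit_cost B + (B.+2 ^ e + (unit_cost B + 0)) + d.+1 * K.+1).+1).
    by rewrite addn0 [leqRHS]mulSn addSn.
  apply: does_loop_next d2; apply: (does_bind hr); apply: (does_bind d1).
  by apply: (does_bind hinc); apply: does_ret.
have h0c := does_clr c hb0.
have [||||s' [d b i]] := hw (pb s0 p) 0 (setp s0 c 0) _ (h0 _ _ hp0).
- by rewrite add0n.
- by rewrite /= eqxx.
- by rewrite /= eq_sym (negbTE cp).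
- by move=> q /=; case: ifP.
exists tt, s'; split=> //; refine (does_weaken _ (does_bind h0c d)).
have -> : 5 + (1 + (maxn 5 (maxn e 5).+1).+1).+1 = maxn 5 (5 + (1 + (maxn 5 (maxn e 5).+1).+1).+1) by lia.
apply: pow_add; first exact: unit_cost_pow.
apply: leq_trans (_ : B.+2 ^ 1 * B.+2 ^ (maxn 5 (maxn e 5).+1).+2 <= _).
  apply: leq_mul; first by rewrite expn1; apply: leq_trans (_ : B.+1 <= _); rewrite ?ltnS.
  rewrite -addn1; apply: leq_trans (pow_add (i := (maxn 5 (maxn e 5).+1).+1) (j := 0) _ _) _ => //.
    by apply: pow_add; [exact: unit_cost_pow|apply: pow_add => //; exact: unit_cost_pow].
by rewrite -expnD leq_pexp2l //; lia.
Qed.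

(* [aN] holds the number of vertices and [aI] the index of a table cell. *)
Definition aN : peb := inr (Ordinal (isT : 0 < 5)).
Definition aI : peb := inr (Ordinal (isT : 1 < 5)).
Definition aT : peb := inr (Ordinal (isT : 2 < 5)).
Definition a1 : peb := inr (Ordinal (isT : 3 < 5)).
Definition a2 : peb := inr (Ordinal (isT : 4 < 5)).
Definition scratch : seq peb := [:: a1; a2; aT; aI].

Definition frame (L : seq peb) (s s' : st) :=
  dt s' = dt s /\ forall q, q \notin L -> pb s' q = pb s q.

Lemma frame_trans L s1 s2 s3 : frame L s1 s2 -> frame L s2 s3 -> frame L s1 s3.
Proof.
by move=> [d1 p1] [d2 p2]; split=> [|q qL]; [rewrite d2|rewrite p2 // p1].
Qed.

Lemma frame_sub L L' s s' : {subset L <= L'} -> frame L s s' -> frame L' s s'.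
Proof. by move=> sub [d p]; split=> // q qL; apply: p; apply: contra qL; apply: sub. Qed.

Lemma frame_setp L s p v : p \in L -> frame L s (setp s p v).
Proof. by move=> pL; split=> // q qL /=; case: eqP => // E; rewrite E pL in qL. Qed.

Definition addp p q := forto a1 p (inc q).

Lemma spec_addp p q : p != a1 -> q != a1 -> p != q ->
  spec (addp p q) (fun B s => pb s q + pb s p <= B)
    (fun s _ s' => frame [:: a1; q] s s' /\ pb s' q = pb s q + pb s p).
Proof.
move=> p1 q1 pq; apply: (spec_forto (I := fun s0 i s => frame [:: a1; q] s0 s /\ pb s q = pb s0 q + i)
   _ (spec_inc q)); first by rewrite eq_sym.
- move=> B s _; split; first by apply: frame_setp; rewrite mem_head.
  by rewrite /= (negbTE q1) addn0.
- by move=> B s0 i s hB _ _ hi [_ ->] _ _; apply: leq_trans hB; rewrite -addnS leq_add2l.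
- move=> B s0 i s x s' hB _ _ hi [fr hq] hc hp ->; split.
  + by rewrite /= eq_sym (negbTE q1).
  + by rewrite /= (negbTE pq).
  + split; last by rewrite /= (negbTE q1) eqxx hq addnS.
    apply: frame_trans fr (frame_trans (frame_setp _ _ _) (frame_setp _ _ _)).
      by rewrite !inE eqxx orbT.
    by rewrite mem_head.
Qed.

Definition mulN := bind (clr aT) (fun _ => bind (forto a2 aI (addp aN aT)) (fun _ =>
  bind (clr aI) (fun _ => addp aT aI))).

Lemma spec_mulN : spec mulN (fun B s => pb s aI * pb s aN <= B)
  (fun s _ s' => frame scratch s s' /\ pb s' aI = pb s aI * pb s aN).
Proof.
have sub L : all (mem scratch) L -> {subset L <= scratch} by move/allP.
have main : spec (forto a2 aI (addp aN aT))
   (fun B s => pb s aI * pb s aN <= B /\ pb s aT = 0)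
   (fun s _ s' => frame [:: a1; a2; aT] s s' /\ pb s' aT = pb s aI * pb s aN).
  apply: (spec_forto (I := fun s0 i s => frame [:: a1; a2; aT] s0 s /\ pb s aT = i * pb s0 aN)
    _ (spec_addp (p := aN) (q := aT) isT isT isT)) => //.
  - by move=> B s [_ hT]; split; [apply: frame_setp|rewrite /= hT].
  - move=> B s0 i s [hB _] _ _ hi [[_ fr] ->] _ _; rewrite fr // -mulSnr.
    by apply: leq_trans hB; rewrite leq_mul2r hi orbT.
  - move=> B s0 i s x s' _ _ _ hi [fr hT] hc hp [fr2 hT2]; have [_ f2] := fr2.
    rewrite !f2 //; split=> //; split.
      by apply: frame_trans fr (frame_trans (frame_sub _ fr2) (frame_setp _ _ _)) => //; apply/allP.
    by rewrite /= hT2 hT mulSnr; have [_ ->] := fr.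
apply: spec_conseq (spec_bind (spec_clr aT (fun B s => pb s aI * pb s aN <= B)) (fun _ => spec_bind main (fun _ =>
   spec_bind (spec_clr aI (fun _ _ => True)) (fun _ => spec_addp (p := aT) (q := aI) isT isT isT) _) _) _) => //.
- move=> B s x s' _ hB _ [_ [s1 [-> [_ [s2 [[fr2 hT] [_ [s3 [-> [fr4 hI]]]]]]]]]].
  have [_ f2] := fr2; split.
    apply: frame_trans (frame_setp _ _ _) (frame_trans (frame_sub _ fr2) (frame_trans (frame_setp _ _ _) (frame_sub _ fr4))) => //.
      exact: (sub [:: a1; a2; aT]).
    exact: (sub [:: a1; aI]).
  by rewrite hI /= hT.
- by move=> _ _ B s x s' _ -> b; have := b aT; rewrite /= add0n.
- by move=> B s x s' hB -> _.
Qed.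

(** Horner's rule: the number with digits [l] in base [n]. *)
Definition idx (n a : nat) (l : seq nat) := foldl (fun a x => a * n + x) a l.

Fixpoint pushidx (vs : seq V) : frag cell unit :=
  if vs is v :: vs' then bind mulN (fun _ => bind (addp (inl v) aI) (fun _ => pushidx vs'))
  else ret cell tt.
Definition getidx vs := bind (clr aI) (fun _ => pushidx vs).
Local Notation vals s vs := [seq pb s (inl v) | v <- vs].

Lemma frame_vals s s' vs : frame scratch s s' -> vals s' vs = vals s vs.
Proof. by case=> _ h; apply: eq_map => v; apply: h. Qed.

Lemma frame_aN s s' : frame scratch s s' -> pb s' aN = pb s aN.
Proof. by case=> _ h; apply: h. Qed.

(** [j] counts the digits already pushed and so bounds the register by a power of the base. *)
Lemma spec_pushidx vs : spec (pushidx vs)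
  (fun B s => exists j, [/\ pb s aI < pb s aN ^ j, pb s aN ^ (j + size vs) <= B
                           & all (fun x => x < pb s aN) (vals s vs)])
  (fun s _ s' => frame scratch s s' /\ pb s' aI = idx (pb s aN) (pb s aI) (vals s vs)).
Proof.
elim: vs => [|v vs IH].
  by apply: spec_conseq (spec_ret _ (fun _ _ => True)) => // B s x s' _ _ _ [_ ->].
pose pre B s := exists j, [/\ pb s aI < pb s aN ^ j, pb s aN ^ (j + (size vs).+1) <= B
  & all (fun x => x < pb s aN) (vals s (v :: vs))].
pose pre1 B s := [/\ pb s aI + pb s (inl v) <= B & exists j, [/\
  pb s aI + pb s (inl v) < pb s aN ^ j, pb s aN ^ (j + size vs) <= B
  & all (fun x => x < pb s aN) (vals s vs)]].
have preN B s : pre B s -> exists j, [/\ pb s aI * pb s aN + pb s (inl v) < pb s aN ^ j, pb s aN ^ (j + size vs) <= B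
    & all (fun x => x < pb s aN) (vals s vs)].
  case=> j [h1 h2 /= /andP[h3 h4]]; exists j.+1; rewrite addSnnS; split=> //.
  apply: leq_trans (_ : (pb s aI).+1 * pb s aN <= _); first by rewrite mulSnr ltn_add2l.
  by rewrite expnSr leq_mul2r h1 orbT.
have preB B s : pre B s -> pb s aI * pb s aN + pb s (inl v) < B.
  move=> hp; have [j [h1 h2 _]] := preN _ _ hp; apply: leq_trans h1 (leq_trans _ h2).
  case: hp => j' [_ _ /= /andP[h3 _]]; rewrite leq_pexp2l ?leq_addr //.
  exact: leq_ltn_trans (leq0n _) h3.
have m2 : spec mulN pre (fun s _ s' => frame scratch s s' /\ pb s' aI = pb s aI * pb s aN).
  by apply: spec_conseq spec_mulN => // B s _ hp; have := preB _ _ hp; lia.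
have ad : spec (addp (inl v) aI) pre1
   (fun s _ s' => frame scratch s s' /\ pb s' aI = pb s aI + pb s (inl v)).
  apply: spec_conseq (spec_addp (p := inl v) (q := aI) isT isT isT) => [B s _ []//|B s x s' _ _ _ [fr E]].
  by split=> //; apply: frame_sub fr; apply/allP.
apply: spec_conseq (spec_bind m2 (fun _ => spec_bind ad (fun _ => IH) _) _) => //.
- move=> B s x s' _ _ _ [_ [s1 [[f1 E1] [_ [s2 [[f2 E2] [f3 E3]]]]]]]; split.
    exact: frame_trans f1 (frame_trans f2 f3).
  rewrite E3 E2 E1 (frame_aN f2) (frame_aN f1) (frame_vals _ f2) (frame_vals _ f1) /=.
  by have [_ ->] := f1.
- move=> _ B s _ s' [hB [j [h1 h2 h3]]] [f1 E1] _; exists j.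
  by rewrite E1 (frame_aN f1) (frame_vals _ f1).
- move=> B s _ s' hp [f1 E1] _; split; first by have := preB _ _ hp; rewrite E1; have [_ ->] := f1 => //; lia.
  have [j [h1 h2 h3]] := preN _ _ hp; exists j.
  by rewrite E1 (frame_aN f1) (frame_vals _ f1); have [_ ->] := f1.
Qed.

Lemma spec_getidx vs : spec (getidx vs)
  (fun B s => [/\ 0 < pb s aN, pb s aN ^ size vs <= B & all (fun x => x < pb s aN) (vals s vs)])
  (fun s _ s' => frame scratch s s' /\ pb s' aI = idx (pb s aN) 0 (vals s vs)).
Proof.
pose pre B s := [/\ 0 < pb s aN, pb s aN ^ size vs <= B & all (fun x => x < pb s aN) (vals s vs)].
have fI s : frame scratch s (setp s aI 0) by apply: frame_setp.
apply: spec_conseq (spec_bind (spec_clr aI pre) (fun _ => spec_pushidx vs) _) => //.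
- move=> B s x s' _ _ _ [_ [s1 [-> [f E]]]]; split; first exact: frame_trans f.
  by rewrite E.
- by move=> B s _ s' [h1 h2 h3] -> _; exists 0; rewrite expn0.
Qed.

(** * Structured programs and their compilation *)

Definition store := dat -> nat -> bool.
Definition updd (sg : store) a i b : store :=
  fun a' j => if (a' == a) && (j == i) then b else sg a' j.
Definition upde (env : V -> nat) v i : V -> nat := fun u => if u == v then i else env u.

Inductive stmt :=
| Skip
| Seq of stmt & stmt
| For of V & stmt
| SetT of A & seq V & bool
| If of dat & seq V & stmt & stmt
| IfEq of V & V & stmt & stmt.

Fixpoint sem (n : nat) (env : V -> nat) (s : stmt) (sg : store) : store :=
  match s with
  | Skip => sg
  | Seq s1 s2 => sem n env s2 (sem n env s1 sg)
  | For v s => foldl (fun sg i => sem n (upde env v i) s sg) sg (iota 0 n)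
  | SetT a vs b => updd sg (inr a) (idx n 0 (map env vs)) b
  | If a vs s1 s2 => if sg a (idx n 0 (map env vs)) then sem n env s1 sg else sem n env s2 sg
  | IfEq u v s1 s2 => if env u == env v then sem n env s1 sg else sem n env s2 sg
  end.

Fixpoint maxlen (s : stmt) : nat :=
  match s with
  | Skip => 0
  | Seq s1 s2 | IfEq _ _ s1 s2 => maxn (maxlen s1) (maxlen s2)
  | For _ s => maxlen s
  | SetT _ vs _ => size vs
  | If _ vs s1 s2 => maxn (size vs) (maxn (maxlen s1) (maxlen s2))
  end.

(** Loop variables must be fresh: a compiled loop leaves its pebble at the number of vertices,
    whereas [sem] restores the environment. *)
Fixpoint wf (sc : seq V) (s : stmt) : bool :=
  match s with
  | Skip => true
  | Seq s1 s2 => wf sc s1 && wf sc s2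
  | For v s => (v \notin sc) && wf (v :: sc) s
  | SetT _ vs _ => all [in sc] vs
  | If _ vs s1 s2 => [&& all [in sc] vs, wf sc s1 & wf sc s2]
  | IfEq u v s1 s2 => [&& u \in sc, v \in sc, wf sc s1 & wf sc s2]
  end.

Fixpoint compile (s : stmt) : frag cell unit :=
  match s with
  | Skip => ret cell tt
  | Seq s1 s2 => bind (compile s1) (fun _ => compile s2)
  | For v s => forto (inl v) aN (compile s)
  | SetT a vs b => bind (getidx vs) (fun _ => setdat aI (inr a) b)
  | If a vs s1 s2 => bind (getidx vs) (fun _ => bind (readbit aI (Some (inr a)))
      (fun b : bool => if b then compile s1 else compile s2))
  | IfEq u v s1 s2 => bind (readbit (inl u) (Some (inl (inl v))))
      (fun b : bool => if b then compile s1 else compile s2)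
  end.

Lemma sem_ext n sc s env env' sg : wf sc s -> {in sc, env =1 env'} ->
  sem n env s sg = sem n env' s sg.
Proof.
elim: s sc env env' sg => [|s1 IH1 s2 IH2|v s IH|a vs b|a vs s1 IH1 s2 IH2|u v s1 IH1 s2 IH2] sc env env' sg //=.
- by case/andP=> w1 w2 h; rewrite (IH1 _ _ _ _ w1 h) (IH2 _ _ _ _ w2 h).
- case/andP=> nv w h; elim: (iota 0 n) sg => //= i r IHr sg; rewrite IHr; congr foldl.
  apply: IH w _ => u; rewrite inE /upde; case: eqP => //= _; exact: h.
- by move/allP=> hs h; congr (updd _ _ (idx _ _ _) _); apply/eq_in_map => u /hs; apply: h.
- case/and3P=> /allP hs w1 w2 h; have -> : map env vs = map env' vs by apply/eq_in_map => u /hs; apply: h.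
  by case: ifP => _; [exact: IH1 w1 h|exact: IH2 w2 h].
- by case/and4P=> hu hv w1 w2 h; rewrite !h //; case: ifP => _; [exact: IH1 w1 h|exact: IH2 w2 h].
Qed.

Definition cpre L (sc : seq V) B (s : st) := [/\ 0 < pb s aN, pb s aN ^ L <= B
  & {in sc, forall v, pb s (inl v) < pb s aN}].
Definition cpost (sc : seq V) p (s : st) (x : unit) (s' : st) := [/\
  dt s' = sem (pb s aN) (fun v => pb s (inl v)) p (dt s), pb s' aN = pb s aN
  & {in sc, forall v, pb s' (inl v) = pb s (inl v)}].

Lemma cpre_le L L' sc B s : L <= L' -> cpre L' sc B s -> cpre L sc B s.
Proof.
by move=> le [h1 h2 h3]; split=> //; apply: leq_trans h2; rewrite leq_pexp2l.
Qed.

Lemma cpre_frame L sc B s s' : frame scratch s s' -> cpre L sc B s -> cpre L sc B s'.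
Proof.
move=> f [h1 h2 h3]; split; rewrite ?(frame_aN f) // => v vs.
by have [_ ->] := f; rewrite ?h3.
Qed.

Lemma compile_ok p sc : wf sc p -> spec (compile p) (cpre (maxlen p) sc) (cpost sc p).
Proof.
elim: p sc => [|s1 IH1 s2 IH2|v s IH|a vs b|a vs s1 IH1 s2 IH2|u v s1 IH1 s2 IH2] sc /=.
- move=> _; apply: spec_conseq (spec_ret _ (fun _ _ => True)) => // B s x s' _ _ _ [_ ->] //.
- case/andP=> w1 w2; pose L := maxn (maxlen s1) (maxlen s2).
  have h1 : spec (compile s1) (cpre L sc) (cpost sc s1).
    by apply: spec_conseq (IH1 _ w1) => // B s _; apply: cpre_le; apply: leq_maxl.
  have h2 : spec (compile s2) (cpre L sc) (cpost sc s2).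
    by apply: spec_conseq (IH2 _ w2) => // B s _; apply: cpre_le; apply: leq_maxr.
  apply: spec_conseq (spec_bind h1 (fun _ => h2) _) => //.
  + move=> B s x s' _ _ _ [_ [s3 [[d1 n1 v1] [d2 n2 v2]]]]; split.
    * by rewrite d2 d1 n1; apply: sem_ext w2 _ => u us; rewrite v1.
    * by rewrite n2 n1.
    * by move=> u us; rewrite v2 // v1.
  + move=> B s x s' [p1 p2 p3] [d1 n1 v1] _; split; rewrite ?n1 // => u us.
    by rewrite v1 // p3.
- case/andP=> nv w.
  pose I s0 i s1 := [/\ dt s1 = foldl (fun sg i => sem (pb s0 aN) (upde (fun v => pb s0 (inl v)) v i) s sg)
      (dt s0) (iota 0 i), pb s1 aN = pb s0 aN & {in sc, forall u, pb s1 (inl u) = pb s0 (inl u)}].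
  have neq u : u \in sc -> (inl u == inl v :> peb) = false.
    by move=> us; apply/negbTE; apply: contraNneq nv => -[<-].
  apply: spec_conseq (spec_forto (I := I) (pre := cpre (maxlen s) sc) _ (IH _ w) _ _ _) => //.
  + by move=> B s0 _; split=> //= u us; rewrite neq.
  + move=> B s0 i s1 [p1 p2 p3] _ _ hi [d1 n1 v1] hc hp; split; rewrite ?n1 //.
    move=> u; rewrite inE => /orP[/eqP->|us]; first by rewrite hc.
    by rewrite v1 // p3.
  + move=> B s0 i s1 x s2 _ _ _ hi [d1 n1 v1] hc hp [d2 n2 v2]; split.
    * by rewrite v2 ?mem_head.
    * by rewrite n2.
    * split=> [|//=|u us]; last by rewrite /= neq // v2 ?inE ?us ?orbT // v1.
        have -> : iota 0 i.+1 = iota 0 i ++ [:: i] by rewrite -addn1 iotaD.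
        rewrite foldl_cat -d1 [RHS]/= -[LHS]/(dt s2) d2 n1.
        apply: sem_ext w _ => u; rewrite inE /upde; case: eqP => [->|_] //= us; exact: v1.
      by rewrite n2 n1.
- move/allP=> hv; pose L := size vs.
  have hp B s : cpre L sc B s -> [/\ 0 < pb s aN, pb s aN ^ size vs <= B & all (fun x => x < pb s aN) (vals s vs)].
    case=> h1 h2 h3; split=> //; apply/allP => x /mapP[u us ->]; apply: h3; exact: hv.
  have h1 := spec_conseq (fun B s _ h => hp B s h) (fun B s x s' _ _ _ h => h) (spec_getidx vs).
  apply: spec_conseq (spec_bind h1 (fun _ => spec_setdat aI (inr a) b (fun _ _ => True)) _) => //.
  move=> B s x s' _ _ _ [_ [s1 [[f E] ->]]]; split.
  + by rewrite /= E; have [-> _] := f.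
  + exact: frame_aN f.
  + by move=> u us /=; have [_ ->] := f.
- case/and3P=> /allP hv w1 w2; set L := maxn _ _.
  have hp B s : cpre L sc B s -> [/\ 0 < pb s aN, pb s aN ^ size vs <= B & all (fun x => x < pb s aN) (vals s vs)].
    move/(cpre_le (leq_maxl _ _)); case=> h1 h2 h3; split=> //; apply/allP => x /mapP[u us ->]; apply: h3; exact: hv.
  have i1 : spec (getidx vs) (cpre L sc) (fun s _ s' => frame scratch s s' /\ pb s' aI = idx (pb s aN) 0 (vals s vs)).
    exact: spec_conseq (fun B s _ h => hp B s h) (fun B s x s' _ _ _ h => h) (spec_getidx vs).
  have h12 (b : bool) : spec (if b then compile s1 else compile s2) (cpre L sc) (cpost sc (if b then s1 else s2)).
    case: b; [apply: spec_conseq (IH1 _ w1)|apply: spec_conseq (IH2 _ w2)] => // B s _; apply: cpre_le.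
      by rewrite /L; lia.
    by rewrite /L; lia.
  apply: spec_conseq (spec_bind i1 (fun _ => spec_bind (spec_read aI (Some (inr a)) (cpre L sc)) h12 _) _) => //.
  + move=> B s x s' _ _ _ [_ [s3 [[f E] [b [s4 [[-> Eb] [d n v]]]]]]].
    have [f1 f2] := f; split; last by move=> u us; rewrite v // f2.
      rewrite d; move: Eb; rewrite ffunE E f1 => ->.
      rewrite (frame_aN f) [RHS]/=.
      by case: ifP => _; [apply: sem_ext w1 _|apply: sem_ext w2 _] => u us; rewrite f2.
    by rewrite n (frame_aN f).
  + by move=> _ B s b s' h [-> _] _.
  + by move=> B s _ s' h [f _] _; apply: cpre_frame f h.
- case/and4P=> hu hv w1 w2; set L := maxn _ _.
  have h12 (b : bool) : spec (if b then compile s1 else compile s2) (cpre L sc) (cpost sc (if b then s1 else s2)).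
    case: b; [apply: spec_conseq (IH1 _ w1)|apply: spec_conseq (IH2 _ w2)] => // B s _; apply: cpre_le.
      by rewrite /L; lia.
    by rewrite /L; lia.
  apply: spec_conseq (spec_bind (spec_read (inl u) (Some (inl (inl v))) (cpre L sc)) h12 _) => //.
  + move=> B s x s' _ _ _ [b [s4 [[-> Eb] [d n vv]]]]; split=> //.
    by rewrite d Eb ffunE eq_sym /=; case: ifP.
  + by move=> B s b s' h [-> _] _.
Qed.

(** * Reading the input *)

Definition empty_cell : cell := [ffun=> false].
Definition bit_cell (b : bool) : cell := [ffun o : track =>
  match o with Some (inr (inl c)) => c || b | _ => false end].
(** Meant for cell 0 alone: it sets the mark and places all pebbles there, so that every register
    starts at 0. *)
Definition mark_cell (c : cell) : cell := [ffun o : track =>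
  match o with Some (inr _) => c o | _ => true end].
Definition init_frag : frag cell unit := act (fun c => (tt, mark_cell c, MStay)).
(* Of the two input tracks, [inl true] marks the extent of the input, from which
   the number of vertices is recovered, and [inl false] holds its bits. *)
Definition input_store (w : seq bool) : store := fun a i =>
  match a with inl true => i < size w | inl false => nth false w i | inr _ => false end.
Definition init_st w := St (fun=> 0) (input_store w).

Lemma runs_init w : runs init_frag 0 (input_tape empty_cell (bit_cell false) (bit_cell true) w)
  1 tt 0 (tape (init_st w)).
Proof.
have inE i o : input_tape empty_cell (bit_cell false) (bit_cell true) w i o =
    match o with Some (inr a) => input_store w a i | _ => false end.
  rewrite /input_tape /input_store; case: ltnP => hs.
    by case: (nth false w i); rewrite ffunE; case: o => [[q|[[]|a]]|].
  by rewrite ffunE; case: o => [[q|[[]|a]]|] //; rewrite nth_default.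
suff <- : upd (input_tape empty_cell (bit_cell false) (bit_cell true) w) 0
  (mark_cell (input_tape empty_cell (bit_cell false) (bit_cell true) w 0)) = tape (init_st w).
  exact: (runs_act (m := MStay)).
apply: functional_extensionality => i; apply/ffunP=> o; rewrite /upd.
case: (i =P 0) => [->|/eqP i0]; rewrite ?ffunE inE; case: o => [[q|a]|] //=.
  by rewrite eq_sym (negbTE i0).
by rewrite (negbTE i0).
Qed.

(** Increments [aN] as long as position [aN * aN] lies in the input, so the loop stops at the square
    root of the input length. *)
Definition count_body : frag cell (option unit) :=
  bind (clr aI) (fun _ => bind (addp aN aI) (fun _ => bind mulN (fun _ =>
  bind (readbit aI (Some (inr (inl true)))) (fun b : bool =>
    if b then bind (inc aN) (fun _ => ret cell None) else ret cell (Some tt))))).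

Lemma spec_count_body : spec count_body
  (fun B s => pb s aN * pb s aN <= B /\ pb s aN < B)
  (fun s x s' => dt s' = dt s /\
    if dt s (inl true) (pb s aN * pb s aN) then x = None /\ pb s' aN = (pb s aN).+1
    else x = Some tt /\ pb s' aN = pb s aN).
Proof.
pose pre B s := pb s aN * pb s aN <= B /\ pb s aN < B.
have h (b : bool) : spec (if b then bind (inc aN) (fun _ => ret cell (@None unit)) else ret cell (Some tt))
  (fun B s => pb s aN < B) (fun s x s' => dt s' = dt s /\
    if b then x = None /\ pb s' aN = (pb s aN).+1 else x = Some tt /\ pb s' aN = pb s aN).
  case: b; last by apply: spec_conseq (spec_ret _ (fun _ _ => True)) => // B s x s' _ _ _ [-> ->].
  apply: spec_conseq (spec_bind (spec_inc aN) (fun _ => spec_ret _ (fun _ _ => True)) _) => //.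
  by move=> B s x s' _ _ _ [_ [s1 [-> [-> ->]]]].
apply: spec_conseq (spec_bind (spec_clr aI pre) (fun _ =>
  spec_bind (pre := fun B s => pre B s /\ pb s aI = 0) (spec_conseq _ (fun B s x s' _ _ _ p => p) (spec_addp (p := aN) (q := aI) isT isT isT)) (fun _ =>
  spec_bind (pre := fun B s => pre B s /\ pb s aI = pb s aN) (spec_conseq _ (fun B s x s' _ _ _ p => p) spec_mulN) (fun _ =>
  spec_bind (spec_read aI (Some (inr (inl true))) (fun B s => pb s aN < B)) h _) _) _) _) => //.
- move=> B s x s' _ _ _ [_ [s1 [-> [_ [s2 [[f2 E2] [_ [s3 [[f3 E3] [b [s4 [[-> Eb] [d4 E4]]]]]]]]]]]]].
  have f12 : frame scratch s s2.
    apply: frame_trans (frame_setp _ _ _) (frame_sub _ f2) => //; exact/allP.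
  have f13 := frame_trans f12 f3; have [d3 _] := f13; split; first by rewrite d4.
  move: Eb E4; rewrite ffunE d3 E3 E2 /= add0n (frame_aN f12) (frame_aN f13) => <-.
  by [].
- by move=> _ B s _ [[h1 h2] ->]; rewrite add0n ltnW.
- by move=> _ _ B s _ [[h1 _] ->].
- by move=> _ _ _ B s b s' h1 [-> _].
- by move=> _ _ B s _ s' [[_ h1] _] [f _] _; rewrite (frame_aN f).
- move=> _ B s _ s' [[h1 h2] h0] [[_ f] E] _; have fN : pb s' aN = pb s aN by apply: f.
  by rewrite /pre fN E h0 add0n.
- by move=> B s _ s' [h1 h2] -> _.
Qed.

Definition sized n (s : st) := forall i, dt s (inl true) i = (i < n * n).

Lemma spec_count : spec (loop count_body)
  (fun B s => exists n, [/\ pb s aN = 0, sized n s, n * n <= B & n < B])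
  (fun s _ s' => dt s' = dt s /\ forall n, sized n s -> pb s' aN = n).
Proof.
have [e he] := spec_count_body; exists (1 + e.+2) => B s hb [n [hN hs hB hnB]].
have uniq_n m : sized m s -> m = n.
  move=> hm; apply/eqP; rewrite eqn_leq; apply/andP; split; rewrite leqNgt; apply/negP => lt.
    by have := hm (n * n); rewrite hs ltnn ltn_mul.
  by have := hs (m * m); rewrite hm ltnn ltn_mul.
have hw : forall d a u, a + d = n -> pb u aN = a -> dt u = dt s -> bounded u B ->
    exists u', [/\ does (loop count_body) u tt u' B (d.+1 * (B.+2 ^ e).+1), bounded u' B,
      dt u' = dt s & pb u' aN = n].
  elim=> [|d IH] a u Ed ha hd hbu.
    rewrite addn0 in Ed; subst a.
    have [|x [u1 [d1 b1 [E1]]]] := he B u hbu; first by rewrite Ed.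
    rewrite hd hs Ed ltnn => -[Ex EN]; subst x; exists u1; split=> //; try by rewrite E1 ?hd // EN.
    by rewrite mul1n; apply: does_loop_stop.
  have an : a < n by lia.
  have [|x [u1 [d1 b1 [E1]]]] := he B u hbu.
    by rewrite ha; split; [apply: leq_trans hB; rewrite leq_mul // ltnW|apply: ltn_trans hnB].
  rewrite hd hs ha ltn_mul // => -[Ex EN]; subst x.
  have [|u' [d2 b2 E2 N2]] := IH a.+1 u1 _ EN (etrans E1 hd) b1; first by rewrite addSnnS.
  exists u'; split=> //; rewrite mulSn; rewrite -[X in does _ _ _ _ _ X]addSn.
  by apply: does_loop_next d1 d2.
have [|u [d b E N]] := hw n 0 s _ hN erefl hb; first by rewrite add0n.
exists tt, u; split=> //; last by split=> // m /uniq_n->.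
apply: does_weaken d; rewrite expnD; apply: leq_mul; first by rewrite expn1; lia.
by rewrite -addn1 -[e.+2]/((maxn e.+1 0).+1); apply: pow_add => //; rewrite leq_pexp2l.
Qed.

(** The empty index list addresses cell 0, where a table of arity zero keeps its bit. *)
Definition core_frag p (res : A) : frag cell bool :=
  bind (loop count_body) (fun _ => bind (compile p) (fun _ => bind (getidx [::]) (fun _ =>
    readbit aI (Some (inr (inr res)))))).
Definition main_frag p res : frag cell bool := bind init_frag (fun _ => core_frag p res).

Lemma spec_core p res : wf [::] p -> spec (core_frag p res)
  (fun B s => exists n, [/\ 0 < n, pb s aN = 0, sized n s, n * n <= B & n < B] /\ n ^ maxlen p <= B)
  (fun s b _ => forall n, sized n s -> b = sem n (fun=> 0) p (dt s) (inr res) 0).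
Proof.
move=> wp; pose pre1 B s := exists n, [/\ 0 < n, pb s aN = 0, sized n s, n * n <= B & n < B] /\ n ^ maxlen p <= B.
have c1 : spec (loop count_body) pre1 (fun s _ s' => dt s' = dt s /\ forall n, sized n s -> pb s' aN = n).
  by apply: spec_conseq spec_count => // B s _ [n [[h0 h1 h2 h3 h4] _]]; exists n.
apply: spec_conseq (spec_bind c1 (fun _ => spec_bind (compile_ok wp) (fun _ =>
  spec_bind (spec_getidx [::]) (fun _ => spec_read aI (Some (inr (inr res))) (fun _ _ => True)) _) _) _) => //.
- move=> B s b s' _ _ _ [_ [s1 [[d1 N1] [_ [s2 [[d2 N2 _] [_ [s3 [[f3 E3] [_ Eb]]]]]]]]]] n hn.
  rewrite Eb ffunE E3 /idx /=; have [-> _] := f3; rewrite d2 d1 (N1 _ hn).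
  by congr ((_ : store) _ _); apply: sem_ext wp _.
- move=> _ B s x s' [h1 h2 h3] [d N _] _; split=> //; rewrite N // expn0.
  by apply: leq_trans h2; rewrite expn_gt0 h1.
- move=> B s _ s' [n [[h0 h1 h2 h3 h4] h5]] [d N] _; split=> //; by rewrite (N _ h2).
Qed.

Lemma main_result p res : wf [::] p -> exists e, forall w n j, 1 < n -> size w = n * n ->
  n.+2 ^ e <= j ->
  tm_result (toTM (main_frag p res) empty_cell (bit_cell false) (bit_cell true)) w j
    = Some (sem n (fun=> 0) p (input_store w) (inr res) 0).
Proof.
move=> wp; have [e he] := spec_core res wp; pose m := maxlen p.
(* [B] has to be at least [n * n] and [n ^ m] and to exceed [n]. With exponent [m + 3] one has
   [B.+2 <= n.+2 ^ (m + 4)]; the last successor pays for the initial step. *)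
exists ((m + 4) * e).+1 => w n j n1 hw hj; pose B := n.+2 ^ (m + 3).
have n0 : 0 < n by apply: ltnW.
have B1 : n * n <= B.
  apply: leq_trans (_ : n.+2 ^ 2 <= _); last by rewrite leq_pexp2l // addnS ltnS addnS.
  by rewrite expnS expn1 leq_mul // leqW // leqW.
have B2 : n < B by apply: leq_trans (_ : n.+2 ^ 1 <= _); rewrite ?expn1 // -{1}(expn1 n.+2) leq_pexp2l // addnS.
have B3 : n ^ m <= B.
  apply: leq_trans (_ : n.+2 ^ m <= _); last by rewrite leq_pexp2l // leq_addr.
  by case: (m) => // m'; rewrite leq_exp2r // leqW // leqW.
have hs : sized n (init_st w) by move=> i; rewrite /= hw.
have [||b [s' [d _ Eb]]] := he B (init_st w); first by [].
  by exists n.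
have [k [p' [hk _ hr]]] := d 0 (leq0n _).
rewrite -(Eb n hs); apply: toTM_result (runs_bind (runs_init w) hr).
apply: leq_trans hj; rewrite add1n expnS; apply: leq_trans (_ : 2 * n.+2 ^ ((m + 4) * e) <= _); last first.
  by rewrite leq_mul2r orbT.
have h4 : B.+2 <= n.+2 ^ (m + 4).
  rewrite addnS expnS; apply: leq_trans (_ : 2 * B <= _); last by rewrite leq_mul2r orbT.
  by rewrite mul2n -addnn; move: B2 n1; lia.
have h5 : k <= n.+2 ^ ((m + 4) * e).
  apply: leq_trans hk _; rewrite expnM; case: (e) => // e'; by rewrite leq_exp2r.
have : 0 < n.+2 ^ ((m + 4) * e) by rewrite expn_gt0.
by lia.
Qed.

End Pebbles.

(** * A program for the query *)

(** The last digit and the rest are recovered by division with remainder. *)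
Lemma idx_inj n (l l' : seq nat) : size l = size l' ->
  all (fun x => x < n) l -> all (fun x => x < n) l' -> idx n 0 l = idx n 0 l' -> l = l'.
Proof.
elim/last_ind: l l' => [|l x IH] l'; first by case: l'.
case/lastP: l' => [|l' x']; first by rewrite size_rcons.
rewrite !size_rcons !all_rcons => -[hs] /andP[hx hl] /andP[hx' hl'].
rewrite /idx -!cats1 !foldl_cat /= => E.
have n0 : 0 < n by apply: leq_ltn_trans hx.
have Ex : x = x' by have := congr1 (modn^~ n) E; rewrite !modnMDl !modn_small.
have Ea := congr1 (divn^~ n) E; rewrite !divnMDl // !divn_small // !addn0 in Ea.
by rewrite (IH _ hs hl hl' Ea) Ex.
Qed.

Section Fors.
Variables (V A : finType) (n : nat).
Implicit Types (env : V -> nat) (s : stmt V A) (vs : seq V).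

Definition fors vs s := foldr (@For V A) s vs.
Definition agree vs env env' :=
  (forall v, v \notin vs -> env' v = env v) /\ (forall v, v \in vs -> env' v < n).

Lemma agree_cons v vs env env' i : i < n -> agree vs (upde env v i) env' -> agree (v :: vs) env env'.
Proof.
move=> hi [h1 h2]; split=> u; rewrite inE.
  by rewrite negb_or => /andP[ne /h1->]; rewrite /upde (negbTE ne).
case uv : (u \in vs); first by rewrite h2.
by rewrite orbF => /eqP E; rewrite h1 ?uv // /upde E eqxx.
Qed.

Lemma agree_upde v vs env env' : agree (v :: vs) env env' -> agree vs (upde env v (env' v)) env'.
Proof.
case=> h1 h2; split=> u hu; last by apply: h2; rewrite inE hu orbT.
by rewrite /upde; case: eqP => [->//|/eqP ne]; apply: h1; rewrite inE negb_or ne.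
Qed.

Lemma fors_inv (P : store A -> Prop) vs s env sg :
  (forall env', agree vs env env' -> forall sg, P sg -> P (sem n env' s sg)) ->
  P sg -> P (sem n env (fors vs s) sg).
Proof.
elim: vs env sg => [|v vs IH] env sg h hP /=; first by apply: h.
have : {subset iota 0 n <= gtn n} by move=> i; rewrite mem_iota.
elim: (iota 0 n) sg hP => //= i r IHr sg hP hr; apply: IHr; last first.
  by move=> j jr; apply: hr; rewrite inE jr orbT.
apply: IH => // env' ag; apply: h; apply: agree_cons ag.
by apply: hr; rewrite mem_head.
Qed.

(** The iteration with the values of [env0] establishes [Q]; those before it keep [P] and those
    after it keep both. *)
Lemma fors_hit (P Q : store A -> Prop) vs s env env0 sg :
  (forall env', agree vs env env' -> forall sg, P sg -> P (sem n env' s sg)) ->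
  (forall env', agree vs env env' -> forall sg, P sg -> Q sg -> Q (sem n env' s sg)) ->
  agree vs env env0 -> (forall sg, P sg -> Q (sem n env0 s sg)) ->
  P sg -> Q (sem n env (fors vs s) sg).
Proof.
elim: vs env sg => [|v vs IH] env sg hP hQ ag h0 hsg.
  have -> : env = env0 by apply: functional_extensionality => v; have [h _] := ag; rewrite h.
  exact: h0.
have lt0 : env0 v < n by have [_ h] := ag; apply: h; rewrite mem_head.
rewrite /= -/(fors vs s).
have keep i sg' : i < n -> P sg' -> P (sem n (upde env v i) (fors vs s) sg').
  by move=> hi; apply: fors_inv => env' /(agree_cons hi); apply: hP.
have keepQ i sg' : i < n -> P sg' /\ Q sg' ->
    P (sem n (upde env v i) (fors vs s) sg') /\ Q (sem n (upde env v i) (fors vs s) sg').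
  move=> hi; apply: (fors_inv (P := fun sg => P sg /\ Q sg)) => env' /(agree_cons hi) ag' sg1 [h1 h2].
  by split; [apply: hP|apply: hQ].
have hit sg' : P sg' -> Q (sem n (upde env v (env0 v)) (fors vs s) sg').
  apply: IH; [|by move=> env' /(agree_cons lt0); apply: hQ|exact: agree_upde|exact: h0].
  by move=> env' /(agree_cons lt0); apply: hP.
have hall : forall r sg', {subset r <= gtn n} -> P sg' /\ Q sg' ->
    P (foldl (fun sg i => sem n (upde env v i) (fors vs s) sg) sg' r) /\
    Q (foldl (fun sg i => sem n (upde env v i) (fors vs s) sg) sg' r).
  elim=> // i r IHr sg' hr h /=; apply: IHr.
    by move=> j jr; apply: hr; rewrite inE jr orbT.
  by apply: keepQ h; apply: hr; rewrite mem_head.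
have : {subset iota 0 n <= gtn n} by move=> i; rewrite mem_iota.
have : env0 v \in iota 0 n by rewrite mem_iota.
elim: (iota 0 n) sg hsg => //= i r IHr sg' hsg' + hr.
have hi : i < n by apply: hr; rewrite mem_head.
have hr' : {subset r <= gtn n} by move=> j jr; apply: hr; rewrite inE jr orbT.
rewrite inE => /orP[/eqP Ei|vr]; last by apply: IHr => //; apply: keep.
have [] // := hall r (sem n (upde env v i) (fors vs s) sg') hr' _.
by split; [apply: keep|rewrite -Ei; apply: hit].
Qed.

Lemma fors_count (P : nat -> store A -> Prop) vs s env sg m :
  (forall env' m sg, P m sg -> P m.+1 (sem n env' s sg)) ->
  P m sg -> P (m + n ^ size vs) (sem n env (fors vs s) sg).
Proof.
move=> h; elim: vs env sg m => [|v vs IH] env sg m hP /=; first by rewrite expn0 addn1; apply: h.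
rewrite expnS -[X in X * _](size_iota 0 n).
elim: (iota 0 n) sg m hP => [|i r IHr] sg m hP /=; first by rewrite mul0n addn0.
by rewrite mulSn addnA; apply: IHr; apply: IH.
Qed.

Lemma wf_fors sc vs s : uniq vs -> {in vs, forall v, v \notin sc} ->
  wf (rev vs ++ sc) s -> wf sc (fors vs s).
Proof.
elim: vs sc => //= v vs IH sc /andP[nv uv] hd hw.
rewrite hd ?mem_head //=; apply: IH => //; last by move: hw; rewrite rev_cons cat_rcons.
move=> u us; rewrite inE negb_or hd ?inE ?us ?orbT // andbT.
by apply: contraNneq nv => <-.
Qed.
End Fors.

Section Branch.
Variables (V A U : finType) (n : nat) (var : U -> V) (f : pattern U -> stmt V A).

(* Nested tests determine the arcs and equalities among the values of [var] one
   pair at a time; the leaf runs [f] on the resulting pattern. *)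
Fixpoint branch (l : seq (U * U)) (acc : U * U -> bool * bool) : stmt V A :=
  if l is ij :: l' then
    let next b := branch l' (fun kl => if kl == ij then b else acc kl) in
    If (inl false) [:: var ij.1; var ij.2]
      (IfEq (var ij.1) (var ij.2) (next (true, true)) (next (true, false)))
      (IfEq (var ij.1) (var ij.2) (next (false, true)) (next (false, false)))
  else f (finfun acc).

Definition on_pattern := branch (enum {: U * U}) (fun=> (false, false)).

Lemma sem_branch (env : V -> nat) sg l acc :
  let g ij := (sg (inl false) (idx n 0 [:: env (var ij.1); env (var ij.2)]),
               env (var ij.1) == env (var ij.2)) in
  sem n env (branch l acc) sg = sem n env (f [ffun ij => if ij \in l then g ij else acc ij]) sg.
Proof.
move=> g; elim: l acc => [|ij l IH] acc /=.
  by congr (sem _ _ (f _) _); apply/ffunP=> ij; rewrite !ffunE.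
have E : forall b, b = g ij -> sem n env (branch l (fun kl => if kl == ij then b else acc kl)) sg
    = sem n env (f [ffun kl => if kl \in ij :: l then g kl else acc kl]) sg.
  move=> b ->; rewrite IH; congr (sem _ _ (f _) _); apply/ffunP=> kl; rewrite !ffunE inE.
  by case: eqP => [->|_] //=; case: ifP.
by case E1 : (sg _ _); case E2 : (_ == _); apply: E; rewrite /g E1 E2.
Qed.

Lemma sem_on_pattern (env : V -> nat) sg (D : rel 'I_n) (x : U -> 'I_n) :
  (forall a b : 'I_n, sg (inl false) (a * n + b) = D a b) ->
  (forall u, env (var u) = x u) ->
  sem n env on_pattern sg = sem n env (f (pat D x)) sg.
Proof.
move=> hD hx; rewrite /on_pattern sem_branch; congr (sem _ _ (f _) _).
by apply/ffunP=> ij; rewrite !ffunE mem_enum !hx /idx /= hD.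
Qed.

Lemma wf_on_pattern sc : (forall u, var u \in sc) -> (forall p, wf sc (f p)) -> wf sc on_pattern.
Proof.
move=> hv hf; rewrite /on_pattern; elim: (enum _) (fun=> _) => [|ij l IH] acc /=; first exact: hf.
by rewrite !hv !IH.
Qed.
End Branch.

Lemma sem_input (V A : finType) n env (s : stmt V A) sg c i :
  sem n env s sg (inl c) i = sg (inl c) i.
Proof.
elim: s env sg => [|s1 IH1 s2 IH2|v s IH|a vs b|a vs s1 IH1 s2 IH2|u v s1 IH1 s2 IH2] env sg //=.
- by rewrite IH2 IH1.
- by elim: (iota 0 n) sg => //= j r IHr sg; rewrite IHr IH.
- by case: ifP.
- by case: ifP.
Qed.

Section Program.
Variables (K J : finType) (p0 pf : pattern (K + J)%type -> bool)
  (q : pattern ((K + J) + (K + J) + unit)%type -> bool).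
Local Notation I := (K + J)%type.

Definition var : finType := ((I + I + unit) + I)%type.
Definition tab : finType := 'I_4.
Definition xv (i : I) : var := inl (inl (inl i)).
Definition yv (i : I) : var := inl (inl (inr i)).
Definition zv : var := inl (inr tt).
Definition dv (i : I) : var := inr i.
(** [tT] holds the states reached so far, [tF] the outcome of the universal test, [tO] whether the
    current terminal tuple has been completed, and [tR] the answer. *)
Definition tT : tab := inord 0.
Definition tF : tab := inord 1.
Definition tO : tab := inord 2.
Definition tR : tab := inord 3.
Definition xs := map xv (enum {: I}).
Definition ys := map yv (enum {: I}).
Definition ds := map dv (enum {: I}).
Definition xK := map (xv \o inl) (enum K).
Definition xJ := map (xv \o inr) (enum J).

Definition initp : stmt var tab :=
  fors xs (on_pattern xv (fun p => if p0 p then SetT tT xs true else Skip _ _)).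
Definition testp : stmt var tab :=
  For zv (on_pattern inl (fun p => if q p then Skip _ _ else SetT tF [::] false)).
Definition movep : stmt var tab :=
  If (inr tT) xs
    (Seq (SetT tF [::] true) (Seq testp (If (inr tF) [::] (SetT tT ys true) (Skip _ _))))
    (Skip _ _).
(* The dummy variables [ds] only count: the [n ^ #|I|] rounds exceed the length of
   every simple path. *)
Definition closep : stmt var tab := fors ds (fors (xs ++ ys) movep).
Definition lookp : stmt var tab :=
  If (inr tT) xs (on_pattern xv (fun p => if pf p then SetT tO [::] true else Skip _ _)) (Skip _ _).
Definition checkp : stmt var tab :=
  Seq (SetT tO [::] false) (Seq (fors xJ lookp)
    (If (inr tO) [::] (Skip _ _) (SetT tR [::] false))).
Definition prog : stmt var tab :=
  Seq initp (Seq closep (Seq (SetT tR [::] true) (fors xK checkp))).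

Lemma mem_xs i : xv i \in xs. Proof. by rewrite map_f ?mem_enum. Qed.
Lemma mem_ys i : yv i \in ys. Proof. by rewrite map_f ?mem_enum. Qed.

Lemma wf_prog : wf [::] prog.
Proof.
have ux : uniq xs by rewrite map_inj_uniq ?enum_uniq // => i j [].
have uy : uniq ys by rewrite map_inj_uniq ?enum_uniq // => i j [].
have ud : uniq ds by rewrite map_inj_uniq ?enum_uniq // => i j [].
have uK : uniq xK by rewrite map_inj_uniq ?enum_uniq // => i j [].
have uJ : uniq xJ by rewrite map_inj_uniq ?enum_uniq // => i j [].
have allx (sc : seq var) : (forall i, xv i \in sc) -> all [in sc] xs.
  by move=> h; apply/allP => _ /mapP[i _ ->].
apply/and4P; split=> //.
- apply: (wf_fors (vs := xs)) => //; have hx i : xv i \in rev xs ++ [::] by rewrite cats0 mem_rev mem_xs.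
  by apply: wf_on_pattern => // p; case: ifP => //= _; apply: allx.
- apply: (wf_fors (vs := ds)) => //; apply: (wf_fors (vs := xs ++ ys)).
  + rewrite cat_uniq ux uy andbT /=; apply/hasPn => _ /mapP[i _ ->].
    by apply/mapP => -[].
  + move=> v; rewrite cats0 mem_rev => hv; apply/mapP => -[i _ E]; move: hv; rewrite E.
    by rewrite mem_cat => /orP[] /mapP[].
  set sc := _ ++ _; have hx i : xv i \in sc by rewrite /sc mem_cat mem_rev mem_cat mem_xs.
  have hy i : yv i \in sc by rewrite /sc mem_cat mem_rev mem_cat mem_ys orbT.
  apply/and3P; split=> //; first exact: allx.
  apply/and3P; split=> //; last by rewrite /= andbT; apply/allP => _ /mapP[i _ ->].
  apply/andP; split.
    by rewrite /sc mem_cat mem_rev cats0 !mem_cat mem_rev !negb_or -!andbA; apply/and3P; split; apply/mapP => -[].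
  apply: wf_on_pattern => [|p]; last by case: ifP.
  by move=> [[i|i]|[]]; rewrite inE ?hx ?hy ?orbT.
- apply: (wf_fors (vs := xK)) => //; apply/and3P; split=> //.
  apply: (wf_fors (vs := xJ)) => //.
    move=> v; rewrite cats0 mem_rev => /mapP[i _ ->]; by apply/mapP => -[j _ []].
  set sc := _ ++ _; have hx i : xv i \in sc.
    rewrite /sc cats0 mem_cat !mem_rev; apply/orP; case: i => i; [right|left].
      by apply/mapP; exists i; rewrite ?mem_enum.
    by apply/mapP; exists i; rewrite ?mem_enum.
  apply/and3P; split=> //; first exact: allx.
  by apply: wf_on_pattern => // p; case: ifP.
Qed.

(** * Correctness of the program *)

Section Run.
Variables (n : nat) (D : rel 'I_n).
Local Notation tup := {ffun I -> 'I_n}.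
Implicit Types (sg : store tab) (x y w : tup) (env : var -> nat).

Definition code x := idx n 0 [seq (x i : nat) | i <- enum {: I}].
Definition holds sg x := sg (inr tT) (code x).
Definition reads sg := forall a b : 'I_n, sg (inl false) (a * n + b) = D a b.
Definition moves_to x y := [forall z, q (pat D (join3 x y z))].

Lemma code_inj x y : code x = code y -> x = y.
Proof.
have h w : all (fun a => a < n) [seq (w i : nat) | i <- enum {: I}].
  by apply/allP => _ /mapP[i _ ->].
move/idx_inj; rewrite !size_map => /(_ erefl (h x) (h y)) /eq_in_map E.
by apply/ffunP => i; apply/val_inj/E; rewrite mem_enum.
Qed.

Lemma code_env (v : I -> var) env x : (forall i, env (v i) = x i) ->
  idx n 0 [seq env u | u <- map v (enum {: I})] = code x.
Proof. by move=> h; rewrite -map_comp; congr (idx _ _ _); apply: eq_map => i /=. Qed.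

Lemma env_tup (v : I -> var) env : (forall i, env (v i) < n) ->
  exists x, forall i, env (v i) = x i.
Proof. by move=> h; exists [ffun i => Ordinal (h i)] => i; rewrite ffunE. Qed.

Lemma reads_sem env s sg : reads sg -> reads (sem n env s sg).
Proof. by move=> h a b; rewrite sem_input. Qed.

Lemma holds_set sg x w : holds (updd sg (inr tT) (code x) true) w = holds sg w || (w == x).
Proof.
rewrite /holds /updd eqxx /=; case: eqP => [/code_inj->|ne]; first by rewrite eqxx orbT.
by case: eqP => [E|]; [rewrite E in ne|rewrite orbF].
Qed.

Lemma holds_other sg t i b w : t != tT -> holds (updd sg (inr t) i b) w = holds sg w.
Proof. by move=> ne; rewrite /holds /updd -[_ == _]/(tT == t) eq_sym (negbTE ne). Qed.

Lemma run_init env sg : reads sg -> (forall w, holds sg w = false) ->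
  forall w, holds (sem n env initp sg) w = p0 (pat D w).
Proof.
move=> rd h0 w.
pose body : stmt var tab := on_pattern xv (fun p => if p0 p then SetT tT xs true else Skip _ _).
have bodyE env' x sg' : (forall i, env' (xv i) = x i) -> reads sg' ->
    forall w, holds (sem n env' body sg') w = holds sg' w || (p0 (pat D x) && (w == x)).
  move=> ex rd' w'; rewrite (sem_on_pattern (x := x) _ rd' ex); case: ifP => _ /=; last by rewrite orbF.
  by rewrite (code_env ex) holds_set.
have tupE env' : agree n xs env env' -> exists x, forall i, env' (xv i) = x i.
  by case=> _ h; apply: env_tup => i; apply/h/mem_xs.
apply/idP/idP.
  pose P sg' := reads sg' /\ forall w, holds sg' w -> p0 (pat D w).
  suff [_] : P (sem n env initp sg) by apply.
  apply: fors_inv => [env' /tupE[x ex] sg' [rd' h]|]; last by split=> // w'; rewrite h0.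
  split=> [|w']; first exact: reads_sem.
  by rewrite (bodyE _ _ _ ex rd') => /orP[/h|/andP[pw /eqP->]].
move=> pw; pose env0 v := if v is inl (inl (inl i)) then (w i : nat) else env v.
apply: (fors_hit (P := reads) (Q := fun sg => holds sg w) (env0 := env0)) => //.
- by move=> env' _ sg'; apply: reads_sem.
- by move=> env' /tupE[x ex] sg' rd' h; rewrite (bodyE _ _ _ ex rd') h.
- split=> [v|v /mapP[i _ ->]]; last exact: ltn_ord.
  by case: v => [[[i|i]|u]|i]; rewrite /= ?mem_xs.
- by move=> sg' rd'; rewrite (bodyE env0 w) // pw eqxx orbT.
Qed.

Lemma run_test env x y sg : (forall i, env (xv i) = x i) -> (forall i, env (yv i) = y i) ->
  reads sg -> let sg' := sem n env testp sg in
  sg' (inr tT) = sg (inr tT) /\ sg' (inr tF) 0 = sg (inr tF) 0 && moves_to x y.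
Proof.
move=> ex ey rd /=.
rewrite (_ : moves_to x y = all (fun z => q (pat D (join3 x y z))) (enum 'I_n)); last first.
  by apply/forallP/allP => [h z _|h z] //; apply: h; rewrite mem_enum.
rewrite -val_enum_ord; elim: (enum 'I_n) sg rd => [|z r IH] sg rd /=; first by rewrite andbT.
set env' := upde _ _ _; pose v u := join3 x y z u.
have ev u : env' (inl u) = v u.
  by rewrite /env' /upde; case: u => [[i|i]|[]] //=; [exact: ex|exact: ey].
have [E1 E2] := IH (sem n env' (on_pattern inl (fun p => if q p then Skip _ _ else SetT tF [::] false)) sg)
  (reads_sem _ _ rd); split.
  rewrite E1 (sem_on_pattern (x := v) _ rd ev); case: ifP => _ //=.
  by apply: functional_extensionality => i; rewrite /updd -[_ == _]/(tT == tF) -val_eqE /= !inordK.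
rewrite E2 (sem_on_pattern (x := v) _ rd ev) /v; case: ifP => _ //=.
by rewrite /updd !eqxx /= andbF.
Qed.

Lemma run_move env x y sg : (forall i, env (xv i) = x i) -> (forall i, env (yv i) = y i) ->
  reads sg -> forall w, holds (sem n env movep sg) w =
    holds sg w || [&& holds sg x, moves_to x y & w == y].
Proof.
move=> ex ey rd w; rewrite /movep; cbn [sem]; rewrite (code_env ex) -/(holds sg x).
case: (holds sg x); last by rewrite orbF.
set sg1 := updd _ _ _ _; have rd1 : reads sg1 by [].
have [E1 E2] := run_test ex ey rd1; rewrite [idx _ _ _]/= E2 /sg1 {1}/updd !eqxx /=.
have E w' : holds (sem n env testp sg1) w' = holds sg w'.
  by rewrite /holds E1 -/(holds sg1 w') /sg1 holds_other // -val_eqE /= !inordK.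
by case: ifP => _; rewrite ?orbF // (code_env ey) holds_set E.
Qed.

Definition reach w := [exists x : tup, p0 (pat D x) && connect moves_to x w].

(** A round may propagate by more than one step, so the invariant sandwiches the table: after [m]
    rounds it contains the ends of all paths of length at most [m] and lies inside [reach]. *)
Lemma run_close env sg : reads sg -> (forall w, holds sg w = p0 (pat D w)) ->
  forall w, holds (sem n env closep sg) w = reach w.
Proof.
move=> rd h0.
pose P m sg := [/\ reads sg, forall w, holds sg w -> reach w
  & forall x p, p0 (pat D x) -> path moves_to x p -> size p <= m -> holds sg (last x p)].
have P0 : P 0 sg.
  split=> // [w|x [|y p]] //=; last by rewrite h0.
  by rewrite h0 => pw; apply/existsP; exists w; rewrite pw connect0.
have tupE env1 env' : agree n (xs ++ ys) env1 env' -> exists x y,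
    (forall i, env' (xv i) = x i) /\ (forall i, env' (yv i) = y i).
  case=> _ h; have [|x ex] := @env_tup xv env'; first by move=> i; apply: h; rewrite mem_cat mem_xs.
  have [|y ey] := @env_tup yv env'; first by move=> i; apply: h; rewrite mem_cat mem_ys orbT.
  by exists x, y.
have Pn : P (0 + n ^ size ds) (sem n env closep sg).
  apply: fors_count P0 => env1 m sg1 [rd1 so1 co1].
  have keep w : holds sg1 w -> holds (sem n env1 (fors (xs ++ ys) movep) sg1) w.
    move=> hw; pose P1 sg' := reads sg' /\ holds sg' w.
    have [] // : P1 (sem n env1 (fors (xs ++ ys) movep) sg1).
    apply: fors_inv => // env' /tupE[x [y [ex ey]]] sg' [rd' h']; split; first exact: reads_sem.
    by rewrite (run_move ex ey rd') h'.
  split; first exact: reads_sem.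
    pose P2 sg' := reads sg' /\ forall w, holds sg' w -> reach w.
    suff [] : P2 (sem n env1 (fors (xs ++ ys) movep) sg1) by [].
    apply: fors_inv => // env' /tupE[x [y [ex ey]]] sg' [rd' h']; split; first exact: reads_sem.
    move=> w; rewrite (run_move ex ey rd') => /orP[/h' //|/and3P[/h'/existsP[u /andP[pu cu]] mv /eqP->]].
    by apply/existsP; exists u; rewrite pu (connect_trans cu) // connect1.
  move=> x p px; case/lastP: p => [|p y] hp hs; first exact/keep/co1.
  rewrite last_rcons; move: hp; rewrite rcons_path => /andP[hp mv].
  rewrite size_rcons ltnS in hs; have hl := co1 x p px hp hs; set u := last x p in mv hl.
  pose env0 v := match v with inl (inl (inl i)) => (u i : nat) | inl (inl (inr i)) => (y i : nat) | _ => env1 v end.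
  apply: (fors_hit (P := fun sg => reads sg /\ holds sg u) (Q := fun sg => holds sg y) (env0 := env0)) => //.
  - move=> env' /tupE[a [b [ea eb]]] sg' [rd' h']; split; first exact: reads_sem.
    by rewrite (run_move ea eb rd') h'.
  - by move=> env' /tupE[a [b [ea eb]]] sg' [rd' h'] h; rewrite (run_move ea eb rd') h.
  - split=> [v|v]; last by rewrite mem_cat => /orP[] /mapP[i _ ->] /=.
    by case: v => [[[i|i]|t]|i]; rewrite mem_cat ?mem_xs ?mem_ys ?orbT.
  - by move=> sg' [rd' h']; rewrite (@run_move env0 u y) // h' mv eqxx orbT.
have [_ so co] := Pn; move=> w; apply/idP/idP; first exact: so.
case/existsP=> x /andP[px /connectP[p hp ->]].
(* A simple path has fewer steps than there are tuples, and the number of tuples is the number of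
   rounds. *)
have [p' hp' up' _] := shortenP hp; apply: co => //; rewrite add0n.
have := max_card (mem (x :: p')); rewrite (card_uniqP up') card_ffun card_ord /=.
by rewrite size_map -cardE; apply: ltnW.
Qed.

Lemma run_look env x sg : (forall i, env (xv i) = x i) -> reads sg ->
  let sg' := sem n env lookp sg in
  [/\ sg' (inr tT) = sg (inr tT), sg' (inr tR) = sg (inr tR)
    & sg' (inr tO) 0 = sg (inr tO) 0 || (holds sg x && pf (pat D x))].
Proof.
move=> ex rd; rewrite /lookp; cbn [sem]; rewrite (code_env ex) -/(holds sg x).
case: (holds sg x); last by split; rewrite ?orbF.
rewrite (sem_on_pattern (x := x) _ rd ex); case: ifP => _; last by split; rewrite ?orbF.
split; last by rewrite /= /updd !eqxx orbT.
  by apply: functional_extensionality => i; rewrite /= /updd -[_ == _]/(tT == tO) -val_eqE /= !inordK.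
by apply: functional_extensionality => i; rewrite /= /updd -[_ == _]/(tR == tO) -val_eqE /= !inordK.
Qed.

Definition completable (T : pred tup) (s : {ffun K -> 'I_n}) :=
  [exists w : tup, [&& T w, pf (pat D w) & [forall i, w (inl i) == s i]]].

Lemma run_check (T : pred tup) (s : {ffun K -> 'I_n}) env sg :
  (forall i, env (xv (inl i)) = s i) -> reads sg -> holds sg =1 T ->
  let sg' := sem n env checkp sg in
  holds sg' =1 T /\ sg' (inr tR) 0 = sg (inr tR) 0 && completable T s.
Proof.
move=> es rd hT; rewrite /checkp; cbn [sem]; rewrite [idx _ _ _]/=.
set sg1 := updd _ _ _ _; set sg2 := sem n env (fors xJ lookp) sg1.
have hT1 : holds sg1 =1 T.
  by move=> w; rewrite holds_other // -val_eqE /= !inordK.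
have R1 : sg1 (inr tR) 0 = sg (inr tR) 0.
  by rewrite /sg1 /updd -[_ == inr tO]/(tR == tO) -val_eqE /= !inordK.
have tupE env' : agree n xJ env env' -> exists x, (forall i, env' (xv i) = x i) /\
    forall i, x (inl i) = s i.
  case=> h1 h2; have hl i : env' (xv (inl i)) = s i.
    by rewrite h1 ?es //; apply/mapP => -[].
  have [|x ex] := @env_tup xv env'.
    case=> i; first by rewrite hl.
    by apply: h2; apply/mapP; exists i; rewrite ?mem_enum.
  by exists x; split=> // i; apply: val_inj; rewrite /= -ex hl.
pose P0 sg' := [/\ reads sg', holds sg' =1 T & sg' (inr tR) 0 = sg (inr tR) 0].
have keep env' : agree n xJ env env' -> forall sg', P0 sg' -> P0 (sem n env' lookp sg').
  move=> /tupE[x [ex _]] sg' [rd' h' r']; have [E1 E2 _] := run_look ex rd'.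
  split; [exact: reads_sem| |by rewrite E2].
  by move=> w; rewrite /holds E1; apply: h'.
have Psg1 : P0 sg1 by [].
have [rd2 hT2 R2] : P0 sg2 by apply: fors_inv.
have -> : completable T s = sg2 (inr tO) 0.
  apply/idP/idP => [/existsP[w /and3P[Tw pw /forallP ws]]|].
    pose env0 v := match v with inl (inl (inl i)) => (w i : nat) | _ => env v end.
    apply: (fors_hit (P := P0) (Q := fun sg => sg (inr tO) 0) (env0 := env0)) => //.
    - move=> env' /tupE[x [ex _]] sg' [rd' _ _] h'.
      by have [_ _ ->] := run_look ex rd'; rewrite h'.
    - split=> [v|v /mapP[i _ ->]]; last exact: ltn_ord.
      case: v => [[[[i|i]|i]|t]|i] //= hv; first by rewrite (eqP (ws i)) -es.
      by case/negP: hv; apply/mapP; exists i; rewrite ?mem_enum.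
    - move=> sg' [rd' h' _]; have [|_ _ ->] := @run_look env0 w sg' _ rd'; first by [].
      by rewrite h' Tw pw orbT.
  pose P1 sg' := P0 sg' /\ (sg' (inr tO) 0 -> completable T s).
  suff [_] : P1 sg2 by [].
  apply: fors_inv => [env' ag sg' [p0' h']|].
    split; first exact: keep.
    have [x [ex xs']] := tupE _ ag; have [rd' hT' _] := p0'; have [_ _ ->] := run_look ex rd'.
    case/orP=> [/h' //|/andP[hx px]]; apply/existsP; exists x; rewrite -hT' hx px /=.
    by apply/forallP => i; rewrite xs'.
  by split=> //; rewrite /sg1 /updd !eqxx.
case: ifP => _; first by rewrite R2 andbT.
split; last by rewrite /= /updd !eqxx andbF.
by move=> w; rewrite /= holds_other // -val_eqE /= !inordK.
Qed.

Lemma run_prog sg : reads sg -> (forall t i, sg (inr t) i = false) ->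
  sem n (fun=> 0) prog sg (inr tR) 0 = query p0 pf q D.
Proof.
move=> rd z0; rewrite /prog; cbn [sem]; rewrite [idx _ _ _]/=.
set sg1 := sem _ _ initp _; set sg2 := sem _ _ closep _; set sg3 := updd _ _ _ _.
have rd1 : reads sg1 := reads_sem _ _ rd; have rd2 : reads sg2 := reads_sem _ _ rd1.
have h1 : forall w, holds sg1 w = p0 (pat D w) by apply: run_init => // w; apply: z0.
have h2 : holds sg2 =1 reach by apply: run_close.
have h3 : holds sg3 =1 reach by move=> w; rewrite holds_other // -val_eqE /= !inordK.
have r3 : sg3 (inr tR) 0 by rewrite /sg3 /updd !eqxx.
have queryE : query p0 pf q D = [forall s, completable reach s].
  apply: eq_forallb => s; apply/existsP/existsP.
    case=> x /existsP[y /and4P[px py ys cxy]]; exists y; rewrite py ys !andbT /reach.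
    by apply/existsP; exists x; rewrite px.
  case=> y /and3P[/existsP[x /andP[px cxy]] py ys]; exists x; apply/existsP; exists y.
  by rewrite px py ys.
have tupE env' : agree n xK (fun=> 0) env' -> exists s : {ffun K -> 'I_n}, forall i, env' (xv (inl i)) = s i.
  case=> _ h; have hl i : env' (xv (inl i)) < n by apply: h; apply/mapP; exists i; rewrite ?mem_enum.
  by exists [ffun i => Ordinal (hl i)] => i; rewrite ffunE.
pose P0 sg' := reads sg' /\ holds sg' =1 reach.
have keep env' : agree n xK (fun=> 0) env' -> forall sg', P0 sg' -> P0 (sem n env' checkp sg').
  move=> /tupE[s es] sg' [rd' h']; have [h _] := run_check es rd' h'.
  by split=> //; apply: reads_sem.
rewrite queryE; case: forallP => [hall|/forallP].
  pose P1 sg' := P0 sg' /\ sg' (inr tR) 0.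
  suff [_ ->] : P1 (sem n (fun=> 0) (fors xK checkp) sg3) by [].
  apply: fors_inv => [env' ag sg' [p' r']|//]; split; first exact: keep.
  have [s es] := tupE _ ag; have [rd' h'] := p'; have [_ ->] := run_check es rd' h'.
  by rewrite r' hall.
rewrite negb_forall => /existsP[s ns].
pose env0 (v : var) := if v is inl (inl (inl (inl i))) then (s i : nat) else 0.
pose Q0 (sg' : store tab) := sg' (inr tR) 0 = false.
suff : Q0 (sem n (fun=> 0) (fors xK checkp) sg3) by [].
apply: (fors_hit (P := P0) (env0 := env0)) => //.
- move=> env' /tupE[s' es] sg' [rd' h'] r'; rewrite /Q0; have [_ ->] := run_check es rd' h'.
  by rewrite r'.
- split=> [v|v /mapP[i _ ->]]; last exact: ltn_ord.
  case: v => [[[[i|i]|i]|t]|i] //= hv.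
  by case/negP: hv; apply/mapP; exists i; rewrite ?mem_enum.
- move=> sg' [rd' h']; rewrite /Q0; have [|_ ->] := @run_check _ s env0 sg' _ rd' h'; first by [].
  by rewrite (negbTE ns) andbF.
Qed.

End Run.
End Program.

Lemma nth_allpairs (S T U : Type) (f : S -> T -> U) s t x0 y0 z0 i j :
  i < size s -> j < size t ->
  nth z0 [seq f x y | x <- s, y <- t] (i * size t + j) = f (nth x0 s i) (nth y0 t j).
Proof.
elim: s i => [|x s IH] [|i] //= hi hj; rewrite nth_cat size_map.
  by rewrite mul0n add0n hj (nth_map y0).
by rewrite mulSn -addnA ltnNge leq_addr /= addKn IH.
Qed.

Lemma size_encode n (D : rel 'I_n) : size (encode D) = n * n.
Proof. by rewrite size_allpairs size_enum_ord. Qed.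

Lemma reads_encode n (D : rel 'I_n) (A : finType) (a b : 'I_n) :
  @input_store A (encode D) (inl false) (a * n + b) = D a b.
Proof.
have := @nth_allpairs _ _ _ D (enum 'I_n) (enum 'I_n) a b false a b.
by rewrite size_enum_ord !nth_ord_enum /=; apply.
Qed.

Theorem theorem2p4 (k l : nat) (hk : 2 <= k) (hl : 2 <= l) :
  exists (M : TM) (c : nat),
    forall (n : nat) (D : rel 'I_n),
      loopless D -> semicomplete D -> k <= n ->
      tm_result M (encode D) (c * (size (encode D)) ^ c + c)
        = Some (l <= kappa_k D k).
Proof.
pose R := 2 * k; pose w := 3 * (l * R) + 2; pose g := 3 * k + 2 * k * w.+2.
pose B := (l * R) * (l * R) * (w.+2 + l * R + 1).
pose p0 := @init_pat k l R g w B; pose pf := @final_pat k l R g w B.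
pose q := @step_pat k l R g w B.
have [e he] := main_result tR (wf_prog p0 pf q).
exists (toTM (main_frag (prog p0 pf q) tR) (empty_cell _ _) (bit_cell _ _ false) (bit_cell _ _ true)), e.+1.
move=> n D _ semi kn; have n1 : 1 < n := leq_trans hk kn.
rewrite (he _ n) ?size_encode //.
  congr Some; rewrite (kappa_query hk (ltnW hl) semi kn); apply: run_prog => //.
  exact: reads_encode.
(* For [n >= 2] one has [n + 2 <= n * n], so the time is bounded by a power of the input length. *)
have h : n.+2 ^ e <= (n * n) ^ e.+1.
  apply: leq_trans (_ : (n * n) ^ e <= _); last by rewrite leq_pexp2l // muln_gt0 (ltnW n1).
  by case: (e) => // e'; rewrite leq_exp2r //; nia.
by rewrite mulSn -addnA (leq_trans h) // leq_addr.
Qed.
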